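(* Consider the following two assertions about a skew shape $\mu/\nu$ and an integer $n\ge\ell(\mu/\nu)$. (P1) For every $\lambda\vdash n$, the monomial immanant $\phi^\lambda[H_{\mu/\nu}]$ of the $n\times n$ Jacobi-Trudi matrix $H_{\mu/\nu}$ is Schur-positive (equivalently, for every $\theta\vdash|\mu/\nu|$, the immanant character $\Gamma^\theta_{\mu/\nu}$ of $S_n$ is the character of a permutation representation of $S_n$ whose transitive components are each isomorphic to the action of $S_n$ on cosets of a Young subgroup). (P2) For every $\theta\vdash|\mu/\nu|$, the immanant character $\Gamma^\theta_{\mu/\nu}$ of $S_n$ is a non-negative integral sum of Stanley-Stembridge characters of $S_n$. If (P1) and (P2) hold for all pairs $(\mu/\nu,n)$ such that $\mu/\nu$ is connected and $n=\ell(\mu/\nu)$, then (P1) and (P2) hold for all skew shapes $\mu/\nu$ and all $n\ge\ell(\mu/\nu)$.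
   Context: Partitions are weakly decreasing sequences of positive integers, extended by zeros when needed ($\nu$ may be empty). A skew shape $\mu/\nu$ is a pair of partitions with $\nu_i\le\mu_i$ for all $i$, of positive size $|\mu/\nu|=\sum_i(\mu_i-\nu_i)$; its diagram is the Young diagram of $\mu$ with the boxes of $\nu$ removed; its length $\ell(\mu/\nu)$ is the largest $i$ with $\nu_i<\mu_i$. It is connected if its diagram is connected (boxes adjacent when sharing an edge) and has no empty rows among rows $1,\ldots,\ell(\mu/\nu)$. For $\theta\vdash N$ and an integer sequence $c=(c_1,\ldots,c_n)$ summing to $N$, $K_{\theta,c}$ is the number of semistandard Young tableaux of shape $\theta$ with content $c$; it is $0$ if some $c_i<0$. For $n\ge\ell(\mu/\nu)$ let $\delta=(n-1,\ldots,1,0)$, regard $\mu,\nu$ as their first $n$ entries, and let $w\in S_n$ act by $w(a_1,\ldots,a_n)=(a_{w^{-1}(1)},\ldots,a_{w^{-1}(n)})$. For $\theta\vdash N=|\mu/\nu|$ the immanant character $\Gamma^\theta_{\mu/\nu}:S_n\to\mathbb{Z}$ is $$\Gamma^\theta_{\mu/\nu}(w)=\frac{n!}{|C(w)|}\sum_{w'\in C(w)}K_{\theta,\ \mu+\delta-w'(\nu+\delta)},$$ where $C(w)$ is the conjugacy class of $w$. A Stanley-Stembridge character of $S_n$ is an immanant character $\Gamma^{(M)}_{\alpha/\beta}$ of $S_n$ with $\alpha/\beta$ a skew shape of length at most $n$ and $M=|\alpha/\beta|$ (one-row partition $(M)$; $M$ may vary among summands). The $n\times n$ Jacobi-Trudi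 matrix is $H_{\mu/\nu}=[h_{\mu_i-\nu_j+j-i}]_{1\le i,j\le n}$ with $h_r$ the complete homogeneous symmetric functions, $h_0=1$, $h_r=0$ for $r<0$. For a virtual character (integer-valued class function) $\chi$ of $S_n$ and a matrix $M=[m_{ij}]$, the immanant is $\chi[M]=\sum_{w\in S_n}\chi(w)m_{1,w(1)}\cdots m_{n,w(n)}$. The monomial virtual character $\phi^\lambda$ of $S_n$ is the preimage of the monomial symmetric function $m_\lambda$ under the Frobenius characteristic map $\mathrm{Frob}(\chi)=\frac{1}{n!}\sum_{w\in S_n}\chi(w)p_{\mathrm{type}(w)}$. A symmetric function is Schur-positive if its coefficients in the Schur basis are all non-negative. A Young subgroup of $S_n$ is the subgroup preserving each block of a set partition of $[n]$. *)

(* Defs.v *)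
From HB Require Import structures.
From mathcomp Require Import all_boot all_order all_fingroup all_algebra.
From mathcomp.multinomials Require Export mpoly.

Set Implicit Arguments.
Unset Strict Implicit.
Unset Printing Implicit Defensive.

Import GRing.Theory Num.Theory.

Local Open Scope ring_scope.

(* Rows, columns, parts and tableau entries are numbered from 0. *)

Definition is_partition (la : seq nat) : bool := sorted geq la && (0%N \notin la).

Definition partition_of (N : nat) (la : seq nat) : bool :=
  is_partition la && (sumn la == N).

Definition part (la : seq nat) (i : nat) : nat := nth 0%N la i.

Definition skew_size (mu nu : seq nat) : nat :=
  (\sum_(i < size mu) (part mu i - part nu i))%N.

Definition skew_shape (mu nu : seq nat) : Prop :=
  [/\ is_partition mu, is_partition nu,
      (forall i, part nu i <= part mu i)%N & (0 < skew_size mu nu)%N].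

Definition skew_length (mu nu : seq nat) : nat :=
  \max_(i < size mu | (part nu i < part mu i)%N) i.+1.

Definition in_diagram (mu nu : seq nat) (b : nat * nat) : bool :=
  (part nu b.1 <= b.2 < part mu b.1)%N.

Definition adjacent (b c : nat * nat) : bool :=
  ((b.1 == c.1) && ((b.2 == c.2.+1) || (c.2 == b.2.+1)))
  || ((b.2 == c.2) && ((b.1 == c.1.+1) || (c.1 == b.1.+1))).

Definition connected_skew (mu nu : seq nat) : Prop :=
  (forall b c, in_diagram mu nu b -> in_diagram mu nu c ->
     exists2 p : seq (nat * nat),
       path adjacent b p && all (in_diagram mu nu) p & last b p = c)
  /\ (forall i, (i < skew_length mu nu)%N -> (part nu i < part mu i)%N).

(* The boxes (row, column) of the Young diagram of th. *)
Definition box (th : seq nat) : finType := {i : 'I_(size th) & 'I_(part th i)}.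

Definition brow (th : seq nat) (b : box th) : nat := tag b.
Definition bcol (th : seq nat) (b : box th) : nat := tagged b.

Definition is_ssyt (th : seq nat) (N : nat) (T : {ffun box th -> 'I_N}) : bool :=
  [forall b, forall c,
     ((brow b == brow c) && (bcol b < bcol c)%N ==> (T b <= T c)%N)
     && ((bcol b == bcol c) && (brow b < brow c)%N ==> (T b < T c)%N)].

Definition kostka (th : seq nat) (n : nat) (c : 'I_n -> int) : nat :=
  #|[set T : {ffun box th -> 'I_n} | is_ssyt T &
      [forall i, (#|[set b | T b == i]|)%:Z == c i]]|.

Definition delta (n : nat) (i : 'I_n) : nat := (n - i.+1)%N.

(* mu + delta - w (nu + delta), where (w a)_i = a_(w^-1 i) *)
Definition jt_content (mu nu : seq nat) (n : nat) (w : 'S_n) (i : 'I_n) : int :=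
  (part mu i + delta i)%:Z
  - (part nu ((w^-1)%g i) + delta ((w^-1)%g i))%:Z.

(* The quotient n! %/ #|C(w)| is exact: it is the order of the centraliser. *)
Definition immanant_char (th mu nu : seq nat) (n : nat) (w : 'S_n) : int :=
  let C := (w ^: [set: 'S_n])%g in
  ((n`! %/ #|C|) * \sum_(w' in C) kostka th (jt_content mu nu w'))%N%:Z.

Definition stanley_stembridge (n : nat) (chi : 'S_n -> int) : Prop :=
  exists al be : seq nat,
    [/\ skew_shape al be, (skew_length al be <= n)%N
      & chi =1 immanant_char [:: skew_size al be] al be (n := n)].

(* A symmetric function (with rational coefficients) is represented by the
   family of its restrictions to N variables, for all N, as in the description
   of the ring of symmetric functions as an inverse limit. Ring operations and
   equality are meant componentwise. *)
Definition symfun : Type := forall N : nat, {mpoly rat[N]}.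

Definition psym (k : nat) : symfun := fun N => \sum_(i < N) 'X_i ^+ k.

Definition hsym (r : int) : symfun := fun N =>
  if r is Posz d then \sum_(m : 'X_{1..N < d.+1} | mdeg m == d) 'X_[m] else 0.

(* Sum of the distinct monomials whose nonzero exponents rearrange to la. *)
Definition msym (la : seq nat) : symfun := fun N =>
  \sum_(m : 'X_{1..N < (sumn la).+1} |
        perm_eq [seq e <- (m : 'X_{1..N}) | e != 0%N] la) 'X_[m].

Definition schur (th : seq nat) : symfun := fun N =>
  \sum_(T : {ffun box th -> 'I_N} | is_ssyt T) \prod_(b : box th) 'X_(T b).

(* The coefficient family c is independent of the number N of variables. *)
Definition schur_positive (f : symfun) : Prop :=
  exists (s : seq (seq nat)) (c : seq nat -> rat),
    [/\ uniq s, all is_partition s, (forall th, th \in s -> 0 <= c th)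
      & forall N, f N = \sum_(th <- s) c th *: schur th N].

Definition class_function (n : nat) (chi : 'S_n -> int) : Prop :=
  forall x y : 'S_n, chi (x ^ y)%g = chi x.

Definition frob (n : nat) (chi : 'S_n -> int) : symfun := fun N =>
  (n`!%:R)^-1 *:
    \sum_(w : 'S_n) (chi w)%:~R *: \prod_(O in porbits w) psym #|O| N.

(* phi is the virtual character phi^la, i.e. the preimage of m_la under the
   Frobenius characteristic map (which is injective on class functions). *)
Definition monomial_vchar (la : seq nat) (n : nat) (phi : 'S_n -> int) : Prop :=
  class_function phi /\ forall N, frob phi N = msym la N.

Definition immanant (R : comNzRingType) (n : nat) (chi : 'S_n -> int)
    (M : 'M[R]_n) : R :=
  \sum_(w : 'S_n) (chi w)%:~R * \prod_(i < n) M i (w i).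

Definition jacobi_trudi (mu nu : seq nat) (n N : nat) : 'M[{mpoly rat[N]}]_n :=
  \matrix_(i < n, j < n)
    hsym ((part mu i)%:Z - (part nu j)%:Z + (j : nat)%:Z - (i : nat)%:Z) N.

Definition P1 (mu nu : seq nat) (n : nat) : Prop :=
  forall (la : seq nat) (phi : 'S_n -> int),
    partition_of n la -> monomial_vchar la phi ->
    schur_positive (fun N => immanant phi (jacobi_trudi mu nu n N)).

Definition P2 (mu nu : seq nat) (n : nat) : Prop :=
  forall th : seq nat, partition_of (skew_size mu nu) th ->
    exists (k : nat) (chi : 'I_k -> 'S_n -> int),
      (forall a, stanley_stembridge (chi a))
      /\ forall w : 'S_n,
           immanant_char th mu nu w = \sum_(a < k) chi a w.

(* Main.v *)
(** If [mu_(k+1) <= nu_k], the Jacobi-Trudi matrix of [mu/nu] is block upper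
    triangular, with diagonal blocks the matrices of the first [k] and of the
    remaining rows; an empty row always allows such a splitting unless it is the
    only row. If there is no splitting, consecutive rows overlap and the shape
    is connected. So it suffices to treat one split.

    For (P1), the restriction of [phi^la] to the block subgroup is the sum of
    [phi^la1 x phi^la2] over [la = la1 u la2], since [phi^la w] is the coefficient
    of [h_la] in the power sum of the cycle type of [w]. The immanant is hence a
    sum of products of immanants of the blocks, and products of Schur functions
    are Schur-positive.

    For (P2), [K_(th,(c1,c2))] is a nonnegative combination, independent of [c1]
    and [c2], of the products [K_(th1,c1) K_(th2,c2)]. The immanant character is
    hence a sum of characters induced from products of immanant characters of the
    blocks; and the character induced from two Stanley-Stembridge characters
    belongs to the shape obtained by gluing, far enough apart, the two shapes.

    Both positivity facts are instances of the Littlewood-Richardson rule for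
    skew shapes, proved by Stembridge's sign-reversing involution. *)

Require Import Defs.
From mathcomp Require Import all_boot all_order all_fingroup all_algebra.
From mathcomp Require Import zify ring.

Set Implicit Arguments.
Unset Strict Implicit.
Unset Printing Implicit Defensive.

Import GRing.Theory Num.Theory.

Local Open Scope ring_scope.

(** The blocks of a split need not be skew shapes: one of them starts in the middle of the row
    sequences, and either may have no box at all. The induction therefore runs over pairs of
    row-length functions [a], [b], with (P1) and (P2) restated for these; partitions come in only at
    the two ends. The identification of phi^la rests on one computation: over the Young subgroup of
    a colouring with class sizes c_i, the power sums of the cycle types add up to the product of the
    c_i! h_(c_i). So the coefficient of h_la has the same sums over Young subgroups as phi^la, and
    these sums determine a class function. The Littlewood-Richardson rule is proved for s_la
    s_(mu/nu), after multiplication by the Vandermonde alternant. With nu empty it gives products of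
    Schur functions. With la empty it expands the Kostka numbers of th/nu, where nu is the shape
    filled by the letters of the first block. *)

(** * Tableaux as chains of partitions *)

(* A tableau of shape [mu/nu] with entries below [N] is encoded by the shapes of its
   subtableaux of entries below [k], for [k <= N]: row [i] of the [k]-th shape has
   [level T k i] boxes. Rows beyond [R] are empty; levels beyond [N] repeat the last. *)
Definition chain (N R D : nat) := {ffun 'I_N.+1 * 'I_R.+1 -> 'I_D.+1}.

Definition level N R D (T : chain N R D) (k i : nat) : nat :=
  if (i <= R)%N then (T (inord (minn k N), inord i) : nat) else 0%N.

Definition mkchain N R D (g : nat -> nat -> nat) : chain N R D :=
  [ffun p : 'I_N.+1 * 'I_R.+1 => inord (g p.1 p.2)].
Arguments mkchain : clear implicits.

Definition is_chain N R D (nu mu : nat -> nat) (T : chain N R D) : bool :=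
  [&& [forall i : 'I_R.+1, level T 0 i == nu i],
      [forall i : 'I_R.+1, level T N i == mu i]
    & [forall k : 'I_N, forall i : 'I_R.+1,
        (level T k.+1 i.+1 <= level T k i <= level T k.+1 i)%N]].

Section Chains.
Variables (N R D : nat).
Implicit Types (T U : chain N R D) (nu mu : nat -> nat).
Local Open Scope nat_scope.

Lemma level_le T k i : level T k i <= D.
Proof. by rewrite /level; case: ifP => // _; rewrite -ltnS. Qed.

Lemma level_out T k i : R < i -> level T k i = 0.
Proof. by move=> iR; rewrite /level leqNgt iR. Qed.

Lemma level_mk g k i : (forall k i, g k i <= D) -> k <= N -> i <= R ->
  level (mkchain N R D g) k i = g k i.
Proof.
move=> gD kN iR; rewrite /level iR ffunE /= (minn_idPl kN).
by rewrite !inordK // ltnS.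
Qed.

Lemma eq_chain T U : (forall k i, k <= N -> i <= R -> level T k i = level U k i) ->
  T = U.
Proof.
move=> e; apply/ffunP => -[k i].
have kN : k <= N by rewrite -ltnS.
have iR : i <= R by rewrite -ltnS.
by move: (e k i kN iR); rewrite /level iR (minn_idPl kN) !inord_val => /val_inj.
Qed.

Lemma chainP nu mu T :
  reflect [/\ forall i, i <= R -> level T 0 i = nu i,
              forall i, i <= R -> level T N i = mu i
            & forall k i, k < N -> level T k.+1 i.+1 <= level T k i <= level T k.+1 i]
          (is_chain nu mu T).
Proof.
apply: (iffP and3P) => [[/forallP h0 /forallP h1 /forallP h2]|[h0 h1 h2]]; split.
- by move=> i iR; move/eqP: (h0 (inord i)); rewrite inordK.
- by move=> i iR; move/eqP: (h1 (inord i)); rewrite inordK.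
- move=> k i kN; case: (leqP i R) => iR.
    by move/forallP/(_ (inord i)): (h2 (Ordinal kN)); rewrite inordK.
  by rewrite !level_out // ltnW.
- by apply/forallP => i; rewrite h0 // -ltnS.
- by apply/forallP => i; rewrite h1 // -ltnS.
- by apply/forallP => k; apply/forallP => i; apply: h2.
Qed.

Lemma chain_mono nu mu T k l i : is_chain nu mu T -> k <= l <= N ->
  level T k i <= level T l i.
Proof.
case/chainP => _ _ h /andP[kl lN]; elim: l kl lN => [|l IH] kl lN.
  by move: kl; rewrite leqn0 => /eqP ->.
move: kl; rewrite leq_eqVlt => /orP[/eqP->//|kl].
apply: leq_trans (IH kl (ltnW lN)) _.
by case/andP: (h l i lN).
Qed.

(** Boxes of the k-th shape in the columns j, j+1, ...; [trunc] counts those before column j. Both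
    include the boxes of [nu], which cancel in differences of successive levels. *)
Definition excess T j k := \sum_(i < R.+1) (level T k i - j).
Definition trunc T j k := \sum_(i < R.+1) minn (level T k i) j.
Definition area T k := \sum_(i < R.+1) level T k i.
Definition weight T k := area T k.+1 - area T k.

Lemma areaE T j k : area T k = excess T j k + trunc T j k.
Proof. by rewrite -big_split; apply: eq_bigr => i _ /=; lia. Qed.

Lemma area_mono nu mu T k : is_chain nu mu T -> k < N -> area T k <= area T k.+1.
Proof.
by move=> h kN; apply: leq_sum => i _; apply: chain_mono h _; rewrite leqnSn.
Qed.

Lemma weightE nu mu T k : is_chain nu mu T -> k < N ->
  area T k + weight T k = area T k.+1.
Proof. by move=> h kN; rewrite subnKC //; apply: area_mono h _. Qed.

(* Box (i, j) has entry k iff [level T k i <= j < level T k.+1 i]. *)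
Definition colcount T j k := \sum_(i < R.+1) (level T k i <= j < level T k.+1 i).

(** The letters k from column j on are those from column j+1 on and those of column j, written
    without subtraction. *)
Lemma excessS nu mu T j k : is_chain nu mu T -> k < N ->
  excess T j k.+1 + excess T j.+1 k =
  excess T j.+1 k.+1 + excess T j k + colcount T j k.
Proof.
move=> h kN; rewrite -!big_split; apply: eq_bigr => i _ /=.
have := chain_mono i h (_ : k <= k.+1 <= N); rewrite leqnSn kN => /(_ isT).
by case: leqP; case: leqP => /=; lia.
Qed.

(** The boxes of one letter form a horizontal strip: by interlacing, those of a lower row end before
    those of a higher row begin. *)
Lemma colcount_le1 nu mu T j k : is_chain nu mu T -> k < N -> colcount T j k <= 1.
Proof.
move=> /chainP[_ _ h] kN.
have dec i i' : i < i' -> level T k.+1 i' <= level T k i.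
  elim: i' => // i' IH; rewrite ltnS leq_eqVlt => /orP[/eqP->|].
    by case/andP: (h k i' kN).
  move=> /IH; apply: leq_trans; apply: leq_trans (_ : level T k i' <= _).
    by case/andP: (h k i' kN).
  by case/andP: (h k i' kN).
rewrite /colcount; case: (pickP (fun i : 'I_R.+1 => level T k i <= j < level T k.+1 i)).
  move=> i Pi; rewrite (bigD1 i) //= Pi big1 ?addn0 // => i' ne.
  case: (ltngtP i i') => [lt|gt|eq]; last by rewrite (val_inj eq) eqxx in ne.
    by have := dec _ _ lt; case/andP: Pi; case: leqP; case: leqP => //=; lia.
  by have := dec _ _ gt; case/andP: Pi; case: leqP; case: leqP => //=; lia.
by move=> P0; rewrite big1 // => i _; rewrite P0.
Qed.

Lemma colcount0 T j k : colcount T j k = 0 ->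
  forall i, i <= R -> level T k.+1 i <= j \/ j < level T k i.
Proof.
move=> h i iR; have iR1 : i < R.+1 by [].
move/eqP: h; rewrite sum_nat_eq0 => /forallP /(_ (Ordinal iR1)) /=.
rewrite eqb0; lia.
Qed.

(* The Bender-Knuth move of the letters k and k+1 inside the first j columns;
   boxes further right are untouched. *)
Definition toggle_lo T k i := maxn (level T k i) (level T k.+2 i.+1).
Definition toggle_hi T k i :=
  if i is i'.+1 then minn (level T k.+2 i) (level T k i') else level T k.+2 0.
Definition toggle T j k : chain N R D :=
  mkchain N R D (fun l i =>
    if (l == k.+1) && (level T l i <= j)
    then minn D (toggle_lo T k i + minn (toggle_hi T k i) j - level T k.+1 i)
    else level T l i).

Section Toggle.
Variables (nu mu : nat -> nat) (T : chain N R D) (j k : nat).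
Hypotheses (hT : is_chain nu mu T) (kN : k.+1 < N).

Lemma toggle_bounds i : toggle_lo T k i <= level T k.+1 i <= toggle_hi T k i.
Proof.
case/chainP: hT => _ _ h; rewrite /toggle_lo /toggle_hi.
have := h k i (ltnW kN); have := h k.+1 i kN.
by case: i => [|i]; last have := h k i (ltnW kN); lia.
Qed.

(** A row is reflected in the interval from [toggle_lo] to min([toggle_hi], j), where its letters k
    and k+1 are free to change. The cap at [D] in [toggle] only keeps the values in range for
    arbitrary arguments; on a chain [toggle_bounds] makes it inactive. *)
Lemma level_toggle l i : l <= N -> i <= R ->
  level (toggle T j k) l i =
    if (l == k.+1) && (level T l i <= j)
    then toggle_lo T k i + minn (toggle_hi T k i) j - level T k.+1 i
    else level T l i.
Proof.
move=> lN iR; rewrite /toggle level_mk //; last first.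
  by move=> l' i'; case: ifP => _; rewrite ?geq_minl ?level_le.
case: eqP => //= -> {l lN}; case: ifP => // lj.
apply/minn_idPr; have := toggle_bounds i.
have : toggle_hi T k i <= D.
  by rewrite /toggle_hi; case: (i) => [|i']; rewrite ?geq_min level_le.
lia.
Qed.

Lemma level_toggle_ne l i : l <= N -> l != k.+1 ->
  level (toggle T j k) l i = level T l i.
Proof.
move=> lN lk; case: (leqP i R) => iR; last by rewrite !level_out.
by rewrite level_toggle // (negbTE lk).
Qed.

Lemma toggle_lohi i : toggle_lo (toggle T j k) k i = toggle_lo T k i
  /\ toggle_hi (toggle T j k) k i = toggle_hi T k i.
Proof.
rewrite /toggle_lo /toggle_hi; split; last case: i => [|i];
  rewrite !level_toggle_ne //; lia.
Qed.

Lemma toggle_is_chain : is_chain nu mu (toggle T j k).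
Proof.
have lo l i : l < N -> level (toggle T j k) l.+1 i.+1 <= level (toggle T j k) l i
    <= level (toggle T j k) l.+1 i.
  move=> lN; case/chainP: hT => _ _ h.
  case: (leqP i R) => iR; last by rewrite !level_out // ltnW.
  have [lk|lk] := eqVneq l k.
    subst l; rewrite [level _ k i]level_toggle_ne; [|lia|lia].
    rewrite [level _ k.+1 i]level_toggle // eqxx /=.
    have hb := toggle_bounds i; have hb1 := toggle_bounds i.+1.
    have hi := h k i (ltnW kN).
    apply/andP; split; last first.
      case: ifP => lj; last by case/andP: hi.
      by move: hb; rewrite /toggle_lo; lia.
    case: (leqP i.+1 R) => i1R; last by rewrite level_out.
    rewrite level_toggle // eqxx /=; case: ifP => lj; last by case/andP: hi.
    by move: hb1; rewrite /toggle_hi; lia.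
  have [lk1|lk1] := eqVneq l k.+1.
    subst l; rewrite [level _ k.+2 i]level_toggle_ne //.
    rewrite [level _ k.+2 i.+1]level_toggle_ne //.
    rewrite level_toggle ?eqxx /=; [|lia|lia].
    have hb := toggle_bounds i; have hi := h k.+1 i kN.
    case: ifP => // lj.
    by move: hb lj hi; rewrite /toggle_lo /toggle_hi; case: (i) => [|i']; lia.
  by rewrite !level_toggle_ne ?h //; lia.
apply/chainP; case/chainP: (hT) => h0 hN h; split=> //.
- by move=> i iR; rewrite level_toggle_ne ?h0.
- by move=> i iR; rewrite level_toggle_ne ?hN //; lia.
Qed.

Lemma toggleK : toggle (toggle T j k) j k = T.
Proof.
apply: eq_chain => l i lN iR.
have hk : k.+1 <= N by lia.
have e : forall l', l' <= N -> level (toggle (toggle T j k) j k) l' i =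
    if (l' == k.+1) && (level (toggle T j k) l' i <= j)
    then toggle_lo T k i + minn (toggle_hi T k i) j - level (toggle T j k) k.+1 i
    else level (toggle T j k) l' i.
  move=> l' l'N; rewrite {1}/toggle level_mk //; last first.
    by move=> l'' i'; case: ifP => _; rewrite ?geq_minl ?level_le.
  have [-> ->] := toggle_lohi i.
  case: eqP => //= -> {l' l'N}; case: ifP => // lj.
  apply/minn_idPr; have := toggle_bounds i.
  have : toggle_hi T k i <= D.
    by rewrite /toggle_hi; case: (i) => [|i']; rewrite ?geq_min level_le.
  move: lj; rewrite level_toggle // eqxx /=.
  by case: ifP; lia.
rewrite e // !level_toggle // eqxx /=.
case: eqP => //= ->; have := toggle_bounds i.
by case: ifP; case: ifP; lia.
Qed.

(** A row that moves ends within the first j columns, before and after the move. *)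
Lemma excess_toggle l j' : l <= N -> j <= j' ->
  excess (toggle T j k) j' l = excess T j' l.
Proof.
move=> lN jj; apply: eq_bigr => i _.
have iR : i <= R by rewrite -ltnS.
rewrite level_toggle //; case: eqP => //= ->.
by have := toggle_bounds i; case: ifP; lia.
Qed.

Lemma area_toggle_ne l : l <= N -> l != k.+1 -> area (toggle T j k) l = area T l.
Proof. by move=> lN lk; apply: eq_bigr => i _; rewrite level_toggle_ne. Qed.

(** [toggle_lo] of row i and [toggle_hi] of row i+1 are the maximum and the minimum of the same two
    levels, so the sum over all rows telescopes. *)
Lemma trunc_lohi :
  \sum_(i < R.+1) (minn (toggle_lo T k i) j + minn (toggle_hi T k i) j)
  = trunc T j k + trunc T j k.+2.
Proof.
(* The upper bound of row n is paired with the lower bound of row n-1, hence the lag of one row; at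
   the end row [R.+1] is empty. *)
have e n : \sum_(i < n) (minn (toggle_lo T k i) j + minn (toggle_hi T k i) j)
    + minn (toggle_hi T k n) j
    = \sum_(i < n) minn (level T k i) j + \sum_(i < n.+1) minn (level T k.+2 i) j.
  elim: n => [|n IH]; first by rewrite !big_ord0 big_ord_recr big_ord0.
  rewrite big_ord_recr [X in _ = X + _]big_ord_recr [X in _ = _ + X]big_ord_recr /=.
  have -> : toggle_lo T k n = maxn (level T k n) (level T k.+2 n.+1) by [].
  move: IH; do 3! [move: (\sum_(i < _) _) => ?]; move: (toggle_hi T k n) => h.
  by lia.
have := e R.+1; rewrite [X in _ = _ + X]big_ord_recr /= (level_out T k.+2) //.
by rewrite min0n !min0n !addn0.
Qed.

(** Before column j the move exchanges the numbers of letters k and k+1. When no letter k stands in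
    column j, a row left unmoved has its level k beyond j, so that it too satisfies the reflection
    formula truncated at j. *)
Lemma trunc_toggle : colcount T j k = 0 ->
  trunc T j k.+1 + trunc (toggle T j k) j k.+1 = trunc T j k + trunc T j k.+2.
Proof.
move=> c0; rewrite -trunc_lohi -big_split; apply: eq_bigr => i _ /=.
have iR : i <= R by rewrite -ltnS.
have hk : k.+1 <= N by lia.
have := toggle_bounds i; have := colcount0 c0 iR; rewrite level_toggle // eqxx /=.
by rewrite /toggle_lo /toggle_hi; case: ifP; lia.
Qed.

End Toggle.
End Chains.

(** * Symmetry of the weight distribution *)

Definition nonincr (a : nat -> nat) : Prop := forall i, (a i.+1 <= a i)%N.

Lemma nonincr_le a i j : nonincr a -> (i <= j)%N -> (a j <= a i)%N.
Proof.
move=> ha; elim: j => [|j IH]; first by rewrite leqn0 => /eqP ->.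
by rewrite leq_eqVlt => /orP[/eqP->//|/IH]; apply: leq_trans.
Qed.

Definition fweight N R D (T : chain N R D) : {ffun 'I_N -> nat} :=
  [ffun k : 'I_N => weight T k].

Section Symmetry.
Variables (N R D : nat) (nu mu : nat -> nat) (V : nmodType).
Implicit Types (T : chain N R D) (F : {ffun 'I_N -> nat} -> V).

(** With j = D all columns take part: this is the ordinary Bender-Knuth involution. *)
Lemma fweight_toggle T (x y : 'I_N) : is_chain nu mu T -> y = x.+1 :> nat ->
  fweight (toggle T D x) = [ffun i => fweight T (tperm x y i)].
Proof.
move=> hT yx.
have kN : (x.+1 < N)%N by rewrite -yx.
have hT' := toggle_is_chain D hT kN.
have c0 : colcount T D x = 0%N.
  rewrite /colcount big1 // => i _.
  have := level_le T x.+1 i; lia.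
have := trunc_toggle hT kN c0.
have hx : (x.+1 <= N)%N by lia.
have := excess_toggle hT kN hx (leqnn D).
have ne l : (l <= N)%N -> l != x.+1 -> area (toggle T D x) l = area T l.
  by move=> *; apply: (area_toggle_ne _ hT kN).
have a0 := areaE T D x; have a1 := areaE T D x.+1; have a2 := areaE T D x.+2.
have a1' := areaE (toggle T D x) D x.+1.
have z k : excess T D k = 0%N.
  by rewrite /excess big1 // => i _; apply/eqP; rewrite subn_eq0 level_le.
rewrite !z in a0 a1 a2 * => e1; rewrite e1 in a1'.
move=> e2; apply/ffunP => i; rewrite !ffunE /weight.
case: tpermP => [->|->|/eqP n1 /eqP n2].
- by rewrite yx (ne x) //; lia.
- by rewrite yx (ne x.+2) //; lia.
- have iN := ltn_ord i.
  have n1' : i != x :> nat by [].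
  have n2' : i != y :> nat by [].
  by rewrite !ne //; lia.
Qed.

Lemma sum_fweight_adj (x y : 'I_N) F : y = x.+1 :> nat ->
  \sum_(T : chain N R D | is_chain nu mu T) F (fweight T) =
  \sum_(T : chain N R D | is_chain nu mu T) F [ffun i => fweight T (tperm x y i)].
Proof.
move=> yx; have kN : (x.+1 < N)%N by rewrite -yx.
have tK T : is_chain nu mu T -> toggle (toggle T D x) D x = T.
  by move=> hT; apply: toggleK hT kN.
rewrite (reindex_onto (fun T => toggle T D x) (fun T => toggle T D x)) /=; last first.
  by move=> T /tK.
apply: eq_big => [T|T /andP[h e]].
  apply/andP/idP => [[h /eqP <-]|h]; first exact: toggle_is_chain.
  by split; [exact: toggle_is_chain|rewrite tK].
rewrite (fweight_toggle _ yx) //.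
by rewrite -(eqP e); apply: toggle_is_chain.
Qed.

Lemma sum_fweight_perm (s : 'S_N) F :
  \sum_(T : chain N R D | is_chain nu mu T) F (fweight T) =
  \sum_(T : chain N R D | is_chain nu mu T) F [ffun i => fweight T (s i)].
Proof.
pose P (s : 'S_N) := forall F,
  \sum_(T : chain N R D | is_chain nu mu T) F (fweight T) =
  \sum_(T : chain N R D | is_chain nu mu T) F [ffun i => fweight T (s i)].
have P1 : P 1%g.
  move=> G; apply: eq_bigr => T _; congr G; apply/ffunP => i.
  by rewrite !ffunE perm1.
have PM s1 s2 : P s1 -> P s2 -> P (s1 * s2)%g.
  move=> h1 h2 G; rewrite h1 (h2 (fun f => G [ffun i => f (s1 i)])).
  by apply: eq_bigr => T _; congr G; apply/ffunP => i; rewrite !ffunE permM.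
(* A transposition of letters at distance d is conjugate, by an adjacent one, to a transposition at
   distance d-1. *)
have Ptperm d (x y : 'I_N) : y = (x + d)%N :> nat -> P (tperm x y).
  elim: d y => [|d IH] y yx.
    have -> : y = x by apply: val_inj; rewrite /= yx addn0.
    by rewrite tperm1.
  have zN : (x + d < N)%N by have := ltn_ord y; lia.
  pose z := Ordinal zN.
  have Pz : P (tperm z y) by move=> G; apply: sum_fweight_adj; rewrite yx addnS.
  case: d => [|d] in IH yx zN z Pz *.
    by have -> : x = z by apply: val_inj; rewrite /= addn0.
  have -> : tperm x y = (tperm z y * tperm x z * tperm z y)%g.
    rewrite -{1}[tperm z y]tpermV -mulgA -/(conjg _ _) tpermJ tpermL tpermD //.
      by apply/eqP => /(congr1 val) /=; lia.
    by apply/eqP => /(congr1 val) /=; lia.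
  by apply: (PM _ _ _ Pz); apply: (PM _ _ Pz); apply: IH.
have Pt (x y : 'I_N) : P (tperm x y).
  case: (leqP x y) => xy; first by apply: (@Ptperm (y - x)%N); lia.
  by rewrite tpermC; apply: (@Ptperm (x - y)%N); lia.
suff: P s by apply.
have [ts -> _] := prod_tpermP s.
by elim/big_ind: _ => // t _; apply: Pt.
Qed.

End Symmetry.

(** * Alternants *)

Definition alternant (N : nat) (a : nat -> nat) : {mpoly rat[N]} :=
  \det (\matrix_(i < N, j < N) 'X_i ^+ a j).

Lemma alternantE N a : alternant N a =
  \sum_(s : 'S_N) (-1) ^+ s * \prod_(i < N) 'X_i ^+ a (s i).
Proof.
apply: eq_bigr => s _; congr (_ * _).
by apply: eq_bigr => i _; rewrite mxE.
Qed.

Lemma eq_alternant N (a b : nat -> nat) : {in gtn N, a =1 b} ->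
  alternant N a = alternant N b.
Proof.
move=> ab; rewrite !alternantE; apply: eq_bigr => s _; congr (_ * _).
by apply: eq_bigr => i _; rewrite ab // inE.
Qed.

Lemma alternant_swap N (a b : nat -> nat) (x y : 'I_N) : x != y ->
  (forall i : 'I_N, b i = a (tperm x y i)) -> alternant N b = - alternant N a.
Proof.
move=> xy ab; rewrite !alternantE -sumrN.
rewrite (reindex_inj (mulIg (tperm x y))); apply: eq_bigr => s _ /=.
rewrite odd_permM odd_tperm xy addbT signrN mulNr; congr (- (_ * _)).
by apply: eq_bigr => i _; rewrite ab permM tpermK.
Qed.

Definition staircase (N k : nat) : nat := (N - k.+1)%N.

(** Up to the order of the columns this is the Vandermonde determinant of distinct variables. It is
    the factor cancelled in the Littlewood-Richardson rule. *)
Lemma staircase_neq0 N : alternant N (staircase N) != 0.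
Proof.
pose V : 'M[{mpoly rat[N]}]_N := Vandermonde N (\row_i 'X_i).
have -> : alternant N (staircase N) = \det (col_perm (perm rev_ord_inj) V^T).
  by congr (\det _); apply/matrixP => i j; rewrite !mxE permE.
rewrite col_permE det_mulmx det_tr det_perm det_Vandermonde mulf_neq0 ?signr_eq0 //.
apply/prodf_neq0 => i _; apply/prodf_neq0 => j ij.
rewrite !mxE subr_eq0; apply/eqP => /(congr1 (mcoeff U_(j))).
rewrite !mcoeffXU eqxx => /eqP; rewrite eq_sym.
by have /negbTE -> : i != j by rewrite neq_ltn ij.
Qed.

(** * Stembridge's sign-reversing involution *)

Section Stembridge.
Variables (N R D : nat) (la nu mu : nat -> nat).
Hypothesis hla : nonincr la.
Implicit Types (T : chain N R D).

(** From column j on, [la k] plus the number of letters k is less than [la k.+1] plus the number of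
    letters k+1. The differences of [excess] are moved across the inequality to avoid truncated
    subtraction. *)
Definition violates T (j k : nat) : bool :=
  (la k + excess T j k.+1 + excess T j k.+1
   < la k.+1 + excess T j k.+2 + excess T j k)%N.

(* Stembridge's condition: for every j, adding to [la] the content of the columns j, j+1, ...
   of [T] gives a partition. *)
Definition good T : bool :=
  [forall j : 'I_D.+1, forall k : 'I_N, (k.+1 < N)%N ==> ~~ violates T j k].

(** The rightmost violating column and, in it, the smallest letter. The toggle changes nothing from
    column j on, so it preserves this choice; that makes it an involution on the bad tableaux. *)
Definition first_violation T (p : 'I_D.+1 * 'I_N) : bool :=
  [&& (p.2.+1 < N)%N, violates T p.1 p.2,
      [forall j : 'I_D.+1, forall k : 'I_N,
         (p.1 < j)%N && (k.+1 < N)%N ==> ~~ violates T j k]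
    & [forall k : 'I_N, (k < p.2)%N ==> ~~ violates T p.1 k]].

Lemma first_violation_inj T p q : first_violation T p -> first_violation T q -> p = q.
Proof.
case: p q => [j k] [j' k'] /and4P[/= kN vk /forallP hj /forallP hk].
case/and4P => /= k'N vk' /forallP hj' /forallP hk'.
have jj : j = j'.
  apply: val_inj; case: (ltngtP j j') => // lt.
    by move/forallP/(_ k'): (hj j'); rewrite lt k'N vk'.
  by move/forallP/(_ k): (hj' j); rewrite lt kN vk.
subst j'; congr (_, _); apply: val_inj; case: (ltngtP k k') => // lt.
  by move: (hk' k); rewrite lt vk.
by move: (hk k'); rewrite lt vk'.
Qed.

Lemma first_violation_ex T : ~~ good T -> exists p, first_violation T p.
Proof.
rewrite negb_forall => /existsP[j0]; rewrite negb_forall => /existsP[k0].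
rewrite negb_imply negbK => vk0.
pose Q (j : 'I_D.+1) := [exists k : 'I_N, (k.+1 < N)%N && violates T j k].
have Qj0 : Q j0 by apply/existsP; exists k0.
case: (arg_maxnP (fun j : 'I_D.+1 => j : nat) Qj0) => j Qj jmax.
case/existsP: (Qj) => k1 Pk1.
pose Q' (k : 'I_N) := (k.+1 < N)%N && violates T j k.
case: (@arg_minnP _ k1 Q' (fun k : 'I_N => k : nat) Pk1) => k /andP[kN vk] kmin.
exists (j, k); apply/and4P; split=> //=.
  apply/forallP => j'; apply/forallP => k'; apply/implyP => /andP[lt k'N].
  apply/negP => v; have := jmax j' _; rewrite /= leqNgt lt => /(_ _)/negP; apply=> //.
  by apply/existsP; exists k'; rewrite k'N.
apply/forallP => k'; apply/implyP => lt; apply/negP => v.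
have k'N : (k'.+1 < N)%N by lia.
by have := kmin k'; rewrite /Q' k'N v leqNgt lt => /(_ isT).
Qed.

Lemma sum_first_violation (V : nmodType) (F : chain N R D -> V) :
  \sum_(T | is_chain nu mu T) F T =
  \sum_(T | is_chain nu mu T && good T) F T
  + \sum_p \sum_(T | is_chain nu mu T && first_violation T p) F T.
Proof.
rewrite (bigID good) /=; congr (_ + _).
rewrite (exchange_big_dep (is_chain nu mu)) /=; last by move=> p T _ /andP[].
rewrite [RHS](bigID good) /= [X in _ = X + _]big1 ?add0r; last first.
  move=> T /andP[_ /forallP g]; apply: big1 => -[j k] /andP[_ /and4P[/= kN v _ _]].
  by move/forallP/(_ k): (g j); rewrite kN v.
apply: eq_bigr => T /andP[hT bT].
have [p hp] := first_violation_ex bT.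
rewrite (big_pred1 p) // => q; rewrite hT /=.
by apply/idP/eqP => [hq|->//]; apply: first_violation_inj hq hp.
Qed.

Definition shifted T (k : nat) : nat := (la k + staircase N k + weight T k)%N.

Section Cancel.
Variables (T : chain N R D) (j : 'I_D.+1) (k : 'I_N).
Hypotheses (hT : is_chain nu mu T) (hv : first_violation T (j, k)).

Let kN : (k.+1 < N)%N. Proof. by case/and4P: hv. Qed.

(** There is no violation at j+1, and a column holds each letter at most once. So column j contains
    k+1 but not k, and the inequality fails there by exactly one. *)
Lemma first_violation_tight :
  colcount T j k = 0%N /\
  (la k.+1 + excess T j k.+2 + excess T j k)%N
    = (la k + excess T j k.+1 + excess T j k.+1).+1.
Proof.
case/and4P: hv => /= _ vk /forallP hj _.
have := hla k.
have c1 := colcount_le1 j hT kN.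
have e0 := excessS j hT (ltnW kN); have e1 := excessS j hT kN.
have nv : ~~ violates T j.+1 k.
  (* For j = D the next column lies outside the range tested by [first_violation]; no box is there,
     and [la] decreases weakly. *)
  case: (ltnP j D) => jD.
    have jD1 : (j.+1 < D.+1)%N by [].
    by move/forallP/(_ k): (hj (Ordinal jD1)); rewrite /= leqnn kN.
  have z l : excess T j.+1 l = 0%N.
    rewrite /excess big1 // => i _.
    by have := level_le T l i; lia.
  by rewrite /violates !z; have := hla k; lia.
by move: vk nv; rewrite /violates; lia.
Qed.

Lemma first_violation_toggle : first_violation (toggle T j k) (j, k).
Proof.
have ev j' k' : (j <= j')%N -> (k'.+1 < N)%N ->
    violates (toggle T j k) j' k' = violates T j' k'.
  by move=> jj k'N; rewrite /violates !(excess_toggle hT kN) //; lia.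
case/and4P: hv => /= _ vk /forallP hj /forallP hk.
apply/and4P; split=> //=; first by rewrite ev.
  apply/forallP => j'; apply/forallP => k'; apply/implyP => /andP[lt k'N].
  rewrite ev //; last exact: ltnW.
  by move/forallP/(_ k'): (hj j'); rewrite lt k'N.
apply/forallP => k'; apply/implyP => lt; rewrite ev //; last by lia.
by move: (hk k'); rewrite lt.
Qed.

(** Before column j the numbers of letters k and k+1 are exchanged. From column j on they are kept,
    but there the deficit of one is made up by the step of one in the staircase. Altogether the
    exponents at k and k+1 are exchanged. *)
Lemma alternant_toggle :
  alternant N (shifted (toggle T j k)) = - alternant N (shifted T).
Proof.
have k1 : (k.+1 < N)%N := kN.
apply: (@alternant_swap _ _ _ k (Ordinal k1)).
  by apply/eqP => /(congr1 val) /=; lia.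
have hT' := toggle_is_chain j hT kN.
have [c0 tight] := first_violation_tight.
have tr := trunc_toggle hT kN c0.
have hx : (k.+1 <= N)%N by lia.
have ex := excess_toggle hT kN hx (leqnn j).
have ne l : (l <= N)%N -> l != k.+1 -> area (toggle T j k) l = area T l.
  by move=> *; apply: (area_toggle_ne _ hT kN).
have a0 := areaE T j k; have a1 := areaE T j k.+1; have a2 := areaE T j k.+2.
have a1' := areaE (toggle T j k) j k.+1.
rewrite ex in a1'.
have m0 := area_mono hT (ltnW kN); have m1 := area_mono hT kN.
have m0' := area_mono hT' (ltnW kN); have m1' := area_mono hT' kN.
have k0 : (k <= N)%N by lia.
have nk : k != k.+1 :> nat by lia.
have nk2 : k.+2 != k.+1 by lia.
move: (m0') (m1'); rewrite (ne k) // (ne k.+2) // => {}m0' {}m1'.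
move=> i; rewrite /shifted /weight /staircase.
case: tpermP => [->|->|/eqP n1 /eqP n2] /=.
- by rewrite (ne k) //; lia.
- by rewrite (ne k.+2) //; lia.
- have iN := ltn_ord i.
  have n1' : i != k :> nat by [].
  have n2' : i != k.+1 :> nat by [].
  by rewrite !ne //; lia.
Qed.

End Cancel.

Lemma sum_alternant_violation p :
  \sum_(T | is_chain nu mu T && first_violation T p) alternant N (shifted T) = 0.
Proof.
case: p => j k; set S := \sum_(T | _) _.
case kN: (k.+1 < N)%N; last first.
  by apply: big1 => T /andP[_ /and4P[/=]]; rewrite kN.
have tK T : is_chain nu mu T -> toggle (toggle T j k) j k = T.
  by move=> hT; apply: toggleK hT kN.
have SN : S = - S.
  rewrite {1}/S (reindex_onto (fun T => toggle T j k) (fun T => toggle T j k)) /=.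
    rewrite -sumrN; apply: eq_big => [T|T /andP[/andP[h v] e]].
      apply/idP/idP => [/andP[/andP[h v] /eqP e]|/andP[h v]].
        by rewrite -e toggle_is_chain ?(first_violation_toggle h v).
      by rewrite tK // toggle_is_chain // (first_violation_toggle h v) eqxx.
    by rewrite -[in RHS](eqP e) (alternant_toggle h v) opprK.
  by move=> T /andP[/tK].
have : S *+ 2 = 0 by rewrite mulr2n {1}SN addNr.
rewrite -scaler_nat => /(congr1 (fun p => 2%:R^-1 *: p)).
by rewrite scalerA mulVf ?scale1r ?scaler0.
Qed.

(** The skew Schur polynomial s_(mu/nu) in N variables. *)
Definition skew_poly : {mpoly rat[N]} :=
  \sum_(T : chain N R D | is_chain nu mu T) \prod_(i < N) 'X_i ^+ weight T i.

Theorem alternant_mul_skew_poly :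
  alternant N (fun k => (la k + staircase N k)%N) * skew_poly =
  \sum_(T | is_chain nu mu T && good T) alternant N (shifted T).
Proof.
transitivity (\sum_(T | is_chain nu mu T) alternant N (shifted T)); last first.
  rewrite sum_first_violation [X in _ + X]big1 ?addr0 // => p _.
  exact: sum_alternant_violation.
rewrite alternantE mulr_suml.
under [RHS]eq_bigr => T _ do rewrite alternantE.
rewrite exchange_big /=; apply: eq_bigr => s _.
have -> : skew_poly = \sum_(T : chain N R D | is_chain nu mu T)
    \prod_(i < N) 'X_i ^+ fweight T i.
  by apply: eq_bigr => T _; apply: eq_bigr => i _; rewrite ffunE.
(* For each term s of the alternant, the weights may be permuted by s; the exponents then add up
   position by position. *)
rewrite (sum_fweight_perm _ _ _ _ s (fun f : {ffun 'I_N -> nat} => \prod_(i < N) 'X_i ^+ f i)).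
rewrite mulr_sumr.
apply: eq_bigr => T _; rewrite -mulrA -big_split; congr (_ * _).
by apply: eq_bigr => i _ /=; rewrite !ffunE -exprD.
Qed.

End Stembridge.

(** * The bialternant formula *)

Section Bialternant.
Variables (N R D : nat) (mu : nat -> nat).
Hypotheses (hmu : nonincr mu) (muN : forall i, (N <= i)%N -> mu i = 0%N).
Hypotheses (muR : forall i, (R < i)%N -> mu i = 0%N) (muD : (mu 0 <= D)%N).
Implicit Types (T : chain N R D).
Local Open Scope nat_scope.

Let zero := fun _ : nat => 0.

Let mu_le i : mu i <= D.
Proof. exact: leq_trans (nonincr_le hmu (leq0n i)) muD. Qed.

(** The tableau whose row i consists of letters i. *)
Definition superstandard : chain N R D :=
  mkchain N R D (fun k i => if i < k then mu i else 0).

Lemma level_superstandard k i : k <= N ->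
  level superstandard k i = if i < k then mu i else 0.
Proof.
move=> kN; case: (leqP i R) => iR.
  by rewrite level_mk // => k' i'; case: ifP.
by rewrite level_out // muR //; case: ifP.
Qed.

Lemma superstandard_is_chain : is_chain zero mu superstandard.
Proof.
apply/chainP; split=> [i iR|i iR|k i kN]; rewrite !level_superstandard //; last exact: ltnW.
  by case: ltnP => // /muN.
have := hmu i; rewrite ltnS; case: (ltnP i k); case: (ltnP i k.+1); lia.
Qed.

Lemma excess_superstandard j k : k < N ->
  excess superstandard j k.+1 = excess superstandard j k + (mu k - j).
Proof.
move=> kN.
have e : \sum_(i < R.+1) (if i == k :> nat then mu k - j else 0) = mu k - j.
  case: (leqP k R) => kR.
    rewrite (bigD1 (inord k)) //= inordK // eqxx big1 ?addn0 // => i ne.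
    case: eqP => // ik; case/eqP: ne; apply: val_inj.
    by rewrite /= inordK.
  rewrite muR // big1 // => i _.
  by case: ifP.
rewrite -e -big_split; apply: eq_bigr => i _ /=.
rewrite !level_superstandard //; last exact: ltnW.
by rewrite ltnS; case: ltngtP => [||->] //=; lia.
Qed.

Lemma weight_superstandard k : k < N -> weight superstandard k = mu k.
Proof.
move=> kN.
have a l : area superstandard l = excess superstandard 0 l.
  by apply: eq_bigr => i _; rewrite subn0.
by rewrite /weight !a excess_superstandard // subn0 addKn.
Qed.

Lemma superstandard_good : good zero superstandard.
Proof.
apply/forallP => j; apply/forallP => k; apply/implyP => kN.
rewrite /violates /zero !excess_superstandard //.
by have := hmu k; lia.
Qed.

Lemma chain_above_diag T k i : is_chain zero mu T -> k <= i -> k <= N -> level T k i = 0.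
Proof.
case/chainP => h0 _ h; elim: k i => [|k IH] i ki kN.
  by case: (leqP i R) => iR; [rewrite h0|rewrite level_out].
case: i ki => // i ki; apply/eqP; rewrite -leqn0.
by rewrite -(IH i ki (ltnW kN)); case/andP: (h k i kN).
Qed.

(** Row by row from the top, row i can contain only letters i. Otherwise consider its last column
    and a letter k+1 > i standing there: the rows above contain no k, and neither row i nor the rows
    below have a k in that column or further right. From that column on k+1 occurs and k does not,
    which is a violation. *)
Lemma good_superstandard T : is_chain zero mu T -> good zero T -> T = superstandard.
Proof.
move=> hT gT; case/chainP: (hT) => h0 hN h.
have lmu k i : k <= N -> level T k i <= mu i.
  move=> kN; case: (leqP i R) => iR; last by rewrite level_out.
  by rewrite -(hN i iR); apply: chain_mono hT _; rewrite kN /=.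
have key i : forall k, i < k <= N -> level T k i = mu i.
  have [n] := ubnP i; elim: n i => // n IHi i; rewrite ltnS => ni k /andP[ik kN].
  case: (leqP i R) => iR; last by rewrite level_out // muR.
  move: {2}(N - k) (erefl (N - k)) => d.
  elim: d k ik kN => [|d IH] k ik kN Nk.
    have -> : k = N by lia.
    exact: hN.
  have kN' : k < N by lia.
  have k1 : level T k.+1 i = mu i by apply: IH; lia.
  apply/eqP; rewrite eqn_leq lmu //= leqNgt; apply/negP => lt.
  case: k => // k in ik kN Nk kN' k1 lt.
  (* The last column of row i. *)
  pose j := (mu i).-1.
  have jD : j < D.+1 by have := mu_le i; rewrite /j; lia.
  have kN2 : k < N by lia.
  move/forallP/(_ (Ordinal jD))/forallP/(_ (Ordinal kN2)): gT.
  rewrite /= kN' /= /violates /zero.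
  have lo r : level T k.+1 r.+1 <= level T k.+1 r.
    by case/andP: (h k.+1 r kN') => a _; apply: leq_trans a; case/andP: (h k.+1 r.+1 kN').
  have lo' r : i <= r -> level T k.+1 r <= j.
    elim: r => [|r IHr]; first by rewrite leqn0 => /eqP <-; rewrite /j; lia.
    rewrite leq_eqVlt => /orP[/eqP <-|]; first by rewrite /j; lia.
    by move=> /IHr; apply: leq_trans (lo r).
  have e0 : excess T j k = excess T j k.+1.
    apply: eq_bigr => r _; case: (ltnP r i) => ri.
      rewrite !IHi //; lia.
    by have := lo' r ri; have := h k r kN2; lia.
  have e1 : excess T j k.+1 < excess T j k.+2.
    have iR1 : i < R.+1 by [].
    rewrite /excess (bigD1 (Ordinal iR1)) //= [X in _ < X](bigD1 (Ordinal iR1)) //=.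
    rewrite -addSn leq_add //; first by rewrite k1 /j; lia.
    by apply: leq_sum => r _; apply: leq_sub2r; case/andP: (h k.+1 r kN').
  by lia.
apply: eq_chain => k i kN iR; rewrite level_superstandard //.
by case: ltnP => ik; [apply: key; rewrite ik|apply: chain_above_diag].
Qed.

(** The case where [la] and [nu] are zero: the superstandard tableau alone survives the
    cancellation. *)
Theorem bialternant :
  (alternant N (staircase N) * skew_poly N R D zero mu =
  alternant N (fun k => (mu k + staircase N k)%N))%R.
Proof.
have hz : nonincr zero by [].
transitivity (alternant N (fun k => (zero k + staircase N k)%N) * skew_poly N R D zero mu)%R.
  by [].
rewrite alternant_mul_skew_poly // (big_pred1 superstandard) => [|T] /=.
  apply: eq_alternant => k; rewrite inE => kN.
  by rewrite /shifted weight_superstandard // add0n addnC.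
apply/idP/eqP => [/andP[]|->]; first exact: good_superstandard.
by rewrite superstandard_is_chain superstandard_good.
Qed.

End Bialternant.

(** * Semistandard tableaux and chains *)

Lemma sum_downclosed (p : nat -> bool) n :
  (forall j, (j.+1 < n)%N -> p j.+1 -> p j) ->
  forall j, (j < n)%N -> p j = (j < \sum_(i < n) p i)%N.
Proof.
have le m (q : nat -> bool) : (\sum_(i < m) q i <= m)%N.
  rewrite -[X in (_ <= X)%N]muln1 -[X in (_ <= X * _)%N]card_ord -sum_nat_const.
  by apply: leq_sum => i _; case: (q i).
elim: n p => // n IH p hp j; rewrite big_ord_recr /= => jn.
have all : p n -> forall i, (i <= n)%N -> p i.
  move=> pn i iN; rewrite -(subKn iN).
  elim: (n - i)%N (leq_subr i n) => [|d IHd] dn; first by rewrite subn0.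
  by apply: hp; [lia|rewrite -subSn // subSS; apply: IHd (ltnW dn)].
case: (boolP (p n)) => pn.
  rewrite (eq_bigr (fun=> 1%N)) => [|i _]; last by rewrite all // ltnW.
  by rewrite sum1_card card_ord all //; lia.
rewrite addn0; move: jn; rewrite ltnS leq_eqVlt => /orP[/eqP ->|jn].
  by rewrite (negbTE pn) ltnNge le.
by rewrite -(IH p) // => i /leqW; apply: hp.
Qed.

Lemma sum_ord_trim m n (F : nat -> nat) : (m <= n)%N ->
  (forall i, (m <= i)%N -> F i = 0%N) -> (\sum_(i < n) F i = \sum_(i < m) F i)%N.
Proof.
move=> mn F0; rewrite (big_ord_widen _ F mn) [RHS]big_mkcond /=.
by apply: eq_bigr => i _; case: ltnP => // /F0.
Qed.

Lemma part_nonincr th : is_partition th -> nonincr (part th).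
Proof.
case/andP => srt _ i; rewrite /part.
case: (ltnP i.+1 (size th)) => hi; last by rewrite nth_default.
by apply: (sortedP _ srt).
Qed.

Lemma part_default th i : (size th <= i)%N -> part th i = 0%N.
Proof. exact: nth_default. Qed.

Section Boxes.
Variable th : seq nat.

Lemma bcol_lt (b : box th) : (bcol b < part th (brow b))%N.
Proof. exact: ltn_ord. Qed.

Lemma box_inj (b c : box th) : brow b = brow c -> bcol b = bcol c -> b = c.
Proof.
case: b c => [i j] [i' j']; rewrite /brow /bcol /= => /val_inj e.
by subst i' => /val_inj ->.
Qed.

Lemma box_ex i j : (j < part th i)%N -> exists b : box th, brow b = i /\ bcol b = j.
Proof.
move=> hj; have hi : (i < size th)%N.
  by rewrite ltnNge; apply/negP => /part_default e; rewrite e in hj.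
by exists (Tagged (fun i : 'I_(size th) => 'I_(part th i))
  (Ordinal hj : 'I_(part th (Ordinal hi)))).
Qed.

Lemma sum_box (V : nmodType) (F : nat -> nat -> V) :
  \sum_(b : box th) F (brow b) (bcol b) =
  \sum_(i < size th) \sum_(j < part th i) F i j.
Proof. by rewrite sig_big_dep. Qed.

End Boxes.

Lemma level_row_mono N R D nu mu (C : chain N R D) k i j : nonincr mu ->
  is_chain nu mu C -> (k <= N)%N -> (i <= j)%N -> (level C k j <= level C k i)%N.
Proof.
move=> hmu hC kN ij; case: (leqP j R) => jR; last by rewrite level_out.
case/chainP: hC => _ hN h.
move: kN; rewrite leq_eqVlt => /orP[/eqP->|kN].
  by rewrite !hN //; [exact: nonincr_le|exact: leq_trans jR].
elim: j ij {jR} => [|j IH]; first by rewrite leqn0 => /eqP ->.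
rewrite leq_eqVlt => /orP[/eqP->//|/IH]; apply: leq_trans.
by case/andP: (h k j kN) => + _; apply: leq_trans; case/andP: (h k j.+1 kN).
Qed.

Section SSYTChain.
Variables (th : seq nat) (N R D : nat).
Hypotheses (hth : is_partition th) (hR : (size th <= R.+1)%N) (hD : (part th 0 <= D)%N).
Implicit Types (T : {ffun box th -> 'I_N}) (C : chain N R D).
Local Open Scope nat_scope.

Let zero := fun _ : nat => 0.

(** A relation in place of two inverse maps: every tableau fits exactly one chain and conversely, so
    [sum_ssyt] follows by exchanging two sums. *)
Definition fits T C : bool :=
  [forall b, level C (T b) (brow b) <= bcol b < level C (T b).+1 (brow b)].

Lemma part_row_bound i j : j < part th i -> i <= R.
Proof.
move=> ij; rewrite -ltnS; apply: leq_trans hR; rewrite ltnNge; apply/negP => /part_default.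
by move=> e; rewrite e in ij.
Qed.

Lemma level_le_part C k i : is_chain zero (part th) C -> k <= N -> level C k i <= part th i.
Proof.
move=> hC kN; case: (leqP i R) => iR; last by rewrite level_out.
case/chainP: (hC) => _ hN _.
by rewrite -(hN i iR); apply: chain_mono hC _; rewrite kN /=.
Qed.

Lemma fits_lt T C (b : box th) k : is_chain zero (part th) C -> fits T C -> k <= N ->
  (T b < k) = (bcol b < level C k (brow b)).
Proof.
move=> hC /forallP/(_ b)/andP[lo hi] kN; case: (ltnP (T b) k) => Tk.
  by rewrite (leq_trans hi) //; apply: chain_mono hC _; rewrite Tk.
apply/esym/negbTE; rewrite -leqNgt; apply: leq_trans lo.
by apply: chain_mono hC _; rewrite Tk ltnW.
Qed.

Lemma fits_inj T C C' : is_chain zero (part th) C -> is_chain zero (part th) C' ->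
  fits T C -> fits T C' -> C = C'.
Proof.
have aux C1 C2 k i : is_chain zero (part th) C1 -> is_chain zero (part th) C2 ->
    fits T C1 -> fits T C2 -> k <= N -> level C1 k i <= level C2 k i.
  move=> h1 h2 f1 f2 kN; rewrite leqNgt; apply/negP => lt.
  have [b [bi bj]] := box_ex (leq_trans lt (level_le_part _ h1 kN)).
  have := fits_lt b h1 f1 kN; rewrite (fits_lt b h2 f2 kN) bi bj lt.
  by rewrite ltnn.
move=> h1 h2 f1 f2; apply: eq_chain => k i kN _.
by apply/eqP; rewrite eqn_leq !aux.
Qed.

Lemma fits_weight T C : is_chain zero (part th) C -> fits T C ->
  [ffun k => #|[set b | T b == k]|] = fweight C.
Proof.
move=> hC fC; apply/ffunP => k; rewrite !ffunE.
have a l : l <= N -> area C l = \sum_(b : box th) (T b < l).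
  move=> lN; transitivity (\sum_(b : box th) (bcol b < level C l (brow b))); last first.
    by apply: eq_bigr => b _; rewrite (fits_lt b hC fC lN).
  rewrite (sum_box th (fun i j => (j < level C l i)%N : nat)).
  transitivity (\sum_(i < size th) level C l i).
    rewrite /area (sum_ord_trim hR) // => i i1.
    by apply/eqP; rewrite -leqn0 -[X in _ <= X](part_default i1) level_le_part.
  apply: eq_bigr => i _; have le := level_le_part i hC lN.
  rewrite (@sum_ord_trim _ _ (fun j => (j < level C l i) : nat) le) => [|j j1].
    rewrite (eq_bigr (fun=> 1)) => [|j _]; last by rewrite ltn_ord.
    by rewrite sum1_card card_ord.
  by rewrite ltnNge j1.
rewrite /weight !a // ?ltn_ord //; last exact: ltnW.
have -> : \sum_b (T b < k.+1) = \sum_b (T b < k) + #|[set b | T b == k]|.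
  rewrite -sum1_card [X in _ + X](eq_bigl (fun b => T b == k)); last by move=> b; rewrite inE.
  rewrite [X in _ + X]big_mkcond -big_split; apply: eq_bigr => b _ /=.
  have [->|/negbTE ne] := eqVneq (T b) k; first by rewrite ltnSn ltnn.
  by rewrite addn0 ltnS leq_eqVlt -[(T b : nat) == k]/(T b == k) ne.
by rewrite addKn.
Qed.

Lemma fits_ssyt T C : is_chain zero (part th) C -> fits T C -> is_ssyt T.
Proof.
move=> hC /forallP f; have hp := part_nonincr hth.
apply/forallP => b; apply/forallP => c.
have := f b; have := f c; have TbN := ltn_ord (T b); have TcN := ltn_ord (T c).
move=> /andP[c1 c2] /andP[b1 b2].
apply/andP; split; apply/implyP => /andP[/eqP e lt].
  rewrite leqNgt; apply/negP => Tlt.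
  have := chain_mono (brow b) hC (_ : (T c).+1 <= T b <= N); rewrite Tlt ltnW //= => /(_ isT) m.
  rewrite e in b1 m; have := leq_trans c2 (leq_trans m b1).
  by rewrite ltnNge ltnW.
rewrite ltnNge; apply/negP => Tle.
have m1 := level_row_mono hp hC TcN lt.
case/chainP: (hC) => _ _ /(_ _ (brow b) TcN)/andP[m2 _].
have := chain_mono (brow b) hC (_ : T c <= T b <= N); rewrite Tle ltnW //= => /(_ isT) m3.
have := leq_trans m1 (leq_trans m2 (leq_trans m3 b1)).
by rewrite e leqNgt c2.
Qed.

Lemma chain_fits C : is_chain zero (part th) C -> exists T, fits T C.
Proof.
move=> hC.
have ex (b : box th) : exists k : 'I_N, level C k (brow b) <= bcol b < level C k.+1 (brow b).
  have lt := bcol_lt b; have bR := part_row_bound lt.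
  case/chainP: (hC) => h0 hN _.
  have exk : exists k, bcol b < level C k (brow b) by exists N; rewrite hN.
  case: (ex_minnP exk) => -[|k] hk kmin; first by rewrite h0 in hk.
  have kN : k < N by apply: kmin; rewrite hN.
  exists (Ordinal kN); rewrite hk andbT leqNgt; apply/negP => /kmin.
  by rewrite ltnn.
have [g hg] := fin_all_exists ex.
by exists [ffun b => g b]; apply/forallP => b; rewrite ffunE.
Qed.

Lemma fits_inj_tableau T T' C : is_chain zero (part th) C -> fits T C -> fits T' C -> T = T'.
Proof.
have le T1 T2 b : is_chain zero (part th) C -> fits T1 C -> fits T2 C -> T1 b <= T2 b.
  move=> hC f1 f2; rewrite -ltnS (fits_lt b hC f1) ?ltn_ord //.
  by move/forallP/(_ b)/andP: f2 => [].
by move=> hC f f'; apply/ffunP => b; apply: val_inj; apply/eqP; rewrite eqn_leq !le.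
Qed.

Let below T k i j : bool :=
  [exists b, [&& brow b == i, bcol b == j & T b < k]].

Let belowE T k (b : box th) : below T k (brow b) (bcol b) = (T b < k).
Proof.
apply/existsP/idP => [[c /and3P[/eqP e1 /eqP e2]]|h].
  by rewrite (box_inj e1 e2).
by exists b; rewrite !eqxx.
Qed.

Lemma ssyt_fits T : is_ssyt T -> exists2 C, is_chain zero (part th) C & fits T C.
Proof.
move=> /forallP sT; have hp := part_nonincr hth.
(* The number of entries below k in row i. As rows increase weakly, these entries occupy an initial
   segment of the row. *)
pose cnt k i := \sum_(j < part th i) below T k i j.
have cnt_le k i : cnt k i <= part th i.
  rewrite -[X in _ <= X]muln1 -[X in _ <= X * _]card_ord -sum_nat_const.
  by apply: leq_sum => j _; case: below.
have cntE k i j : j < part th i -> below T k i j = (j < cnt k i).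
  apply: sum_downclosed => {}j jp.
  have [c [ci cj]] := box_ex jp; have [b [bi bj]] := box_ex (ltnW jp).
  have -> : below T k i j.+1 = (T c < k) by rewrite -belowE ci cj.
  have -> : below T k i j = (T b < k) by rewrite -belowE bi bj.
  apply: leq_ltn_trans.
  by move/forallP/(_ c)/andP: (sT b) => [/implyP h _]; apply: h; rewrite bi ci bj cj eqxx /=.
have cntD k i : cnt k i <= D.
  by apply: leq_trans (cnt_le k i) _; apply: leq_trans hD; apply: nonincr_le.
pose C := mkchain N R D cnt.
have lC k i : k <= N -> i <= R -> level C k i = cnt k i by move=> kN iR; rewrite level_mk.
have cntS k i : cnt k i <= cnt k.+1 i.
  apply: leq_sum => j _; case: (boolP (below T k i j)) => // /existsP[b /and3P[bi bj h]].
  by have -> // : below T k.+1 i j; apply/existsP; exists b; rewrite bi bj (leqW h).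
have hC : is_chain zero (part th) C.
  apply/chainP; split=> [i iR|i iR|k i kN].
  - rewrite lC // /cnt big1 // => j _; case: (boolP (below _ _ _ _)) => // /existsP[b].
    by rewrite ltn0 !andbF.
  - rewrite lC // /cnt (eq_bigr (fun=> 1)) ?sum1_card ?card_ord // => j _.
    have [b [bi bj]] := box_ex (ltn_ord j).
    by have -> // : below T N i j; apply/existsP; exists b; rewrite bi bj !eqxx /=.
  case: (leqP i R) => iR; last by rewrite !level_out // ltnW.
  rewrite [level C k i]lC ?(ltnW kN) // [level C k.+1 i]lC // cntS andbT.
  case: (leqP i.+1 R) => i1R; last by rewrite level_out.
  rewrite lC // leqNgt; apply/negP => lt.
  have ltp := leq_trans lt (cnt_le k.+1 i.+1).
  have := cntE k.+1 i.+1 _ ltp; rewrite lt => hb.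
  have ltp' := leq_trans ltp (hp i).
  have := cntE k i _ ltp'; rewrite ltnn => hb'.
  have [c [ci cj]] := box_ex ltp; have [b [bi bj]] := box_ex ltp'.
  have Tc : T c < k.+1 by rewrite -belowE ci cj.
  have Tb : (T b < k) = false by rewrite -belowE bi bj.
  move/forallP/(_ c)/andP: (sT b) => [_ /implyP h].
  have := h _; rewrite bj cj bi ci eqxx /= => /(_ (leqnn _)).
  by move: Tb Tc; rewrite ltnS; case: ltnP => // Tb _ Tc; rewrite ltnNge (leq_trans Tc Tb).
exists C => //; apply/forallP => b.
have bR := part_row_bound (bcol_lt b).
rewrite !lC ?ltn_ord //; last exact: ltnW.
by rewrite -cntE ?bcol_lt // belowE ltnSn leqNgt -cntE ?bcol_lt // belowE ltnn.
Qed.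

Lemma sum_ssyt (V : nmodType) (F : {ffun 'I_N -> nat} -> V) :
  (\sum_(T : {ffun box th -> 'I_N} | is_ssyt T) F [ffun k => #|[set b | T b == k]|] =
  \sum_(C : chain N R D | is_chain zero (part th) C) F (fweight C))%R.
Proof.
transitivity (\sum_(T : {ffun box th -> 'I_N} | is_ssyt T)
   \sum_(C : chain N R D | is_chain zero (part th) C && fits T C) F (fweight C))%R.
  apply: eq_bigr => T /ssyt_fits[C hC fC].
  rewrite (big_pred1 C) ?(fits_weight hC fC) // => C'.
  by apply/andP/eqP => [[h' f']|->//]; apply: fits_inj fC.
rewrite (exchange_big_dep (is_chain zero (part th))) /=; last by move=> T C _ /andP[].
apply: eq_bigr => C hC; have [T fT] := chain_fits hC.
rewrite (big_pred1 T) // => T'; rewrite hC /=.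
apply/andP/eqP => [[_ f']|->]; first exact: fits_inj_tableau hC _ _.
by split=> //; apply: fits_ssyt hC _.
Qed.

End SSYTChain.

(** * The Littlewood-Richardson rule *)

(** Meant for weakly decreasing [a]: its zeros come last, so dropping them leaves the positions of
    the other entries unchanged. *)
Definition to_partition (n : nat) (a : nat -> nat) : seq nat :=
  [seq x <- mkseq a n | x != 0%N].

Lemma part_to_partition n a i : (forall k, (k.+1 < n)%N -> (a k.+1 <= a k)%N) ->
  part (to_partition n a) i = if (i < n)%N then a i else 0%N.
Proof.
rewrite /part /to_partition; elim: n a i => [|n IH] a i ha; first by rewrite nth_nil.
have -> : mkseq a n.+1 = a 0%N :: mkseq (fun k => a k.+1) n.
  by rewrite /mkseq /= (iotaDl 1) -map_comp.
rewrite /=; case: eqP => [a0|/eqP a0] /=; last first.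
  by case: i => [|i] //=; rewrite IH // => k; apply: (ha k.+1).
have z k : (k < n.+1)%N -> a k = 0%N.
  elim: k => // k IHk kn; apply/eqP; rewrite -leqn0 -(IHk (ltnW kn)).
  exact: ha.
rewrite (@eq_in_filter _ _ pred0) ?filter_pred0 ?nth_nil; last first.
  by move=> x /mapP[k]; rewrite mem_iota => kn ->; rewrite z.
by case: ltnP => // /z ->.
Qed.

Lemma sorted_geq_mkseq n a : (forall k, (k.+1 < n)%N -> (a k.+1 <= a k)%N) ->
  sorted geq (mkseq a n).
Proof.
move=> ha; apply/(sortedP 0%N); rewrite size_mkseq => i iN.
by rewrite !nth_mkseq ?(ltnW iN) //; apply: ha.
Qed.

Lemma to_partition_is_partition n a : (forall k, (k.+1 < n)%N -> (a k.+1 <= a k)%N) ->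
  is_partition (to_partition n a).
Proof.
move=> ha; rewrite /is_partition mem_filter eqxx /= andbT.
apply: sorted_filter; last exact: sorted_geq_mkseq.
by move=> y x z xy yz; apply: leq_trans yz xy.
Qed.

Lemma sumn_to_partition n a : sumn (to_partition n a) = (\sum_(i < n) a i)%N.
Proof.
rewrite sumnE /to_partition big_filter big_mkcond /= /mkseq big_map.
rewrite -{1}[n]subn0 -/(index_iota 0 n) big_mkord.
by apply: eq_bigr => i _; case: eqP.
Qed.

Lemma size_to_partition n a : (size (to_partition n a) <= n)%N.
Proof. by rewrite size_filter (leq_trans (count_size _ _)) // size_mkseq. Qed.

Lemma part_pos th i : is_partition th -> (0 < part th i)%N = (i < size th)%N.
Proof.
case/andP => _ z; case: (ltnP i (size th)) => [ith|/part_default -> //].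
by rewrite lt0n; apply: contraNneq z => <-; apply: mem_nth.
Qed.

Lemma part_inj th th' : is_partition th -> is_partition th' ->
  (forall i, part th i = part th' i) -> th = th'.
Proof.
move=> h h' e; apply: (@eq_from_nth _ 0%N) => [|i _]; last exact: e.
have e' i : (i < size th)%N = (i < size th')%N by rewrite -!part_pos // e.
case: (ltngtP (size th) (size th')) => // lt.
  by have := e' (size th); rewrite ltnn lt.
by have := e' (size th'); rewrite ltnn lt.
Qed.

Lemma sumn_part th n : (size th <= n)%N -> sumn th = (\sum_(i < n) part th i)%N.
Proof.
move=> sn; rewrite (sum_ord_trim sn) => [|i]; last exact: part_default.
by rewrite sumnE (big_nth 0%N) big_mkord.
Qed.

Lemma size_le_sumn th : is_partition th -> (size th <= sumn th)%N.
Proof.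
move=> h; rewrite (sumn_part (leqnn _)) -[X in (X <= _)%N]card_ord -sum1_card.
by apply: leq_sum => i _; rewrite part_pos.
Qed.

Section Schur.
Variables (th : seq nat) (N R D : nat).
Hypotheses (hth : is_partition th) (hR : (size th <= R.+1)%N) (hD : (part th 0 <= D)%N).

Let zero := fun _ : nat => 0%N.

Lemma schurE : schur th N = skew_poly N R D zero (part th).
Proof.
pose F (f : {ffun 'I_N -> nat}) : {mpoly rat[N]} := \prod_(i < N) 'X_i ^+ f i.
transitivity (\sum_(C : chain N R D | is_chain zero (part th) C) F (fweight C)).
  rewrite -(sum_ssyt hth hR hD); apply: eq_bigr => T _; rewrite /F.
  rewrite (partition_big T xpredT) //=; apply: eq_bigr => i _.
  rewrite (eq_bigr (fun=> 'X_i)) => [|b /eqP -> //].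
  rewrite ffunE prodr_const; congr (_ ^+ _).
  by apply: eq_card => b; rewrite inE.
by apply: eq_bigr => C _; apply: eq_bigr => i _; rewrite ffunE.
Qed.

Lemma kostkaE (c : 'I_N -> int) :
  kostka th c = (\sum_(C : chain N R D | is_chain zero (part th) C)
    [forall k : 'I_N, (weight C k)%:Z == c k])%N.
Proof.
pose F (f : {ffun 'I_N -> nat}) : nat := [forall k : 'I_N, (f k)%:Z == c k].
transitivity (\sum_(C : chain N R D | is_chain zero (part th) C) F (fweight C))%N.
  rewrite -(sum_ssyt hth hR hD) /kostka -sum1_card big_mkcond [RHS]big_mkcond.
  apply: eq_bigr => T _; rewrite inE; case: is_ssyt => //=; rewrite /F.
  have -> : [forall i, #|[set b | T b == i]|%:Z == c i] =
    [forall k, ([ffun k => #|[set b | T b == k]|] k)%:Z == c k].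
    by apply: eq_forallb => i; rewrite ffunE.
  by case: ifP.
by apply: eq_bigr => C _; rewrite /F; congr nat_of_bool; apply: eq_forallb => i; rewrite ffunE.
Qed.

End Schur.

(** Row N could only contain entries that are at least N. *)
Lemma schur_eq0 th N : is_partition th -> (N < size th)%N -> schur th N = 0.
Proof.
move=> h lt; rewrite (@schurE _ _ (size th) (part th 0)) ?leqnSn //.
apply: big1 => T hT; have := chain_above_diag hT (leqnn N) (leqnn N).
case/chainP: hT => _ hN _; rewrite hN ?(ltnW lt) //.
by have := part_pos N h; rewrite lt; case: part.
Qed.

Lemma alternant_schur th N : is_partition th -> (size th <= N)%N ->
  alternant N (staircase N) * schur th N
  = alternant N (fun k => (part th k + staircase N k)%N).
Proof.
move=> h sN; rewrite (@schurE _ _ (size th) (part th 0)) ?leqnSn //.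
apply: bialternant => //; first exact: part_nonincr.
  by move=> i iN; apply: part_default; apply: leq_trans iN.
by move=> i iN; apply: part_default; apply: ltnW.
Qed.

Section GoodSums.
Variables (N R D : nat) (la nu mu : nat -> nat).
Implicit Types (T : chain N R D).

Definition added T : seq nat := to_partition N (fun k => la k + weight T k)%N.

Lemma good_added_nonincr T k : is_chain nu mu T -> good la T -> (k.+1 < N)%N ->
  (la k.+1 + weight T k.+1 <= la k + weight T k)%N.
Proof.
move=> hT /forallP/(_ ord0)/forallP gT kN.
have := gT (Ordinal (ltnW kN)); rewrite /= kN /= /violates.
have a l : excess T 0 l = area T l by apply: eq_bigr => i _; rewrite subn0.
rewrite !a /weight; have := area_mono hT (ltnW kN); have := area_mono hT kN; lia.
Qed.

Lemma added_is_partition T : is_chain nu mu T -> good la T -> is_partition (added T).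
Proof. by move=> hT gT; apply: to_partition_is_partition => k; apply: good_added_nonincr. Qed.

Lemma part_added T k : is_chain nu mu T -> good la T ->
  part (added T) k = if (k < N)%N then (la k + weight T k)%N else 0%N.
Proof. by move=> hT gT; apply: part_to_partition => l; apply: good_added_nonincr. Qed.

End GoodSums.

(** Multiplied by the Vandermonde alternant, both sides become the same sum of alternants; the
    factor is then cancelled in the domain of polynomials. *)
Theorem littlewood_richardson N R D la nu mu : is_partition la -> (size la <= N)%N ->
  schur la N * skew_poly N R D nu mu =
  \sum_(T : chain N R D | is_chain nu mu T && good (part la) T) schur (added (part la) T) N.
Proof.
move=> hla sN; apply: (mulfI (staircase_neq0 N)).
rewrite mulrA alternant_schur // alternant_mul_skew_poly; last exact: part_nonincr.
rewrite mulr_sumr; apply: eq_bigr => T /andP[hT gT].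
rewrite alternant_schur; last exact: size_to_partition.
  apply: eq_alternant => k; rewrite inE => kN.
  by rewrite (part_added _ hT gT) kN /shifted addnAC.
exact: added_is_partition hT gT.
Qed.

Lemma schur_nil N : schur [::] N = 1.
Proof.
apply: (mulfI (staircase_neq0 N)); rewrite alternant_schur // mulr1.
by apply: eq_alternant => k _; rewrite part_default.
Qed.

Lemma skew_poly_schur N R D nu mu : skew_poly N R D nu mu =
  \sum_(T : chain N R D | is_chain nu mu T && good (part [::]) T)
     schur (added (part [::]) T) N.
Proof. by rewrite -littlewood_richardson // schur_nil mul1r. Qed.

(** * Independence of the number of variables *)

(* [level] is constant beyond the last letter, so that [mkchain _ _ _ (level T)]
   both extends the alphabet and, if the extra letters do not occur, restricts it. *)
Section Stability.
Variables (N M R D : nat) (la nu mu : nat -> nat).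
Hypotheses (NM : (N <= M)%N) (hmu : nonincr mu).
Hypothesis laN : forall k, (N <= k)%N -> la k = 0%N.

Definition resize N1 N2 (T : chain N1 R D) : chain N2 R D := mkchain N2 R D (level T).

Lemma level_resize N1 N2 (T : chain N1 R D) k i : (k <= N2)%N ->
  level (resize N2 T) k i = level T k i.
Proof.
move=> kN; case: (leqP i R) => iR; last by rewrite !level_out.
by rewrite level_mk //; apply: level_le.
Qed.

Lemma level_clip N1 (T : chain N1 R D) k i : (N1 <= k)%N -> level T k i = level T N1 i.
Proof. by move=> kN; rewrite /level (minn_idPr kN) minnn. Qed.

Lemma excess_resize N1 N2 (T : chain N1 R D) j k : (k <= N2)%N ->
  excess (resize N2 T) j k = excess T j k.
Proof. by move=> kN; apply: eq_bigr => i _; rewrite level_resize. Qed.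

Lemma weight_resize N1 N2 (T : chain N1 R D) k : (k < N2)%N ->
  weight (resize N2 T) k = weight T k.
Proof.
move=> kN; have a l : (l <= N2)%N -> area (resize N2 T) l = area T l.
  by move=> lN; apply: eq_bigr => i _; rewrite level_resize.
by rewrite /weight !a // ltnW.
Qed.

Lemma weight_clip N1 (T : chain N1 R D) k : (N1 <= k)%N -> weight T k = 0%N.
Proof.
move=> kN; apply/eqP; rewrite subn_eq0; apply: leq_sum => i _.
by rewrite !level_clip // ltnW.
Qed.

Lemma resize_is_chain (T : chain N R D) : is_chain nu mu T -> is_chain nu mu (resize M T).
Proof.
move=> hT; case/chainP: (hT) => h0 hN h; apply/chainP; split=> [i iR|i iR|k i kM].
- by rewrite level_resize ?h0.
- by rewrite level_resize // level_clip ?hN.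
- rewrite !level_resize //; last exact: ltnW.
  case: (ltnP k N) => kN; first exact: h.
  have kN' := leqW kN; rewrite !(level_clip T) // leqnn andbT.
  by apply: level_row_mono hmu hT _ _.
Qed.

Lemma resize_good (T : chain N R D) : is_chain nu mu T -> good la T -> good la (resize M T).
Proof.
move=> hT /forallP gT; apply/forallP => j; apply/forallP => k; apply/implyP => kM.
have kM' := ltnW kM; rewrite /violates !excess_resize ?(ltnW kM') //.
case: (ltnP k.+1 N) => kN.
  by move/forallP/(_ (Ordinal (ltnW kN))): (gT j); rewrite /= kN.
have e l : (N <= l)%N -> excess T j l = excess T j N.
  by move=> lN; apply: eq_bigr => i _; rewrite level_clip.
rewrite (laN kN) (e _ kN) (e k.+2 (leqW kN)) -leqNgt.
suff : (excess T j k <= excess T j N)%N by lia.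
case: (ltnP k N) => kN'; last by rewrite e.
apply: leq_sum => i _; apply: leq_sub2r; apply: chain_mono hT _.
by rewrite leqnn ltnW.
Qed.

Lemma resizeK (T : chain N R D) : resize N (resize M T) = T.
Proof.
apply: eq_chain => k i kN _; rewrite !level_resize //; exact: leq_trans NM.
Qed.

Lemma added_resize (T : chain N R D) : is_chain nu mu T -> good la T ->
  added la (resize M T) = added la T.
Proof.
move=> hT gT; have hT' := resize_is_chain hT; have gT' := resize_good hT gT.
apply: part_inj; [exact: added_is_partition hT' gT'|exact: added_is_partition hT gT|].
move=> k; rewrite (part_added _ hT gT) (part_added _ hT' gT').
case: (ltnP k M) => kM; last by rewrite ltnNge (leq_trans NM).
rewrite weight_resize //; case: ltnP => // kN.
by rewrite laN // weight_clip.
Qed.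

(** With at most N parts in [added], the letters from N on have weight zero. Levels only grow along
    a chain, so weight zero keeps every row fixed. *)
Lemma level_unused (T : chain M R D) : is_chain nu mu T -> good la T ->
  (size (added la T) <= N)%N ->
  forall k i, (N <= k)%N -> level T k i = level T N i.
Proof.
move=> hT gT sN.
have w k : (N <= k)%N -> (k < M)%N -> weight T k = 0%N.
  move=> kN kM; have := part_added k hT gT; rewrite kM part_default ?laN //.
  exact: leq_trans kN.
have st k i : (N <= k)%N -> (k < M)%N -> level T k.+1 i = level T k i.
  move=> kN kM; have := weightE hT kM; rewrite w // addn0 => e.
  case: (leqP i R) => iR; last by rewrite !level_out.
  have iR1 : (i < R.+1)%N by [].
  move: e; rewrite /area (bigD1 (Ordinal iR1)) //= [RHS](bigD1 (Ordinal iR1)) //=.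
  have le i' : (level T k i' <= level T k.+1 i')%N.
    by apply: chain_mono hT _; rewrite leqnSn.
  have := le i.
  set x := (\sum_(j < R.+1 | _) _)%N; set y := (\sum_(j < R.+1 | _) _)%N.
  have : (x <= y)%N by apply: leq_sum.
  by move: x y => x y; lia.
elim=> [|k IH] i kN; first by move: kN; rewrite leqn0 => /eqP ->.
move: kN; rewrite leq_eqVlt => /orP[/eqP <- //|kN].
case: (ltnP k M) => kM; first by rewrite st // IH.
by rewrite level_clip ?(leqW kM) // -(IH i kN) [RHS]level_clip.
Qed.

Lemma resize_used (T : chain M R D) : is_chain nu mu T -> good la T ->
  (size (added la T) <= N)%N ->
  [/\ is_chain nu mu (resize N T), good la (resize N T) & resize M (resize N T) = T].
Proof.
move=> hT gT sN; have un := level_unused hT gT sN.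
case/chainP: (hT) => h0 hM h; split.
- apply/chainP; split=> [i iR|i iR|k i kN].
  + by rewrite level_resize ?h0.
  + by rewrite level_resize // -(un M) ?hM.
  + by rewrite !level_resize ?(ltnW kN) // h // (leq_trans kN).
- apply/forallP => j; apply/forallP => k; apply/implyP => kN.
  have kM : (k.+1 < M)%N by apply: leq_trans NM.
  move/forallP/(_ j)/forallP/(_ (Ordinal (ltnW kM))): gT; rewrite /= kM /=.
  by have kN' := ltnW kN; rewrite /violates !excess_resize // ltnW.
- apply: eq_chain => k i kM _; rewrite level_resize //.
  case: (leqP k N) => kN; first by rewrite level_resize.
  by rewrite level_clip ?(ltnW kN) // level_resize // (un k) // ltnW.
Qed.

(** The larger alphabet only adds tableaux whose partition has more than N parts; the Schur
    polynomials of these vanish in N variables. *)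
Lemma sum_good_resize (V : nmodType) (F : seq nat -> V) :
  \sum_(T : chain N R D | is_chain nu mu T && good la T) F (added la T) =
  \sum_(T : chain M R D | [&& is_chain nu mu T, good la T & (size (added la T) <= N)%N])
     F (added la T).
Proof.
rewrite [RHS](reindex_onto (fun T : chain N R D => resize M T) (fun T => resize N T)) /=.
  apply: eq_big => [T|T /andP[hT gT]]; last by rewrite added_resize.
  rewrite resizeK eqxx andbT.
  apply/andP/and3P => [[hT gT]|[hT gT sT]].
    by rewrite resize_is_chain ?resize_good ?added_resize // size_to_partition.
  by have [] := resize_used hT gT sT; rewrite resizeK.
by move=> T /and3P[hT gT sT]; case: (resize_used hT gT sT).
Qed.

End Stability.

Lemma sum_weight N R D nu mu (T : chain N R D) n : is_chain nu mu T -> (n <= N)%N ->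
  (area T 0 + \sum_(k < n) weight T k = area T n)%N.
Proof.
move=> hT; elim: n => [|k IH] kN; first by rewrite big_ord0 addn0.
by rewrite big_ord_recr /= addnA IH ?(weightE hT) // ltnW.
Qed.

(** * Closure properties of Schur-positivity *)

(** Partitions may repeat, unlike in [schur_positive], so that a sum is a concatenation of lists. *)
Definition schur_comb (f : symfun) : Prop :=
  exists l : seq (rat * seq nat),
    all (fun p => (0 <= p.1) && is_partition p.2) l /\
    forall N, f N = \sum_(p <- l) p.1 *: schur p.2 N.

Lemma schur_comb_positive f : schur_comb f -> schur_positive f.
Proof.
case=> l [/allP hl fE].
exists (undup (map snd l)), (fun th => \sum_(p <- l | p.2 == th) p.1); split.
- exact: undup_uniq.
- by apply/allP => th; rewrite mem_undup => /mapP[p /hl/andP[_ hp] ->].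
- by move=> th _; rewrite big_seq_cond; apply: sumr_ge0 => p /andP[/hl/andP[]].
move=> N; rewrite fE.
under [RHS]eq_bigr => th _ do rewrite scaler_suml.
rewrite (exchange_big_dep xpredT) //= big_seq [RHS]big_seq; apply: eq_bigr => p pl.
have pu : p.2 \in undup (map snd l) by rewrite mem_undup map_f.
rewrite big_mkcond (bigD1_seq p.2) ?undup_uniq //= eqxx big1 ?addr0 // => th.
by rewrite eq_sym => /negbTE ->.
Qed.

Lemma schur_positive_comb f : schur_positive f -> schur_comb f.
Proof.
case=> s [c [_ /allP hs hc fE]]; exists [seq (c th, th) | th <- s]; split.
  by apply/allP => p /mapP[th ths ->] /=; rewrite hc ?hs.
by move=> N; rewrite fE big_map.
Qed.

Lemma eq_schur_positive f g : (forall N, f N = g N) -> schur_positive g -> schur_positive f.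
Proof.
move=> e [s [c [us hs hc gE]]]; exists s, c; split=> // N.
by rewrite e.
Qed.

Lemma schur_positive_sum (I : Type) (r : seq I) (P : pred I) (f : I -> symfun) :
  (forall i, P i -> schur_positive (f i)) ->
  schur_positive (fun N => \sum_(i <- r | P i) f i N).
Proof.
move=> hf; apply: schur_comb_positive; elim: r => [|i r IH].
  by exists [::]; split=> // N; rewrite !big_nil.
case: (boolP (P i)) => Pi; last first.
  by case: IH => l [hl lE]; exists l; split=> // N; rewrite big_cons (negbTE Pi).
have [l [hl lE]] := IH; have [l' [hl' lE']] := schur_positive_comb (hf i Pi).
exists (l' ++ l); split; first by rewrite all_cat hl' hl.
by move=> N; rewrite big_cons Pi big_cat /= -lE -lE'.
Qed.

Lemma schur_positive_scale (c : rat) (f : symfun) : 0 <= c -> schur_positive f ->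
  schur_positive (fun N => c *: f N).
Proof.
move=> c0 [s [d [us hs hd fE]]]; exists s, (fun th => c * d th); split=> //.
  by move=> th /hd; apply: mulr_ge0.
by move=> N; rewrite fE scaler_sumr; apply: eq_bigr => th _; rewrite scalerA.
Qed.

Lemma schur_positive_schur th : is_partition th -> schur_positive (schur th).
Proof.
move=> h; apply: schur_comb_positive; exists [:: (1, th)]; split=> [|N].
  by rewrite /= h.
by rewrite big_seq1 scale1r.
Qed.

Lemma schur_positive_schurM la mu : is_partition la -> is_partition mu ->
  schur_positive (fun N => schur la N * schur mu N).
Proof.
(* All partitions in the product have at most d parts, so the good tableaux on d letters provide
   coefficients valid for every N. *)
move=> hla hmu; pose d := (sumn la + sumn mu)%N.
pose R := size mu; pose D := part mu 0.
pose G := fun T : chain d R D => is_chain (fun=> 0%N) (part mu) T && good (part la) T.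
have hG T : G T -> is_partition (added (part la) T).
  by case/andP => hT gT; apply: added_is_partition hT gT.
apply: (@eq_schur_positive _
  (fun N => \sum_(T : chain d R D | G T) schur (added (part la) T) N)); last first.
  by apply: schur_positive_sum => T /hG; apply: schur_positive_schur.
move=> N; have lad : (size la <= d)%N := leq_trans (size_le_sumn hla) (leq_addr _ _).
have nla := part_nonincr hla; have nmu := part_nonincr hmu.
(* With fewer variables than parts of [la] the rule does not apply, but both sides vanish: each
   partition on the right contains [la]. *)
case: (ltnP N (size la)) => laN.
  rewrite schur_eq0 // mul0r big1 // => T /andP[hT gT].
  rewrite schur_eq0 //; first exact: added_is_partition hT gT.
  have p : (0 < part (added (part la) T) N)%N.
    rewrite (part_added _ hT gT) (leq_trans laN lad).
    by apply: ltn_addr; rewrite part_pos.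
  by rewrite -part_pos //; apply: added_is_partition hT gT.
rewrite (@schurE mu N R D) // littlewood_richardson //.
have laz n k : (size la <= n)%N -> (n <= k)%N -> part la k = 0%N.
  by move=> a b; apply: part_default; apply: leq_trans b.
case: (leqP N d) => Nd.
  rewrite (sum_good_resize R D _ Nd nmu (fun k => laz N k laN) (fun th => schur th N)).
  rewrite /G [RHS](bigID (fun T => size (added (part la) T) <= N)%N) /=.
  rewrite [X in _ = _ + X]big1 ?addr0; first by apply: eq_bigl => T; rewrite andbA.
  move=> T /andP[GT lt]; rewrite schur_eq0 ?ltnNge //; exact: hG.
(* With more than d letters no new tableau appears, since every partition obtained has size at most
   d. *)
rewrite (sum_good_resize R D _ (ltnW Nd) nmu (fun k => laz d k lad) (fun th => schur th N)).
apply: eq_bigl => T; rewrite andbA; case: (boolP (_ && _)) => //= /andP[hT gT].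
have hp := added_is_partition hT gT.
apply/esym; apply: leq_trans (size_le_sumn hp) _.
rewrite sumn_to_partition big_split /= /d leq_add //.
  by rewrite -sumn_part.
suff : (\sum_(k < N) weight T k <= area T N)%N.
  move=> le; apply: leq_trans le _; rewrite (@sumn_part _ R.+1) ?leqnSn //.
  by apply: leq_sum => i _; case/chainP: hT => _ -> //; rewrite -ltnS.
by rewrite -(sum_weight hT (leqnn N)) leq_addl.
Qed.

Lemma schur_positiveM f g : schur_positive f -> schur_positive g ->
  schur_positive (fun N => f N * g N).
Proof.
case=> s [c [_ /allP hs hc fE]] [t [d [_ /allP ht hd gE]]].
apply: (@eq_schur_positive _ (fun N => \sum_(p <- s | p \in s) \sum_(q <- t | q \in t)
    (c p * d q) *: (schur p N * schur q N))).
  move=> N; rewrite fE gE mulr_suml big_seq; apply: eq_bigr => p ps.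
  rewrite mulr_sumr big_seq; apply: eq_bigr => q qt.
  by rewrite -scalerAl -scalerAr scalerA.
apply: schur_positive_sum => p ps; apply: schur_positive_sum => q qt.
apply: schur_positive_scale; first by rewrite mulr_ge0 ?hc ?hd.
by apply: schur_positive_schurM; [apply: hs|apply: ht].
Qed.

(** * Kostka numbers of concatenated contents *)

Definition skew_kostka N R D (nu mu : nat -> nat) (c : 'I_N -> int) : nat :=
  (\sum_(T : chain N R D | is_chain nu mu T) [forall k : 'I_N, (weight T k)%:Z == c k])%N.
Arguments skew_kostka : clear implicits.

Lemma mcoeff_chain_poly N R D (A : pred (chain N R D)) (m : 'X_{1..N}) :
  (\sum_(T | A T) \prod_(i < N) 'X_i ^+ weight T i : {mpoly rat[N]})@_m =
  (\sum_(T | A T) [forall k : 'I_N, weight T k == m k])%N%:R.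
Proof.
rewrite raddf_sum natr_sum; apply: eq_bigr => T _ /=.
have -> : \prod_(i < N) 'X_i ^+ weight T i = 'X_[[multinom weight T i | i < N]] :> {mpoly rat[N]}.
  by rewrite [RHS]mpolyXE_id; apply: eq_bigr => i _; rewrite mnmE.
rewrite mcoeffX; congr (nat_of_bool _)%:R.
apply/eqP/forallP => [<- k|h]; first by rewrite mnmE.
by apply/mnmP => k; rewrite mnmE; apply/eqP.
Qed.

(** Comparison of coefficients in the Schur expansion of s_(mu/nu). *)
Lemma skew_kostka_schur N R D nu mu (c : 'I_N -> int) :
  skew_kostka N R D nu mu c =
  (\sum_(T : chain N R D | is_chain nu mu T && good (part [::]) T)
     kostka (added (part [::]) T) c)%N.
Proof.
have hadd (T : chain N R D) : is_chain nu mu T && good (part [::]) T ->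
    is_partition (added (part [::]) T).
  by case/andP => hT gT; apply: added_is_partition hT gT.
(* A content with a negative entry is not the exponent of a monomial; both sides are then zero. *)
case: (boolP [forall k, 0 <= c k]) => [/forallP c0|]; last first.
  rewrite negb_forall => /existsP[k ck].
  have z (w : nat -> nat) : [forall k : 'I_N, (w k)%:Z == c k] = false.
    by apply/negbTE; rewrite negb_forall; apply/existsP; exists k; apply: contraNneq ck => <-.
  rewrite /skew_kostka big1; last by move=> T _; rewrite z.
  rewrite big1 // => T /hadd h; rewrite (@kostkaE _ _ (size (added (part [::]) T))
    (part (added (part [::]) T) 0)) ?leqnSn // big1 // => T' _.
  by rewrite z.
pose m : 'X_{1..N} := [multinom `|c i|%N | i < N].
have cm (w : nat -> nat) :
    [forall k : 'I_N, (w k)%:Z == c k] = [forall k : 'I_N, w k == m k].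
  by apply: eq_forallb => k; rewrite mnmE -{1}[c k]gez0_abs.
have /(congr1 (mcoeff m)) := skew_poly_schur N R D nu mu.
rewrite mcoeff_chain_poly [RHS]raddf_sum /= => e.
apply/eqP; rewrite -(eqr_nat rat); apply/eqP.
transitivity ((\sum_(T : chain N R D | is_chain nu mu T)
    [forall k : 'I_N, weight T k == m k])%N%:R : rat).
  by congr _%:R; apply: eq_bigr => T _; rewrite cm.
rewrite e natr_sum; apply: eq_bigr => T /hadd h.
rewrite (@schurE _ _ (size (added (part [::]) T)) (part (added (part [::]) T) 0)) ?leqnSn //.
rewrite mcoeff_chain_poly (@kostkaE _ _ (size (added (part [::]) T))
    (part (added (part [::]) T) 0)) ?leqnSn //.
by congr _%:R; apply: eq_bigr => T' _; rewrite cm.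
Qed.

Section Split.
Variables (k m R D : nat) (nu mu : nat -> nat).
Implicit Types (T : chain (k + m) R D) (p : chain k R D * chain m R D).

Definition lower T : chain k R D := mkchain k R D (level T).
Definition upper T : chain m R D := mkchain m R D (fun j => level T (k + j)).
Definition join p : chain (k + m) R D :=
  mkchain (k + m) R D (fun j i => if (j <= k)%N then level p.1 j i else level p.2 (j - k) i).

Lemma level_lower T j i : (j <= k)%N -> level (lower T) j i = level T j i.
Proof.
move=> jk; case: (leqP i R) => iR; last by rewrite !level_out.
by rewrite level_mk //; apply: level_le.
Qed.

Lemma level_upper T j i : (j <= m)%N -> level (upper T) j i = level T (k + j) i.
Proof.
move=> jk; case: (leqP i R) => iR; last by rewrite !level_out.
by rewrite level_mk // => *; apply: level_le.
Qed.

Lemma level_join p j i : (j <= k + m)%N ->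
  level (join p) j i = if (j <= k)%N then level p.1 j i else level p.2 (j - k) i.
Proof.
move=> jk; case: (leqP i R) => iR; last by rewrite !level_out //; case: ifP.
by rewrite level_mk // => *; case: ifP; rewrite level_le.
Qed.

Lemma level_join_upper p j i : is_chain (level p.1 k) mu p.2 -> (j <= m)%N ->
  level (join p) (k + j) i = level p.2 j i.
Proof.
move=> /chainP[h0 _ _] jm; rewrite level_join ?leq_add2l //.
case: j jm => [|j] jm; last by rewrite leqNgt -[k in (k < _)%N]addn0 ltn_add2l addKn.
rewrite addn0 leqnn; case: (leqP i R) => iR; last by rewrite !level_out.
by rewrite h0.
Qed.

Lemma lower_is_chain T : is_chain nu mu T -> is_chain nu (level (lower T) k) (lower T).
Proof.
case/chainP => h0 _ h; apply/chainP; split=> // [i iR|j i jk]; rewrite !level_lower ?h0 //.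
  by apply: h; apply: leq_trans (leq_addr _ _).
exact: ltnW.
Qed.

Lemma upper_is_chain T : is_chain nu mu T -> is_chain (level (lower T) k) mu (upper T).
Proof.
case/chainP => _ hN h; apply/chainP; split=> [i iR|i iR|j i jm].
- by rewrite level_upper // addn0 level_lower.
- by rewrite level_upper ?hN.
- by rewrite !level_upper ?(ltnW jm) // addnS; apply: h; rewrite ltn_add2l.
Qed.

Lemma join_is_chain p : is_chain nu (level p.1 k) p.1 -> is_chain (level p.1 k) mu p.2 ->
  is_chain nu mu (join p).
Proof.
move=> h1 h2; case/chainP: (h1) => a0 _ a; case/chainP: (h2) => _ bN b.
apply/chainP; split=> [i iR|i iR|j i jkm].
- by rewrite level_join ?a0.
- by rewrite level_join_upper ?bN.
case: (ltnP j k) => jk.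
  rewrite !level_join ?(ltnW jkm) // jk (ltnW jk).
  by apply: a.
have -> : j = (k + (j - k))%N by lia.
rewrite -addnS !(level_join_upper _ h2); try lia.
by apply: b; lia.
Qed.

Lemma lower_join p : lower (join p) = p.1.
Proof.
apply: eq_chain => j i jk _; rewrite level_lower // level_join ?jk //.
by apply: leq_trans (leq_addr _ _).
Qed.

Lemma upper_join p : is_chain (level p.1 k) mu p.2 -> upper (join p) = p.2.
Proof. by move=> h; apply: eq_chain => j i jm _; rewrite level_upper // level_join_upper. Qed.

Lemma join_split T : join (lower T, upper T) = T.
Proof.
apply: eq_chain => j i jkm _; rewrite level_join //=.
case: leqP => jk; first by rewrite level_lower.
by rewrite level_upper ?subnKC //; [exact: ltnW|lia].
Qed.

Lemma weight_lower T j : (j < k)%N -> weight (lower T) j = weight T j.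
Proof.
move=> jk; congr (_ - _)%N; apply: eq_bigr => i _; rewrite level_lower //; exact: ltnW.
Qed.

Lemma weight_upper T j : (j < m)%N -> weight (upper T) j = weight T (k + j).
Proof.
move=> jk; rewrite /weight -addnS.
by congr (_ - _)%N; apply: eq_bigr => i _; rewrite level_upper //; exact: ltnW.
Qed.

Lemma skew_kostka_split (c : 'I_(k + m) -> int) :
  skew_kostka (k + m) R D nu mu c =
  (\sum_(T1 : chain k R D | is_chain nu (level T1 k) T1)
     [forall i : 'I_k, (weight T1 i)%:Z == c (lshift m i)]
     * skew_kostka m R D (level T1 k) mu (fun i => c (rshift k i)))%N.
Proof.
under [RHS]eq_bigr => T1 _ do rewrite /skew_kostka big_distrr /=.
rewrite pair_big_dep /= /skew_kostka.
rewrite (reindex_onto join (fun T => (lower T, upper T))) /=;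
  last by move=> T _; rewrite join_split.
apply: eq_big => [p|p /andP[hT /eqP e]].
  apply/andP/andP => [[h /eqP e]|[h1 h2]].
    by rewrite -e /=; split; [apply: lower_is_chain h|apply: upper_is_chain h].
  by rewrite join_is_chain // lower_join upper_join //; case: (p).
rewrite -[in RHS]e /= -[in LHS]e join_split.
set T := join p; rewrite mulnb; congr nat_of_bool.
apply/forallP/andP => [h|[/forallP h1 /forallP h2] i].
  split; apply/forallP => i; first by rewrite weight_lower // -(eqP (h (lshift m i))).
  by rewrite weight_upper // -(eqP (h (rshift k i))).
case: (split_ordP i) => j ->; first by rewrite -(eqP (h1 j)) weight_lower.
by rewrite -(eqP (h2 j)) weight_upper.
Qed.

End Split.

Lemma eq_is_chain N R D (nu nu' mu mu' : nat -> nat) (T : chain N R D) :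
  (forall i, (i <= R)%N -> nu i = nu' i) -> (forall i, (i <= R)%N -> mu i = mu' i) ->
  is_chain nu mu T = is_chain nu' mu' T.
Proof.
move=> en em; rewrite /is_chain; congr [&& _, _ & _]; apply: eq_forallb => i.
  by rewrite en // -ltnS.
by rewrite em // -ltnS.
Qed.

Lemma eq_skew_kostka N R D (nu nu' mu mu' : nat -> nat) (c : 'I_N -> int) :
  (forall i, (i <= R)%N -> nu i = nu' i) -> (forall i, (i <= R)%N -> mu i = mu' i) ->
  skew_kostka N R D nu mu c = skew_kostka N R D nu' mu' c.
Proof. by move=> en em; apply: eq_bigl => T; apply: eq_is_chain. Qed.

Lemma chain_end_nonincr N R D nu mu (T : chain N R D) : nonincr nu ->
  is_chain nu mu T -> forall i, (i < R)%N -> (mu i.+1 <= mu i)%N.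
Proof.
move=> hnu /chainP[h0 hN h] i iR; rewrite -!hN //; last exact: ltnW.
case: N T h0 hN h => [|N] T h0 hN h; first by rewrite !h0 // ltnW.
by case/andP: (h N i (ltnSn N)); apply: leq_trans.
Qed.

(** The letters below k fill a shape nu and the others fill th/nu, to which [skew_kostka_schur]
    applies. The list is indexed by nu and a good tableau of shape th/nu, hence is independent of
    the content. *)
Theorem kostka_split th k m : is_partition th ->
  exists L : seq (seq nat * seq nat),
    all (fun p => is_partition p.1 && is_partition p.2) L /\
    forall c : 'I_(k + m) -> int,
      kostka th c = (\sum_(p <- L) kostka p.1 (fun i => c (lshift m i))
                                 * kostka p.2 (fun i => c (rshift k i)))%N.
Proof.
move=> hth; pose R := size th; pose D := part th 0; pose zero (_ : nat) := 0%N.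
pose shape := {ffun 'I_R.+1 -> 'I_D.+1}.
pose fn (nu : shape) (i : nat) : nat := if (i <= R)%N then nu (inord i) : nat else 0%N.
(* Among all functions, those that end a chain from the empty shape are certainly partitions; the
   others contribute zero and must stay out of the list. *)
pose reached nu := [exists T1 : chain k R D, is_chain zero (fn nu) T1].
pose P (x : shape * chain m R D) :=
  reached x.1 && (is_chain (fn x.1) (part th) x.2 && good (part [::]) x.2).
pose t (x : shape * chain m R D) :=
  (to_partition R.+1 (fn x.1), added (part [::]) x.2).
have fn_nonincr nu : reached nu -> forall i, (i.+1 < R.+1)%N -> (fn nu i.+1 <= fn nu i)%N.
  by case/existsP => T1 hT1 i iR; apply: chain_end_nonincr hT1 _ _.
have fnD nu i : (fn nu i <= D)%N by rewrite /fn; case: ifP => // _; rewrite -ltnS.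
exists [seq t x | x <- enum P]; split.
  apply/allP => q /mapP[[nu T2]]; rewrite mem_enum => /andP[/= hnu /andP[hT gT]] ->.
  rewrite (added_is_partition hT gT) andbT.
  exact: to_partition_is_partition (fn_nonincr _ hnu).
move=> c.
transitivity (skew_kostka (k + m) R D zero (part th) c); first by rewrite (@kostkaE _ _ R D).
rewrite skew_kostka_split.
pose pr (T1 : chain k R D) : shape := [ffun i : 'I_R.+1 => inord (level T1 k i)].
have prE T1 i : fn (pr T1) i = level T1 k i.
  rewrite /fn; case: (leqP i R) => iR; last by rewrite level_out.
  by rewrite ffunE !inordK // ltnS level_le.
rewrite (partition_big pr xpredT) //=.
transitivity (\sum_(nu : shape) skew_kostka k R D zero (fn nu) (fun i => c (lshift m i))
   * skew_kostka m R D (fn nu) (part th) (fun i => c (rshift k i)))%N.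
  apply: eq_bigr => nu _; rewrite {2}/skew_kostka big_distrl /=.
  apply: eq_big => [T1|T1 /andP[_ /eqP <-]]; last first.
    by congr (_ * _)%N; apply: eq_skew_kostka => // i _; rewrite prE.
  apply/andP/idP => [[h /eqP <-]|h].
    by rewrite (@eq_is_chain _ _ _ _ zero _ (level T1 k)) // => i _; rewrite prE.
  case/chainP: (h) => _ hk _; split.
    by rewrite (@eq_is_chain _ _ _ _ zero _ (fn nu)) // => i iR; rewrite hk.
  apply/eqP/ffunP => i; have iR : (i <= R)%N by rewrite -ltnS.
  rewrite ffunE hk // /fn iR.
  by rewrite !inord_val.
rewrite big_map big_enum_cond /=.
transitivity (\sum_(nu : shape | reached nu)
    \sum_(T2 : chain m R D | is_chain (fn nu) (part th) T2 && good (part [::]) T2)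
      kostka (to_partition R.+1 (fn nu)) (fun i => c (lshift m i))
      * kostka (added (part [::]) T2) (fun i => c (rshift k i)))%N; last first.
  by rewrite pair_big_dep /=; apply: eq_bigl => x; rewrite andbT.
rewrite [RHS]big_mkcond; apply: eq_bigr => nu _.
case: ifP => hnu; last first.
  rewrite /skew_kostka big_pred0 // => T1; apply/negbTE/negP => hT1.
  by case/negP: (negbT hnu); apply/existsP; exists T1.
rewrite -big_distrr /= -skew_kostka_schur; congr (_ * _)%N.
have hp := to_partition_is_partition (fn_nonincr _ hnu).
rewrite (@kostkaE _ _ R D) // ?size_to_partition //.
  by apply: eq_skew_kostka => // i iR; rewrite part_to_partition ?ltnS ?iR //; apply: fn_nonincr.
by rewrite part_to_partition ?fnD //; apply: fn_nonincr.
Qed.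

(** * Monomial virtual characters *)

Section Orbits.
Variable T : finType.
Implicit Types (s t w : {perm T}) (x y z : T) (O A : {set T}).

Lemma eq_porbit s t z : (forall u, u \in porbit s z -> t u = s u) -> porbit t z = porbit s z.
Proof.
move=> e; have it i : (t ^+ i)%g z = (s ^+ i)%g z.
  elim: i => [|i IH]; first by rewrite !expg0.
  by rewrite !expgSr !permM IH e // mem_porbit.
apply/setP => y; apply/porbitP/porbitP => -[i ->]; exists i; rewrite ?it //.
Qed.

Lemma porbit_stable s z u : u \in porbit s z -> s u \in porbit s z.
Proof. by case/porbitP => i ->; apply/porbitP; exists i.+1; rewrite expgSr permM. Qed.

Lemma porbit_fix s x : s x = x -> porbit s x = [set x].
Proof.
move=> sx; apply/setP => y; rewrite inE; apply/porbitP/eqP => [[i ->]|->].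
  by elim: i => [|i IH]; rewrite ?expg0 ?perm1 // expgSr permM IH.
by exists 0%N; rewrite expg0 perm1.
Qed.

Section Insertion.
Variables (w : {perm T}) (x y : T).
Hypotheses (wx : w x = x) (yx : y != x).
Let w' := (w * tperm x y)%g.

Let w'x : w' x = y. Proof. by rewrite permM wx tpermL. Qed.

(** Multiplication by the transposition inserts the fixed point x into the cycle of y, just before
    y. *)
Lemma porbit_insert : porbit w' x = x |: porbit w y.
Proof.
apply/eqP; rewrite eqEsubset; apply/andP; split; apply/subsetP => z.
  case/porbitP => i ->; elim: i => [|i IH]; first by rewrite expg0 perm1 setU11.
  rewrite expgSr permM; move: IH; set u := (w' ^+ i)%g x => IH.
  rewrite permM; case: tpermP => [_|_|_ _].
  - by rewrite inE porbit_id orbT.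
  - by rewrite setU11.
  - move: IH; rewrite !inE => /orP[/eqP ->|uw]; first by rewrite wx eqxx.
    by rewrite porbit_stable ?orbT.
rewrite !inE => /orP[/eqP ->|]; first exact: porbit_id.
have y' : y \in porbit w' x by rewrite -w'x porbit_stable // porbit_id.
case/porbitP => i ->; elim: i => [|i IH]; first by rewrite expg0 perm1.
rewrite expgSr permM; move: IH; set u := (w ^+ i)%g y => /porbit_stable.
by rewrite permM; case: tpermP => // ->; rewrite porbit_id.
Qed.

Lemma card_porbit_insert : #|porbit w' x| = #|porbit w y|.+1.
Proof.
rewrite porbit_insert cardsU1; suff -> : x \notin porbit w y by [].
by rewrite porbit_sym porbit_fix // inE.
Qed.

Lemma porbits_insert O :
  (O \in porbits w') && (x \notin O) = [&& O \in porbits w, x \notin O & y \notin O].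
Proof.
apply/andP/and3P => [[/imsetP[z _ ->] xO]|[/imsetP[z _ ->] xO yO]].
  have e : porbit w z = porbit w' z.
    apply: eq_porbit => u uO; have := porbit_stable uO; rewrite permM.
    case: tpermP => // [wux|wuy]; last by rewrite (negbTE xO).
    by have ux : u = x; [apply: (@perm_inj _ w); rewrite wx|rewrite -ux uO in xO].
  split=> //; first by rewrite -e imset_f.
  apply: contra xO => yO.
  have y' : y \in porbit w' x by rewrite -w'x porbit_stable // porbit_id.
  by move: yO y'; rewrite -!eq_porbit_mem => /eqP <- /eqP <-.
have e : porbit w' z = porbit w z.
  apply: eq_porbit => u uO; have := porbit_stable uO; rewrite permM.
  case: tpermP => // wu; first by rewrite wu (negbTE xO).
  by rewrite wu (negbTE yO).
by split=> //; rewrite -e imset_f.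
Qed.

End Insertion.
End Orbits.

(** * The cycle index of a Young subgroup *)

Section CycleIndex.
Variables (T C : finType) (f : T -> C) (R : comNzRingType) (P H : nat -> R).
Hypotheses (H0 : H 0%N = 1)
  (newton : forall n, n%:R * H n = \sum_(k < n) P k.+1 * H (n - k.+1)%N).
Implicit Types (w : {perm T}) (x y z : T) (O A : {set T}).

(** Membership in the Young subgroup of the fibres of [f]. *)
Definition preserves w : bool := [forall x, f (w x) == f x].

Definition cycle_index A : R :=
  \sum_(w | perm_on A w && preserves w)
    \prod_(O in porbits w | O \subset A) P #|O|.

(** The cycle of x is weighted as if it had j further elements: those that the recursion has already
    removed from it. *)
Definition pointed_index A x j : R :=
  \sum_(w | perm_on A w && preserves w)
    (P (#|porbit w x| + j) * \prod_(O in porbits w | (O \subset A) && (x \notin O)) P #|O|).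

Definition fiber A (i : C) : nat := #|[set z in A | f z == i]|.

Lemma preserves_tperm w x y : w x = x -> preserves (w * tperm x y)%g = (f y == f x) && preserves w.
Proof.
move=> wx; apply/forallP/andP => [h|[/eqP e /forallP h] z].
  have e : f y == f x by rewrite -(eqP (h x)) permM wx tpermL.
  split=> //; apply/forallP => z; rewrite -(eqP (h z)) permM.
  by case: tpermP => // ->; rewrite (eqP e).
by rewrite permM -(eqP (h z)); case: tpermP => // ->; rewrite e.
Qed.

(** Remove x from its cycle: either x was fixed, or its image y takes over the cycle, which has now
    lost one more element. *)
Lemma pointed_index_rec A x j : x \in A ->
  pointed_index A x j = P j.+1 * cycle_index (A :\ x)
   + \sum_(y in A :\ x | f y == f x) pointed_index (A :\ x) y j.+1.
Proof.
move=> xA.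
have wfix w : perm_on (A :\ x) w -> w x = x.
  by move=> h; apply: out_perm h _; rewrite !inE eqxx.
pose term w := P (#|porbit w x| + j) *
   \prod_(O in porbits w | (O \subset A) && (x \notin O)) P #|O|.
have subD O : (O \subset A) && (x \notin O) = (O \subset A :\ x).
  by rewrite subsetD1.
transitivity (\sum_(y in A | f y == f x)
    \sum_(w | perm_on (A :\ x) w && preserves w) term (w * tperm x y)%g).
  rewrite /pointed_index (partition_big (fun w : {perm T} => w x)
     (fun y => (y \in A) && (f y == f x))) /=; last first.
    by move=> w /andP[wA /forallP/(_ x) ->]; rewrite (perm_closed _ wA) xA.
  apply: eq_bigr => y /andP[yA fy].
  rewrite (reindex_inj (mulIg (tperm x y))) /=; apply: eq_bigl => w.
  apply/andP/andP => [[/andP[wA pw] /eqP wx]|[wA pw]].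
    have wx' : w x = x.
      by move: wx; rewrite permM => /(congr1 (tperm x y)); rewrite tpermK tpermR.
    move: pw; rewrite preserves_tperm // => /andP[_ ->]; split=> //.
    apply/subsetP => z; rewrite !inE => wz.
    have zx : z != x by apply: contraNneq wz => ->; rewrite wx'.
    rewrite zx /=; apply: contraR wz => zA; apply/eqP.
    have := out_perm wA zA; rewrite permM => /(congr1 (tperm x y)); rewrite tpermK => ->.
    by rewrite tpermD //; [rewrite eq_sym|apply: contraNneq zA => <-].
  have wx := wfix w wA; rewrite preserves_tperm // fy pw permM wx tpermL eqxx andbT.
  rewrite andbT; split=> //; apply: perm_onM; first by apply: subset_trans wA _; rewrite subD1set.
  apply/subsetP => z; rewrite inE; case: tpermP => [->|->|]; rewrite ?eqxx //.
rewrite (bigD1 x) /=; last by rewrite xA eqxx.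
congr (_ + _).
  rewrite /cycle_index big_distrr; apply: eq_bigr => w /andP[wA _].
  rewrite tperm1 mulg1 /term porbit_fix ?(wfix w) // cards1; congr (_ * _).
  by apply: eq_bigl => O; rewrite subD.
apply: eq_big => [y|y /andP[/andP[yA fy] yx]]; first by rewrite !inE andbC andbA.
apply: eq_bigr => w /andP[wA _]; have wx := wfix w wA.
rewrite /term card_porbit_insert // addnS addSn; congr (_ * _).
apply: eq_bigl => O; rewrite -subD.
have := porbits_insert y wx O.
case: (O \in porbits (w * _)%g); case: (O \in porbits w); case: (x \in O);
  by case: (y \in O); case: (O \subset A).
Qed.

Lemma fiber_D1 A x i : x \in A -> fiber A i = ((i == f x) + fiber (A :\ x) i)%N.
Proof.
move=> xA; rewrite /fiber (cardsD1 x) inE xA eq_sym; congr (_ + _)%N.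
by apply: eq_card => z; rewrite !inE andbA.
Qed.

Lemma sum_fiber A x : (\sum_(y in A | f y == f x) 1 = fiber A (f x))%N.
Proof. by rewrite sum1_card; apply: eq_card => y; rewrite !inE. Qed.

Let part_value (c : nat) : R := c`!%:R * H c.

(** Both closed formulas are proved together by induction on the size of A. At j = 0 the pointed one
    contains the right side of Newton's identity, which yields the formula for [cycle_index]. *)
Theorem cycle_indexE A : cycle_index A = \prod_i part_value (fiber A i).
Proof.
have main n : forall A, #|A| = n ->
  cycle_index A = \prod_i part_value (fiber A i) /\
  forall x j, x \in A -> pointed_index A x j =
    ((fiber A (f x)).-1)`!%:R
    * (\sum_(k < fiber A (f x)) P (k.+1 + j)%N * H (fiber A (f x) - k.+1)%N)
    * \prod_(i | i != f x) part_value (fiber A i).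
  elim: n => [|n IH] {}A cA.
    have -> : A = set0 by apply/eqP; rewrite -cards_eq0 cA.
    split=> [|x j]; last by rewrite inE.
    rewrite big1 => [|i _]; last first.
      by rewrite /part_value /fiber (_ : [set _ in _ | _] = set0) ?cards0 ?H0 ?mulr1 //;
         apply/setP => z; rewrite !inE.
    rewrite /cycle_index (big_pred1 1%g) => [|w] /=.
      rewrite big1 // => O /andP[/imsetP[z _ ->]] /subsetP/(_ z (porbit_id _ _)).
      by rewrite inE.
    apply/andP/eqP => [[w0 _]|->].
      by apply/permP => z; rewrite perm1 (out_perm w0) ?inE.
    by rewrite perm_on1; split=> //; apply/forallP => z; rewrite perm1.
  have pt x j : x \in A -> pointed_index A x j =
      ((fiber A (f x)).-1)`!%:R
      * (\sum_(k < fiber A (f x)) P (k.+1 + j)%N * H (fiber A (f x) - k.+1)%N)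
      * \prod_(i | i != f x) part_value (fiber A i).
    move=> xA; have cA' : #|A :\ x| = n by move: cA; rewrite (cardsD1 x) xA => -[].
    have [IHz IHp] := IH _ cA'.
    rewrite pointed_index_rec // IHz (bigD1 (f x)) //=.
    have pe : \prod_(i | i != f x) part_value (fiber A i) =
              \prod_(i | i != f x) part_value (fiber (A :\ x) i).
      by apply: eq_bigr => i /negbTE ne; rewrite (fiber_D1 _ xA) ne.
    rewrite pe (fiber_D1 _ xA) eqxx add1n /=.
    set c := fiber _ _; set Q := \prod_(i | _) _.
    (* The c other elements with the colour of x give equal terms. *)
    transitivity (P j.+1 * (part_value c * Q) +
       c%:R * ((c.-1)`!%:R * (\sum_(k < c) P (k.+1 + j.+1)%N * H (c - k.+1)%N) * Q)).
      congr (_ + _).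
      rewrite (eq_bigr (fun=> (c.-1)`!%:R *
          (\sum_(k < c) P (k.+1 + j.+1)%N * H (c - k.+1)%N) * Q)); last first.
        by move=> y /andP[yA /eqP fy]; rewrite IHp // fy.
      rewrite -/(fiber _ _) /c -sum_fiber natr_sum mulr_suml.
      by apply: eq_bigr => y _; rewrite mul1r.
    rewrite big_ord_recl /= subSS subn0 add1n.
    have -> : \sum_(i < c) P ((bump 0 i).+1 + j)%N * H (c.+1 - (bump 0 i).+1)%N =
       \sum_(k < c) P (k.+1 + j.+1)%N * H (c - k.+1)%N.
      by apply: eq_bigr => i _; rewrite /bump add1n subSS addSnnS.
    rewrite /part_value; set S := \sum_(k < c) _.
    case: c @S => [|c] S.
      rewrite /S big_ord0 fact0 /=; ring.
    rewrite factS natrM /=; ring.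
  split=> //.
  have [x xA] : exists x, x \in A by apply/set0Pn; rewrite -cards_eq0 cA.
  have -> : cycle_index A = pointed_index A x 0.
    apply: eq_bigr => w /andP[wA _]; rewrite addn0 (bigD1 (porbit w x)) /=; last first.
      rewrite imset_f //=; apply/subsetP => z /porbitP[i ->].
      by elim: i => [|i IHi]; rewrite ?expg0 ?perm1 // expgSr permM (perm_closed _ wA).
    congr (_ * _); apply: eq_bigl => O; rewrite -andbA.
    case: (boolP (O \in porbits w)) => //= /imsetP[z _ ->]; congr (_ && _).
    by rewrite eq_porbit_mem porbit_sym.
  rewrite pt // [RHS](bigD1 (f x)) //=; congr (_ * _).
  under eq_bigr => k _ do rewrite addn0.
  rewrite -newton (fiber_D1 _ xA) eqxx add1n /= /part_value factS natrM.
  by rewrite mulrCA mulrA.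
by case: (main _ _ (erefl #|A|)).
Qed.

End CycleIndex.

(** * Class functions and sums over Young subgroups *)

Section OrbitColoring.
Variables (T : finType) (w : {perm T}).

Lemma porbit_in x : porbit w x \in porbits w.
Proof. exact: imset_f. Qed.

Definition orbit_color (x : T) : 'I_#|porbits w| := enum_rank_in (porbit_in x) (porbit w x).

Lemma orbit_colorK x : enum_val (orbit_color x) = porbit w x.
Proof. by rewrite enum_rankK_in ?porbit_in. Qed.

Lemma orbit_color_eq x y : (orbit_color x == orbit_color y) = (x \in porbit w y).
Proof.
by rewrite -eq_porbit_mem -!orbit_colorK (inj_eq enum_val_inj).
Qed.

Lemma orbit_color_surj i : exists x, orbit_color x == i.
Proof.
case/imsetP: (enum_valP i) => x _ e; exists x.
by rewrite -(inj_eq enum_val_inj) orbit_colorK e.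
Qed.

Lemma orbit_color_preserves : preserves orbit_color w.
Proof.
by apply/forallP => x; rewrite orbit_color_eq porbit_stable // porbit_id.
Qed.

Lemma preserves_porbit (C : finType) (f : T -> C) x y :
  preserves f w -> y \in porbit w x -> f y = f x.
Proof.
move=> /forallP h /porbitP[i ->]; elim: i => [|i IH]; first by rewrite expg0 perm1.
by rewrite expgSr permM (eqP (h _)).
Qed.

(** Expanding the product chooses a colour for each cycle, that is, a colouring preserved by w. *)
Lemma prod_power_sums (C : finType) (R : comNzRingType) (a : C -> R) :
  \prod_(O in porbits w) \sum_i a i ^+ #|O| =
  \sum_(f : {ffun T -> C} | preserves f w) \prod_x a (f x).
Proof.
pose rep i := xchoose (orbit_color_surj i).
have repK i : orbit_color (rep i) = i by apply/eqP; exact: (xchooseP (orbit_color_surj i)).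
rewrite big_enum_val /= bigA_distr_bigA /=.
rewrite [RHS](reindex_onto (fun h : {ffun 'I_#|porbits w| -> C} => [ffun x => h (orbit_color x)])
   (fun f : {ffun T -> C} => [ffun i => f (rep i)])) /=; last first.
  move=> f pf; apply/ffunP => x; rewrite !ffunE; apply: preserves_porbit pf _.
  by rewrite -orbit_color_eq repK.
apply: eq_big => [h|h _].
  apply/esym/andP; split.
    by apply/forallP => x; rewrite !ffunE; have /forallP/(_ x)/eqP -> := orbit_color_preserves.
  by apply/eqP/ffunP => i; rewrite !ffunE repK.
rewrite [RHS](partition_big orbit_color xpredT) //=; apply: eq_bigr => i _.
rewrite (eq_bigr (fun=> a (h i))) => [|x /eqP e]; last by rewrite ffunE e.
rewrite prodr_const; congr (_ ^+ _); rewrite -{1}(repK i) orbit_colorK.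
by apply: eq_card => x; rewrite -orbit_color_eq repK.
Qed.

End OrbitColoring.

Section Conjugacy.
Variables (T : finType) (w s : {perm T}).
Hypothesis same : forall x, porbit w x = porbit s x.

(** In each common cycle, send the i-th iterate of s at a representative to the i-th iterate of w at
    the same point. *)
Lemma same_porbits_conj : exists t : {perm T}, w = (s ^ t)%g.
Proof.
(* [pick] depends only on the orbit as a set, so all points of a cycle share one representative. *)
pose rep (x : T) : T := odflt x [pick y in porbit s x].
have repO x : rep x \in porbit s x.
  by rewrite /rep; case: pickP => // /(_ x); rewrite porbit_id.
have rep_eq x y : porbit s x = porbit s y -> rep x = rep y.
  move=> e; rewrite /rep e; case: pickP => // /(_ y).
  by rewrite porbit_id.
pose len x := #|porbit s x|.
pose idx x := index x (traject s (rep x) (len x)).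
have repE x : porbit s (rep x) = porbit s x by apply/eqP; rewrite eq_porbit_mem.
have idxP x : (idx x < len x)%N.
  rewrite /idx -[X in (_ < X)%N](size_traject s (rep x)) index_mem.
  by rewrite /len -repE -porbit_traject repE porbit_id.
have idxE x : x = iter (idx x) s (rep x).
  by rewrite -(nth_traject s (idxP x)) nth_index // -index_mem size_traject; apply: idxP.
pose g x := iter (idx x) w (rep x).
have gO x : g x \in porbit s x.
  rewrite /g -repE -same; elim: (idx x) => [|i IH] /=; first exact: porbit_id.
  exact: porbit_stable.
have gs x : g (s x) = w (g x).
  have e : porbit s (s x) = porbit s x by apply/eqP; rewrite eq_porbit_mem porbit_stable ?porbit_id.
  have er := rep_eq _ _ e; have el : len (s x) = len x by rewrite /len e.
  have sx : s x = iter (idx x).+1 s (rep x) by rewrite iterS -idxE.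
  have wl : iter (len x) w (rep x) = rep x.
    by rewrite /len -repE -same iter_porbit.
  have := idxP x; rewrite /g er -iterS leq_eqVlt => /orP[/eqP lx|lx].
    have : s x = rep x by rewrite sx lx /len -repE iter_porbit.
    move=> sxr; have -> : idx (s x) = 0%N.
      rewrite /idx er el; case: (len x) (idxP x) => // l _.
      by rewrite /= sxr eqxx.
    by rewrite lx wl.
  congr (iter _ w _); rewrite {1}/idx er el sx -(nth_traject s lx).
  by rewrite index_uniq ?size_traject // /len -repE uniq_traject_porbit.
have g_inj : injective g.
  move=> x y exy.
  have e : porbit s x = porbit s y.
    by have := gO x; have := gO y; rewrite exy -!eq_porbit_mem => /eqP <- /eqP.
  have er := rep_eq _ _ e; have el : len x = len y by rewrite /len e.
  have u : uniq (traject w (rep y) (len y)) by rewrite /len -repE -same uniq_traject_porbit.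
  have ix : (idx x < len y)%N by rewrite -el.
  rewrite (idxE x) (idxE y) er; congr (iter _ s _).
  apply/eqP; rewrite -(nth_uniq (rep y) _ _ u) ?size_traject //.
  by rewrite !nth_traject //; move: exy; rewrite /g er => ->.
exists (perm g_inj); apply/permP => x.
have -> : x = perm g_inj (((perm g_inj)^-1)%g x) by rewrite permKV.
by rewrite permJ !permE gs.
Qed.

End Conjugacy.

Section Injectivity.
Variables (n : nat) (chi : 'S_n -> int).
Hypotheses (hchi : class_function chi)
  (chi0 : forall N (f : {ffun 'I_n -> 'I_N}), \sum_(w | preserves f w) chi w = 0).

(* Induction on the number of cycles: a permutation preserving the colouring of
   [u] by its own cycles has either more cycles than [u] or the same cycles. *)
Theorem class_function_inj u : chi u = 0.
Proof.
have [m] := ubnP (n - #|porbits u|); elim: m u => // m IH u hm.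
pose f : {ffun 'I_n -> 'I_#|porbits u|} := [ffun x => orbit_color u x].
have fE x : f x = orbit_color u x by rewrite ffunE.
have uf : preserves f u.
  by apply/forallP => x; rewrite !fE; have /forallP/(_ x) := orbit_color_preserves u.
have porbits_le (w : 'S_n) : (#|porbits w| <= n)%N.
  by apply: leq_trans (leq_imset_card _ _) _; rewrite card_ord.
have val w : preserves f w -> chi w = 0 \/ chi w = chi u.
  move=> pw.
  (* The colour of a cycle of w. Every colour occurs, so w has at least as many cycles as u; with
     equally many, [h] is injective and the cycles coincide. *)
  pose h (O : {set 'I_n}) : option 'I_#|porbits u| := omap (fun x => f x) [pick x in O].
  have hO x : h (porbit w x) = Some (f x).
    rewrite /h; case: pickP => [y yO|/(_ x)]; last by rewrite porbit_id.
    by rewrite /= (preserves_porbit pw yO).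
  have hsurj : (#|porbits u| <= #|h @: porbits w|)%N.
    have card_some : #|[set Some i | i : 'I_#|porbits u|]| = #|porbits u|.
      by rewrite card_imset ?card_ord //; apply: Some_inj.
    apply: leq_trans (eq_leq (esym card_some)) _; apply: subset_leq_card.
    apply/subsetP => _ /imsetP[i _ ->].
    have [x /eqP e] := orbit_color_surj i.
    by apply/imsetP; exists (porbit w x); rewrite ?porbit_in // hO fE e.
  have le := leq_trans hsurj (leq_imset_card h _).
  move: le; rewrite leq_eqVlt => /orP[/eqP e|lt]; last first.
    left; apply: IH; apply: leq_trans (ltn_sub2l (leq_trans lt (porbits_le w)) lt) _.
    by rewrite -ltnS.
  right; have hinj : {in porbits w &, injective h}.
    by apply/imset_injP; rewrite eqn_leq leq_imset_card -e hsurj.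
  have [t ->] : exists t, w = (u ^ t)%g.
    apply: same_porbits_conj => x; apply/setP => y.
    rewrite -[RHS]orbit_color_eq -!fE -eq_porbit_mem.
    apply/eqP/eqP => [xy|fxy].
      by apply: (preserves_porbit pw); rewrite -eq_porbit_mem xy.
    by apply: hinj; rewrite ?porbit_in // !hO fxy.
  exact: hchi.
(* If [chi u] is nonzero, all nonzero terms of the vanishing sum equal it, and the term of u is
   among them. *)
have := chi0 f; case: (eqVneq (chi u) 0) => // nz.
pose Q w := preserves f w && (chi w != 0).
rewrite (bigID (fun w => chi w != 0)) /= [X in _ + X]big1 ?addr0; last first.
  by move=> w /andP[_ /negPn/eqP].
rewrite (eq_bigr (fun=> chi u)) => [|w /andP[pw nw]]; last first.
  by case: (val w pw) => // cw; rewrite cw eqxx in nw.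
rewrite sumr_const => /eqP; rewrite mulrn_eq0 (negbTE nz) orbF => /eqP/card0_eq/(_ u).
by rewrite unfold_in uf nz.
Qed.

End Injectivity.

Definition content n N (f : 'I_n -> 'I_N) : 'X_{1..N} :=
  [multinom #|[set x | f x == i]| | i < N].

Section Content.
Variables (n N : nat).
Implicit Types (f g : {ffun 'I_n -> 'I_N}) (c : 'X_{1..N}).

Definition weight_fact (c : 'X_{1..N}) : nat := (\prod_i (c i)`!)%N.

Lemma weight_fact_gt0 c : (0 < weight_fact c)%N.
Proof. by apply: prodn_gt0 => i; rewrite fact_gt0. Qed.

Lemma content_conj f (s : 'S_n) : content [ffun x => f (s x)] = content f.
Proof.
apply/mnmP => i; rewrite !mnmE -[RHS](card_preimset _ (@perm_inj _ s)).
by apply: eq_card => x; rewrite !inE ffunE.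
Qed.

Lemma content_eq_conj f g : content f = content g ->
  exists s : 'S_n, f = [ffun x => g (s x)].
Proof.
move=> e; pose tf := [tuple f x | x < n]; pose tg := [tuple g x | x < n].
have cnt (h : {ffun 'I_n -> 'I_N}) i : count_mem i [tuple h x | x < n] = content h i.
  rewrite mnmE -sum1_card -sum1_count big_map big_enum_cond /=.
  by apply: eq_bigl => x; rewrite inE.
have : perm_eq tf tg by apply/allP => i _ /=; rewrite !cnt e eqxx.
case/tuple_permP => s es; exists s; apply/ffunP => x; rewrite ffunE.
have := congr1 (fun t => nth (f x) t x) es.
by rewrite -!tnth_nth !tnth_mktuple.
Qed.

Lemma content_exists c : mdeg c = n -> exists f, content f = c.
Proof.
move=> cn; pose s := flatten [seq nseq (c i) i | i <- enum 'I_N].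
have sz : size s == n.
  rewrite size_flatten /shape -map_comp sumnE big_map big_enum /= -cn mdegE.
  by apply/eqP; apply: eq_bigr => i _; rewrite /= size_nseq.
exists [ffun x => tnth (Tuple sz) x]; apply/mnmP => i; rewrite mnmE.
transitivity (count_mem i s).
  rewrite -[s]/(tval (Tuple sz)) -[in RHS](map_tnth_enum (Tuple sz)) count_map.
  rewrite -sum1_card -sum1_count big_enum_cond /=; apply: eq_bigl => x.
  by rewrite !inE ffunE.
rewrite count_flatten -map_comp sumnE big_map big_enum /= (bigD1 i) //=.
rewrite count_nseq /= eqxx mul1n big1 ?addn0 // => j ji.
by rewrite count_nseq /= (negbTE ji).
Qed.

Lemma mdeg_content f : mdeg (content f) = n.
Proof.
rewrite mdegE -[RHS]card_ord -sum1_card (partition_big f xpredT) //=.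
by apply: eq_bigr => i _; rewrite mnmE sum1dep_card; apply: eq_card => x; rewrite !inE.
Qed.

(** The cycle index with all power sums equal to 1, for which every h_n is 1. *)
Lemma card_preserves f : (#|[set w : 'S_n | preserves f w]| = weight_fact (content f))%N.
Proof.
have nw m : m%:R * 1 = \sum_(k < m) (1 * 1 : int).
  by rewrite !mulr1 sumr_const card_ord.
have /(_ [set: 'I_n]) := @cycle_indexE _ _ f int (fun=> 1) (fun=> 1) erefl nw.
rewrite /cycle_index => e; apply/eqP; rewrite -eqz_nat -!natz; apply/eqP.
transitivity (\sum_(w | preserves f w) 1 : int).
  by rewrite sumr_const; congr _%:R; apply: eq_card => w; rewrite inE.
transitivity (\sum_(w | perm_on [set: 'I_n] w && preserves f w) 1 : int).
  by apply: eq_bigl => w; rewrite (_ : perm_on _ _) //; apply/subsetP => x; rewrite inE.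
transitivity (\sum_(w | perm_on [set: 'I_n] w && preserves f w)
    \prod_(O in porbits w | O \subset [set: 'I_n]) 1 : int).
  by apply: eq_bigr => w _; rewrite big1.
rewrite e /weight_fact (big_morph _ (@natrM int) (erefl _)); apply: eq_bigr => i _.
by rewrite mulr1 mnmE; congr (_`!%:R); apply: eq_card => x; rewrite !inE.
Qed.

(* Orbit-stabiliser for the action of the symmetric group on words. *)
Lemma card_content f :
  (#|[set g : {ffun 'I_n -> 'I_N} | content g == content f]| * weight_fact (content f) = n`!)%N.
Proof.
rewrite -card_Sn -cardsT -[RHS]sum1_card.
rewrite (partition_big (fun s : 'S_n => [ffun x => f (s x)])
   (mem [set g : {ffun 'I_n -> 'I_N} | content g == content f])) /=; last first.
  by move=> s _; rewrite inE content_conj.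
rewrite -sum_nat_const; apply: eq_bigr => g; rewrite inE => /eqP /content_eq_conj[s0 ->].
rewrite -card_preserves -sum1_card [RHS](reindex_inj (mulgI s0)) /=.
apply: eq_bigl => w; rewrite !inE /=; apply/forallP/eqP => [h|/ffunP h x]; last first.
  by have := h ((s0^-1)%g x); rewrite !ffunE permM permKV => ->.
by apply/ffunP => x; rewrite !ffunE permM (eqP (h _)).
Qed.

End Content.

Section Frobenius.
Variables (n N : nat) (chi : 'S_n -> int).

(** For a class function: the order of the Young subgroup times the scalar product with the
    permutation character on its cosets. *)
Definition young_sum (f : {ffun 'I_n -> 'I_N}) : int := \sum_(w | preserves f w) chi w.

Lemma frobE : frob chi N =
  (n`!%:R)^-1 *: \sum_(f : {ffun 'I_n -> 'I_N}) (young_sum f)%:~R *: 'X_[content f].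
Proof.
rewrite /frob; congr (_ *: _).
have e (w : 'S_n) : (chi w)%:~R *: \prod_(O in porbits w) psym #|O| N =
    \sum_(f : {ffun 'I_n -> 'I_N} | preserves f w) (chi w)%:~R *: 'X_[content f] :> {mpoly rat[N]}.
  rewrite /psym prod_power_sums scaler_sumr; apply: eq_bigr => f _; congr (_ *: _).
  rewrite mpolyXE_id (partition_big f xpredT) //=; apply: eq_bigr => i _.
  rewrite (eq_bigr (fun=> 'X_i)) => [|x /eqP -> //].
  by rewrite prodr_const mnmE; congr (_ ^+ _); apply: eq_card => x; rewrite !inE.
under eq_bigr => w _ do rewrite e.
rewrite (exchange_big_dep xpredT) //=; apply: eq_bigr => f _.
by rewrite -scaler_suml /young_sum rmorph_sum.
Qed.

Lemma young_sum_conj (f : {ffun 'I_n -> 'I_N}) (s : 'S_n) : class_function chi ->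
  young_sum [ffun x => f (s x)] = young_sum f.
Proof.
move=> hchi; rewrite /young_sum (reindex_inj (conjg_inj (s^-1)%g)) /=.
apply: eq_big => [w|w _]; last by rewrite hchi.
have e x : s ((w ^ s^-1)%g x) = w (s x) by rewrite conjgE invgK !permM permKV.
apply/forallP/forallP => h x; last by rewrite !ffunE e.
by have := h ((s^-1)%g x); rewrite !ffunE e permKV.
Qed.

(** Words of equal content have equal Young sums, and [card_content] counts them. *)
Lemma frob_coef (f : {ffun 'I_n -> 'I_N}) : class_function chi ->
  (frob chi N)@_(content f) * (weight_fact (content f))%:R = (young_sum f)%:~R.
Proof.
move=> hchi; rewrite frobE mcoeffZ raddf_sum /=.
under eq_bigr => g _ do rewrite mcoeffZ mcoeffX.
rewrite (bigID (fun g : {ffun 'I_n -> 'I_N} => content g == content f)) /=.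
rewrite [X in _ + X]big1 ?addr0; last first.
  by move=> g /negbTE ->; rewrite mulr0.
rewrite (eq_bigr (fun=> (young_sum f)%:~R)); last first.
  move=> g /eqP e; rewrite e eqxx mulr1.
  by have [s ->] := content_eq_conj e; rewrite young_sum_conj.
rewrite sumr_const -(card_content f) natrM.
set K := #|[set g : {ffun 'I_n -> 'I_N} | content g == content f]|.
rewrite (_ : #|_| = K); last by apply: eq_card => g; rewrite inE.
have wn : (weight_fact (content f))%:R != 0 :> rat by rewrite pnatr_eq0 -lt0n weight_fact_gt0.
have Kn : K%:R != 0 :> rat.
  by rewrite pnatr_eq0 -lt0n; apply/card_gt0P; exists f; rewrite inE.
by rewrite -[_ *+ K]mulr_natl; field; apply/andP.
Qed.

Lemma frob_coef0 c : mdeg c != n -> (frob chi N)@_c = 0.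
Proof.
move=> cn; rewrite frobE mcoeffZ raddf_sum /= big1 ?mulr0 // => f _.
rewrite mcoeffZ mcoeffX; case: eqP => [e|]; last by rewrite mulr0.
by rewrite -e mdeg_content eqxx in cn.
Qed.

End Frobenius.

(** * Newton's identities and the monomial characters *)

Section Newton.
Variables (R : comNzRingType) (H : nat -> R).

(** The power sums p_1, ..., p_n that Newton's identities determine from H, without division. Each
    one needs all the earlier ones, hence the list. *)
Fixpoint newton_seq (n : nat) : seq R :=
  if n is n'.+1 then
    let s := newton_seq n' in
    rcons s (n%:R * H n - \sum_(k < n') s`_k * H (n - k.+1)%N)
  else [::].

Definition newton_power (k : nat) : R := (newton_seq k)`_k.-1.

Lemma size_newton_seq n : size (newton_seq n) = n.
Proof. by elim: n => //= n IH; rewrite size_rcons IH. Qed.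

Lemma nth_newton_seq n k : (k < n)%N -> (newton_seq n)`_k = newton_power k.+1.
Proof.
elim: n => // n IH; rewrite ltnS leq_eqVlt => /orP[/eqP -> //|kn].
by rewrite [newton_seq n.+1]/= nth_rcons size_newton_seq kn IH.
Qed.

Lemma newton_identity n : H 0%N = 1 ->
  n%:R * H n = \sum_(k < n) newton_power k.+1 * H (n - k.+1)%N.
Proof.
move=> H0; case: n => [|n]; first by rewrite big_ord0 mul0r.
rewrite big_ord_recr /= subnn H0 mulr1 {2}/newton_power /=.
rewrite nth_rcons size_newton_seq ltnn eqxx.
rewrite [X in _ - X](eq_bigr (fun k : 'I_n => newton_power k.+1 * H (n.+1 - k.+1)%N)) => [|k _].
  by rewrite addrC subrK.
by rewrite nth_newton_seq.
Qed.

End Newton.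

(* The ring of symmetric functions as the polynomial ring in h_1, ..., h_B: the
   variable of index j stands for h_(j+1), so a monomial is a partition given by
   its multiplicities, and [monomial_char B m w] is the coefficient of h_m in the
   power sum attached to the cycle type of w. *)
Section MonomialChar.
Variable B : nat.

Definition hmon (j : nat) : 'X_{1..B} := [multinom (i.+1 == j : nat) | i < B].

(** [hmon j] is the zero exponent for j = 0, in accordance with h_0 = 1, but also for j > B; there
    h_j is set to 0. *)
Definition hvar (j : nat) : {mpoly int[B]} := if (j <= B)%N then 'X_[hmon j] else 0.

Definition pvar : nat -> {mpoly int[B]} := newton_power hvar.

Definition cycle_prod n (w : 'S_n) : {mpoly int[B]} := \prod_(O in porbits w) pvar #|O|.

Definition monomial_char n (m : 'X_{1..B}) (w : 'S_n) : int := (cycle_prod w)@_m.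

Definition multiplicities N (c : 'X_{1..N}) : 'X_{1..B} := (\sum_i hmon (c i))%MM.

Definition mult_of (la : seq nat) : 'X_{1..B} := [multinom count_mem i.+1 la | i < B].

Lemma hvar0 : hvar 0 = 1.
Proof.
rewrite /hvar leq0n (_ : hmon 0 = 0%MM) ?mpolyX0 //.
Qed.

Lemma monomial_char_class n m : class_function (@monomial_char n m).
Proof.
move=> w s; rewrite /monomial_char /cycle_prod; congr (_@_m).
have pc x : porbit (w ^ s)%g (s x) = s @: porbit w x.
  apply/setP => y; apply/porbitP/imsetP => [[i ->]|[z /porbitP[i ->] ->]].
    by exists ((w ^+ i)%g x); rewrite ?mem_porbit // -conjXg permJ.
  by exists i; rewrite -conjXg permJ.
have -> : porbits (w ^ s)%g = [set s @: (O : {set 'I_n}) | O in porbits w].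
  apply/setP => O; apply/imsetP/imsetP => [[x _ ->]|[O' /imsetP[x _ ->] ->]].
    exists (porbit w ((s^-1)%g x)); first exact: imset_f.
    by rewrite -pc permKV.
  by exists (s x); rewrite ?pc.
rewrite big_imset /=; last by move=> O O' _ _; apply: imset_inj; apply: perm_inj.
by apply: eq_bigr => O _; rewrite card_imset //; apply: perm_inj.
Qed.

(** By the cycle index, the sum of the [cycle_prod] over the Young subgroup is the product of the
    c_i! h_(c_i), a multiple of a single monomial. *)
Lemma young_sum_monomial_char n N m (f : {ffun 'I_n -> 'I_N}) : (n <= B)%N ->
  young_sum (monomial_char m) f =
  (weight_fact (content f))%:R * (multiplicities (content f) == m)%:R.
Proof.
move=> nB; rewrite /young_sum /monomial_char -raddf_sum /=.
transitivity ((cycle_index f pvar [set: 'I_n])@_m).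
  congr (_@_m); apply: eq_big => [w|w _].
    by rewrite (_ : perm_on _ _) //; apply/subsetP => x; rewrite inE.
  by apply: eq_bigl => O; rewrite subsetT andbT.
rewrite (@cycle_indexE _ _ _ _ _ hvar); first last.
- by move=> k; apply: newton_identity; apply: hvar0.
- exact: hvar0.
have -> : \prod_i ((fiber f [set: 'I_n] i)`!%:R * hvar (fiber f [set: 'I_n] i)) =
    (weight_fact (content f))%:R *: 'X_[multiplicities (content f)] :> {mpoly int[B]}.
  rewrite big_split /= /weight_fact /multiplicities.
  rewrite (big_morph _ (@mpolyXD B int) (@mpolyX0 B int)).
  rewrite -[RHS]mul_mpolyC; congr (_ * _); last first.
    apply: eq_bigr => i _; have -> : fiber f [set: 'I_n] i = content f i.
      by rewrite mnmE; apply: eq_card => x; rewrite !inE.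
    have e := mdeg_content f; rewrite mdegE (bigD1 i) //= in e.
    by rewrite /hvar ifT //; apply: leq_trans nB; apply: leq_trans (leq_addr _ _) (eq_leq e).
  rewrite mpolyC_nat -natr_prod; congr _%:R; apply: eq_bigr => i _.
  by rewrite mnmE; congr (_`!); apply: eq_card => x; rewrite !inE.
by rewrite mcoeffZ mcoeffX.
Qed.

Lemma multiplicitiesE N (c : 'X_{1..N}) j : multiplicities c j = count_mem j.+1 c.
Proof.
rewrite mnm_sumE -sum1_count big_tuple [RHS]big_mkcond /=.
by apply: eq_bigr => i _; rewrite mnmE mnm_tnth eq_sym; case: eqP.
Qed.

Lemma perm_multiplicities N (c : 'X_{1..N}) la : is_partition la ->
  (forall i, (c i <= B)%N) -> {in la, forall x, (x <= B)%N} ->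
  perm_eq [seq e <- c | e != 0%N] la = (multiplicities c == mult_of la).
Proof.
move=> /andP[_ la0] cB laB.
have cnt j : count_mem j.+1 [seq e <- c | e != 0%N] = count_mem j.+1 c.
  by rewrite count_filter; apply: eq_count => x /=; case: eqP => // ->.
apply/idP/eqP => [/seq.permP e|e].
  by apply/mnmP => j; rewrite multiplicitiesE mnmE -e cnt.
apply/allP => x _; apply/eqP; case: x => [|j].
  by rewrite !(count_memPn _) ?mem_filter ?eqxx.
rewrite cnt; case: (ltnP j B) => jB.
  by have /mnmP/(_ (Ordinal jB)) := e; rewrite multiplicitiesE mnmE.
rewrite !(count_memPn _) //; first by apply: contraL jB => /laB; rewrite -ltnNge.
apply: contraL jB => /tnthP[i ji]; rewrite -ltnNge ji -mnm_tnth; exact: cB.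
Qed.

Lemma sumn_multinom N (c : 'X_{1..N}) : sumn [seq e <- c | e != 0%N] = mdeg c.
Proof.
rewrite mdegE sumnE big_filter big_mkcond big_tuple /=; apply: eq_bigr => i _.
by rewrite mnm_tnth; case: eqP => //= ->.
Qed.

Lemma msym_coef N la (c : 'X_{1..N}) :
  (Defs.msym la N)@_c = (perm_eq [seq e <- c | e != 0%N] la)%:R.
Proof.
rewrite /Defs.msym raddf_sum /=; case: (boolP (perm_eq _ _)) => [p|np]; last first.
  apply: big1 => m pm; rewrite mcoeffX; case: eqP => // e.
  by rewrite -e pm in np.
have lt : (mdeg c < (sumn la).+1)%N by rewrite -sumn_multinom (perm_sumn p).
rewrite (bigD1 (BMultinom lt)) //= mcoeffX eqxx big1 ?addr0 // => m /andP[_ ne].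
by rewrite mcoeffX; case: eqP => // e; rewrite -(inj_eq val_inj) /= e eqxx in ne.
Qed.

Section Degree.
Variable n : nat.
Hypothesis nB : (n <= B)%N.

Lemma partition_of_le la : partition_of n la -> {in la, forall x, (x <= B)%N}.
Proof.
case/andP => _ /eqP sla x xla; apply: leq_trans nB; rewrite -sla.
by rewrite sumnE (big_rem x) //= leq_addr.
Qed.

Lemma content_le N (f : {ffun 'I_n -> 'I_N}) i : (content f i <= B)%N.
Proof.
have e := mdeg_content f; rewrite mdegE (bigD1 i) //= in e.
by apply: leq_trans nB; apply: leq_trans (leq_addr _ _) (eq_leq e).
Qed.

Lemma young_sum_vchar N la (phi : 'S_n -> int) (f : {ffun 'I_n -> 'I_N}) :
  partition_of n la -> monomial_vchar la phi ->
  young_sum phi f = (weight_fact (content f))%:R * (multiplicities (content f) == mult_of la)%:R.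
Proof.
move=> hla [hphi fphi]; apply: (@intr_inj rat).
rewrite -frob_coef // fphi msym_coef intrM !rmorph_nat mulrC.
rewrite perm_multiplicities //; first by case/andP: hla.
  exact: content_le.
exact: partition_of_le.
Qed.

Theorem monomial_char_vchar la : partition_of n la ->
  monomial_vchar la (monomial_char (n := n) (mult_of la)).
Proof.
move=> hla; split=> [|N]; first exact: monomial_char_class.
apply/mpolyP => c; case: (eqVneq (mdeg c) n) => [cn|cn]; last first.
  rewrite frob_coef0 // msym_coef; case: (boolP (perm_eq _ _)) => // p.
  by case/andP: hla cn => _ /eqP <-; rewrite -(perm_sumn p) sumn_multinom eqxx.
have [f fc] := content_exists cn; rewrite -fc.
have wn : (weight_fact (content f))%:R != 0 :> rat by rewrite pnatr_eq0 -lt0n weight_fact_gt0.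
apply: (mulIf wn); rewrite frob_coef; last exact: monomial_char_class.
rewrite young_sum_monomial_char // msym_coef intrM !rmorph_nat mulrC.
rewrite perm_multiplicities //; first by case/andP: hla.
  exact: content_le.
exact: partition_of_le.
Qed.

Theorem monomial_vchar_unique la (phi : 'S_n -> int) : partition_of n la ->
  monomial_vchar la phi -> phi =1 monomial_char (mult_of la).
Proof.
move=> hla hphi w; apply/eqP; rewrite -subr_eq0; apply/eqP.
apply: (@class_function_inj n (fun w => phi w - monomial_char (mult_of la) w)).
  by move=> x y; case: hphi => hphi _; rewrite hphi monomial_char_class.
move=> N f; rewrite sumrB -/(young_sum _ _).
by rewrite (young_sum_vchar f hla hphi) -/(young_sum _ _) young_sum_monomial_char // subrr.
Qed.

(** Every exponent encodes a partition; if its size is not n, all Young sums vanish. So (P1) can be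
    used for all exponents, without a degree condition. *)
Theorem monomial_char_cases m :
  (exists2 la, partition_of n la & m = mult_of la) \/
  (forall w : 'S_n, monomial_char m w = 0).
Proof.
pose s := flatten [seq nseq (m j) (j : nat).+1 | j <- enum 'I_B].
pose la := sort geq s.
have s0 : 0%N \notin s.
  apply/negP => /flattenP[t /mapP[j _ ->]]; rewrite mem_nseq => /andP[_].
  by [].
have ms : mult_of la = m.
  apply/mnmP => j; rewrite mnmE count_sort count_flatten -map_comp sumnE big_map big_enum /=.
  rewrite (bigD1 j) //= count_nseq /= eqxx mul1n big1 ?addn0 // => k kj.
  rewrite count_nseq /=; case: eqP => // -[e].
  by case/eqP: kj; apply: val_inj.
have hla : is_partition la.
  rewrite /is_partition mem_sort s0 andbT; apply: sort_sorted => x y.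
  exact: leq_total.
case: (eqVneq (sumn la) n) => [sn|sn].
  by left; exists la; rewrite // /partition_of hla sn eqxx.
right; apply: class_function_inj; first exact: monomial_char_class.
move=> N f; rewrite -/(young_sum _ _) young_sum_monomial_char //.
case: eqP => [e|_]; last by rewrite mulr0.
case/eqP: sn; rewrite -(mdeg_content f) -sumn_multinom; apply/esym/perm_sumn.
rewrite perm_multiplicities // ?e ?ms //; first exact: content_le.
move=> x; rewrite mem_sort => /flattenP[t /mapP[j _ ->]].
by rewrite mem_nseq => /andP[_ /eqP ->]; apply: ltn_ord.
Qed.

End Degree.
End MonomialChar.

(** * Splitting (P1) *)

Section BlockPerm.
Variables (k m : nat).
Implicit Types (u : 'S_k) (v : 'S_m) (w : 'S_(k + m)).

Definition block_fun u v (i : 'I_(k + m)) : 'I_(k + m) :=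
  match split i with inl j => lshift m (u j) | inr j => rshift k (v j) end.

Lemma block_fun_inj u v : injective (block_fun u v).
Proof.
move=> i j; rewrite /block_fun.
case: (split_ordP i) => i' ->; case: (split_ordP j) => j' ->;
  rewrite ?(unsplitK (inl _)) ?(unsplitK (inr _)).
- by move/lshift_inj/perm_inj => ->.
- by move/eqP; rewrite eq_lrshift.
- by move/eqP; rewrite eq_rlshift.
- by move/rshift_inj/perm_inj => ->.
Qed.

Definition block u v : 'S_(k + m) := perm (@block_fun_inj u v).

Lemma blockL u v i : block u v (lshift m i) = lshift m (u i).
Proof. by rewrite permE /block_fun (unsplitK (inl _)). Qed.

Lemma blockR u v i : block u v (rshift k i) = rshift k (v i).
Proof. by rewrite permE /block_fun (unsplitK (inr _)). Qed.

Lemma blockM u u' v v' : (block u v * block u' v')%g = block (u * u') (v * v').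
Proof.
apply/permP => i; rewrite permM; case: (split_ordP i) => j ->.
  by rewrite !blockL permM.
by rewrite !blockR permM.
Qed.

Lemma block1 : block 1%g 1%g = 1%g.
Proof.
apply/permP => i; rewrite perm1; case: (split_ordP i) => j ->.
  by rewrite blockL perm1.
by rewrite blockR perm1.
Qed.

Lemma blockV u v : ((block u v)^-1)%g = block u^-1 v^-1.
Proof. by apply/eqP; rewrite eq_invg_mul blockM !mulgV block1. Qed.

Lemma blockJ u u' v v' : (block u v ^ block u' v')%g = block (u ^ u') (v ^ v').
Proof. by rewrite !conjgE blockV !blockM. Qed.

Lemma block_inj u u' v v' : block u v = block u' v' -> u = u' /\ v = v'.
Proof.
move=> e; split; apply/permP => i.
  by apply: (@lshift_inj k m); rewrite -(blockL u v) -(blockL u' v') e.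
by apply: (@rshift_inj k m); rewrite -(blockR u v) -(blockR u' v') e.
Qed.

Definition stable w : bool := [forall i : 'I_m, (k <= w (rshift k i))%N].

(** A permutation that maps the last m points to themselves does the same with the first k. *)
Lemma stable_block w : stable w -> exists u v, w = block u v.
Proof.
move/forallP => h.
have up (i : 'I_m) : exists j, w (rshift k i) = rshift k j.
  by have := h i; case: (split_ordP (w (rshift k i))) => j -> /=; [rewrite leqNgt ltn_ord|exists j].
have [g gE] := fin_all_exists up.
have g_inj : injective g by move=> i j e; apply/rshift_inj/(@perm_inj _ w); rewrite !gE e.
have lo (i : 'I_k) : exists j, w (lshift m i) = lshift m j.
  case: (split_ordP (w (lshift m i))) => j e; first by exists j.
  have : w (lshift m i) = w (rshift k ((perm g_inj)^-1 j)%g).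
    by rewrite e gE -[g _](permE g_inj) permKV.
  by move/perm_inj/eqP; rewrite eq_lrshift.
have [f fE] := fin_all_exists lo.
have f_inj : injective f by move=> i j e; apply/(@lshift_inj k m)/(@perm_inj _ w); rewrite !fE e.
exists (perm f_inj), (perm g_inj); apply/permP => i.
by case: (split_ordP i) => j ->; rewrite ?blockL ?blockR permE ?fE ?gE.
Qed.

Lemma sum_stable (V : nmodType) (F : 'S_(k + m) -> V) :
  (forall w, ~~ stable w -> F w = 0) ->
  \sum_w F w = \sum_(p : 'S_k * 'S_m) F (block p.1 p.2).
Proof.
move=> F0; rewrite (bigID stable) /= [X in _ + X]big1 ?addr0; last by move=> w; apply: F0.
have -> : \sum_(p : 'S_k * 'S_m) F (block p.1 p.2) =
    \sum_(w in [set block p.1 p.2 | p in [set: 'S_k * 'S_m]]) F w.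
  rewrite big_imset /=; first by apply: eq_bigl => p; rewrite inE.
  by move=> [u v] [u' v'] _ _ /= /block_inj[-> ->].
apply: eq_bigl => w; apply/idP/imsetP => [/stable_block[u [v ->]]|[[u v] _ -> /=]].
  by exists (u, v); rewrite ?inE.
by apply/forallP => i; rewrite blockR leq_addr.
Qed.

Lemma porbit_blockL u v i : porbit (block u v) (lshift m i) = lshift m @: porbit u i.
Proof.
have it j : ((block u v) ^+ j)%g (lshift m i) = lshift m ((u ^+ j)%g i).
  elim: j => [|j IH]; first by rewrite !expg0 !perm1.
  by rewrite !expgSr !permM IH blockL.
apply/setP => y; apply/porbitP/imsetP => [[j ->]|[_ /porbitP[j ->] ->]].
  by exists ((u ^+ j)%g i); rewrite ?mem_porbit.
by exists j; rewrite it.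
Qed.

Lemma porbit_blockR u v i : porbit (block u v) (rshift k i) = @rshift k m @: porbit v i.
Proof.
have it j : ((block u v) ^+ j)%g (rshift k i) = rshift k ((v ^+ j)%g i).
  elim: j => [|j IH]; first by rewrite !expg0 !perm1.
  by rewrite !expgSr !permM IH blockR.
apply/setP => y; apply/porbitP/imsetP => [[j ->]|[_ /porbitP[j ->] ->]].
  by exists ((v ^+ j)%g i); rewrite ?mem_porbit.
by exists j; rewrite it.
Qed.

Lemma prod_porbits_block (R : comNzRingType) (q : nat -> R) u v :
  \prod_(O in porbits (block u v)) q #|O| =
  (\prod_(O in porbits u) q #|O|) * (\prod_(O in porbits v) q #|O|).
Proof.
pose A := [set lshift m @: (O : {set 'I_k}) | O in porbits u].
pose A' := [set @rshift k m @: (O : {set 'I_m}) | O in porbits v].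
have linj : injective (fun O : {set 'I_k} => lshift m @: O) by apply/imset_inj/lshift_inj.
have rinj : injective (fun O : {set 'I_m} => @rshift k m @: O) by apply/imset_inj/rshift_inj.
transitivity (\prod_(O in [predU A & A']) q #|O|).
  apply: eq_bigl => O; rewrite !inE; apply/imsetP/orP => [[x _ ->]|].
    case: (split_ordP x) => j ->.
      by left; apply/imsetP; exists (porbit u j); rewrite ?imset_f // porbit_blockL.
    by right; apply/imsetP; exists (porbit v j); rewrite ?imset_f // porbit_blockR.
  case=> /imsetP[_ /imsetP[j _ ->] ->].
    by exists (lshift m j); rewrite // porbit_blockL.
  by exists (rshift k j); rewrite // porbit_blockR.
rewrite bigU /=; last first.
  rewrite disjoint_subset; apply/subsetP => _ /imsetP[_ /imsetP[j _ ->] ->].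
  rewrite inE; apply/imsetP => -[O' _ e].
  have : lshift m j \in @rshift k m @: O' by rewrite -e imset_f ?porbit_id.
  by case/imsetP => y _ /eqP; rewrite eq_lrshift.
rewrite (big_imset _ (in2W linj)) (big_imset _ (in2W rinj)) /=.
congr (_ * _); apply: eq_bigr => O _; rewrite card_imset //.
  exact: lshift_inj.
exact: rshift_inj.
Qed.

End BlockPerm.

Definition jt_matrix (a b : nat -> nat) (n N : nat) : 'M[{mpoly rat[N]}]_n :=
  \matrix_(i < n, j < n) hsym ((a i)%:Z - (b j)%:Z + (j : nat)%:Z - (i : nat)%:Z) N.

(** (P1) for row-length functions. The number B of variables is left free because both blocks of a
    split use exponents in the variables of the whole. *)
Definition monomial_positive (a b : nat -> nat) (n : nat) : Prop :=
  forall B (m : 'X_{1..B}), (n <= B)%N ->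
    schur_positive (fun N => immanant (monomial_char m) (jt_matrix a b n N)).

Lemma P1_monomial_positive mu nu n : P1 mu nu n -> monomial_positive (part mu) (part nu) n.
Proof.
move=> h B m nB; case: (monomial_char_cases nB m) => [[la hla ->]|z].
  exact: (h la _ hla (monomial_char_vchar nB hla)).
exists [::], (fun=> 0); split=> // N; rewrite big_nil.
by apply: big1 => w _; rewrite z mul0r.
Qed.

Lemma monomial_positive_P1 mu nu n : monomial_positive (part mu) (part nu) n -> P1 mu nu n.
Proof.
move=> h la phi hla hphi; apply: eq_schur_positive (h n (mult_of n la) (leqnn n)) => N.
apply: eq_bigr => w _; congr (_%:~R * _).
exact: monomial_vchar_unique hla hphi w.
Qed.

(* [a] and [b] describe rows that split after the first [k]: the Jacobi-Trudi
   matrix is then block upper triangular. *)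
Definition splits (a b : nat -> nat) (k m : nat) : Prop :=
  forall i j, (k <= i < k + m)%N -> (j < k)%N -> (a i <= b j)%N.

Lemma jt_matrix_block a b k m N (p : 'S_k * 'S_m) (i : 'I_(k + m)) :
  jt_matrix a b (k + m) N i (block p.1 p.2 i) =
  match split i with
  | inl j => jt_matrix a b k N j (p.1 j)
  | inr j => jt_matrix (fun i => a (k + i)%N) (fun i => b (k + i)%N) m N j (p.2 j)
  end.
Proof.
case: (split_ordP i) => j ->.
  by rewrite blockL !mxE.
rewrite blockR !mxE; congr (hsym _ N).
by rewrite /= !PoszD; lia.
Qed.

Lemma monomial_positive_split a b k m : splits a b k m ->
  monomial_positive a b k ->
  monomial_positive (fun i => a (k + i)%N) (fun i => b (k + i)%N) m ->
  monomial_positive a b (k + m).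
Proof.
move=> hs h1 h2 B M nB.
have kB : (k <= B)%N := leq_trans (leq_addr _ _) nB.
have mB : (m <= B)%N := leq_trans (leq_addl _ _) nB.
pose a' i := a (k + i)%N; pose b' i := b (k + i)%N.
(* Beyond the degree of M, so that K ranges over all decompositions of M. *)
pose D := (mdeg M).+1.
pose f (K : 'X_{1..B < D, D}) (N : nat) : {mpoly rat[N]} :=
  immanant (monomial_char K.1) (jt_matrix a b k N)
  * immanant (monomial_char K.2) (jt_matrix a' b' m N).
apply: (@eq_schur_positive _ (fun N => \sum_(K : 'X_{1..B < D, D} | M == (K.1 + K.2)%MM) f K N));
  last first.
  by apply: schur_positive_sum => K _; apply: schur_positiveM; [apply: h1|apply: h2].
move=> N; rewrite /immanant sum_stable; last first.
  (* An entry in a row i >= k and a column j < k is h_r with r = a_i - b_j + j - i < 0. *)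
  move=> w; rewrite negb_forall => /existsP[i]; rewrite -ltnNge => lt.
  rewrite (bigD1 (rshift k i)) //= mxE /hsym.
  have := hs (rshift k i) (w (rshift k i)); rewrite /= leq_addr ltn_add2l ltn_ord => /(_ isT lt) le.
  case e: (_ - _) => [d|d]; last by rewrite mul0r mulr0.
  by move: e; lia.
transitivity (\sum_(p : 'S_k * 'S_m) \sum_(K : 'X_{1..B < D, D} | M == (K.1 + K.2)%MM)
   ((monomial_char K.1 p.1)%:~R * \prod_i jt_matrix a b k N i (p.1 i)) *
   ((monomial_char K.2 p.2)%:~R * \prod_i jt_matrix a' b' m N i (p.2 i))).
  apply: eq_bigr => p _; rewrite /monomial_char /cycle_prod prod_porbits_block.
  rewrite mcoeffM rmorph_sum mulr_suml; apply: eq_bigr => K _.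
  rewrite rmorphM /= big_split_ord /= mulrACA; congr ((_ * _) * (_ * _)); apply: eq_bigr => i _.
    by rewrite jt_matrix_block (unsplitK (inl _)).
  by rewrite jt_matrix_block (unsplitK (inr _)).
rewrite exchange_big; apply: eq_bigr => K _.
rewrite /f /immanant big_distrlr /= pair_bigA.
by apply: eq_bigr.
Qed.

(** * Splitting (P2) *)

Section ConjSum.
Variable n : nat.
Implicit Types (F : 'S_n -> nat) (w : 'S_n).
Local Open Scope nat_scope.

Definition conj_sum F w : nat := \sum_(g : 'S_n) F (w ^ g)%g.

(** The fibres of g |-> w^g are cosets of the centraliser of w, whose order is n!/|C|. *)
Lemma conj_sum_class F w :
  conj_sum F w = n`! %/ #|(w ^: [set: 'S_n])%g| * \sum_(w' in (w ^: [set: 'S_n])%g) F w'.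
Proof.
set C := (w ^: _)%g; pose K := #|[set g : 'S_n | (w ^ g)%g == w]|.
have fib G : \sum_(g : 'S_n) G (w ^ g)%g = \sum_(w' in C) K * G w'.
  rewrite (partition_big (fun g : 'S_n => (w ^ g)%g) (mem C)) /=; last first.
    by move=> g _; apply: memJ_class; rewrite inE.
  apply: eq_bigr => _ /imsetP[g _ ->].
  rewrite (eq_bigr (fun=> G (w ^ g)%g)) => [|h /eqP -> //].
  rewrite sum_nat_const; congr (_ * _).
  rewrite /K -!sum1_card [LHS](reindex_inj (mulIg g)) /=.
  by apply: eq_bigl => h; rewrite inE unfold_in conjgM; apply: (inj_eq (conjg_inj g)).
have C0 : 0 < #|C| by apply/card_gt0P; exists w; apply: class_refl.
have := fib (fun=> 1); rewrite sum1_card sum_nat_const muln1 => e.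
have -> : n`! = #|C| * K by rewrite -e card_Sn.
by rewrite mulKn // /conj_sum (fib F) big_distrr.
Qed.

End ConjSum.

Lemma immanant_charE th mu nu n w : immanant_char th mu nu (n := n) w =
  (conj_sum (fun w' => kostka th (jt_content mu nu w')) w)%:Z.
Proof. by rewrite /immanant_char conj_sum_class. Qed.

Definition jt_entry (a b : nat -> nat) n (w : 'S_n) (i : 'I_n) : int :=
  (a i + delta i)%:Z - (b ((w^-1)%g i) + delta ((w^-1)%g i))%:Z.

Definition row_sum (a b : nat -> nat) n : nat := (\sum_(i < n) (a i - b i))%N.

Definition skew_rows (a b : nat -> nat) n : Prop :=
  [/\ forall i, (i.+1 < n)%N -> (a i.+1 <= a i)%N,
      forall i, (i.+1 < n)%N -> (b i.+1 <= b i)%N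
    & forall i, (i < n)%N -> (b i <= a i)%N].

(** The one-row Kostka number of the content, as [kostka_row] shows; this form also makes sense for
    size 0, where the list with the single part 0 is not a partition. *)
Definition nonneg_content (a b : nat -> nat) n (w : 'S_n) : nat :=
  [forall i, 0 <= jt_entry a b w i].

Lemma sum_jt_entry a b n (w : 'S_n) : skew_rows a b n ->
  \sum_i jt_entry a b w i = (row_sum a b n)%:Z.
Proof.
case=> _ _ ba; rewrite /jt_entry sumrB.
rewrite [X in _ - X](reindex_inj (@perm_inj _ w)) /=.
under [X in _ - X]eq_bigr => i _ do rewrite permK.
rewrite -sumrB /row_sum -natz natr_sum; apply: eq_bigr => i _.
by have := ba i (ltn_ord i); lia.
Qed.

Lemma kostka_eq0 th n (c : 'I_n -> int) : is_partition th ->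
  \sum_i c i != (sumn th)%:Z -> kostka th c = 0%N.
Proof.
move=> hth; apply: contra_neq_eq => k0.
rewrite (@kostkaE th n (size th) (part th 0)) ?leqnSn // in k0.
have [C hC eC] : exists2 C : chain n (size th) (part th 0), is_chain (fun=> 0%N) (part th) C
    & [forall k : 'I_n, (weight C k)%:Z == c k].
  case: (pickP (fun C : chain n (size th) (part th 0) => is_chain (fun=> 0%N) (part th) C
    && [forall k : 'I_n, (weight C k)%:Z == c k])) => [C /andP[]|none]; first by exists C.
  case/eqP: k0; rewrite big1 // => C hC.
  by have := none C; rewrite /= hC /= => ->.
have := sum_weight hC (leqnn n).
have -> : area C 0 = 0%N by rewrite /area big1 // => i _; case/chainP: hC => -> //; rewrite -ltnS.
have -> : area C n = sumn th.
  rewrite (@sumn_part _ (size th).+1) //; apply: eq_bigr => i _.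
  by case/chainP: hC => _ -> //; rewrite -ltnS.
rewrite add0n => <-; rewrite -natz natr_sum; apply: eq_bigr => i _.
by rewrite -(eqP (forallP eC i)) natz.
Qed.

(** A row is determined by its content: its k-th level is the sum of the first k entries. *)
Lemma kostka_row M n (c : 'I_n -> int) : (0 < M)%N -> \sum_i c i = M%:Z ->
  kostka [:: M] c = [forall i, 0 <= c i].
Proof.
move=> M0 cM.
have hM : is_partition [:: M] by rewrite /is_partition /= inE eq_sym -lt0n.
rewrite (@kostkaE _ n 0 M) //; case: (boolP [forall i, _]) => [/forallP c0|]; last first.
  rewrite negb_forall => /existsP[k ck]; apply: big1 => T _.
  have -> // : [forall k : 'I_n, (weight T k)%:Z == c k] = false.
  by apply/negbTE; rewrite negb_forall; apply/existsP; exists k; apply: contraNneq ck => <-.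
pose s (k : nat) := (\sum_(l < n | (l < k)%N) `|c l|)%N.
have sS (k : 'I_n) : s k.+1 = (s k + `|c k|)%N.
  rewrite /s (bigD1 k) //= addnC; congr (_ + _)%N; apply: eq_bigl => l.
  by rewrite ltnS ltn_neqAle andbC.
have sn : s n = M.
  rewrite /s (eq_bigl xpredT) => [|l]; last by rewrite ltn_ord.
  apply/eqP; rewrite -eqz_nat -cM -natz natr_sum; apply/eqP; apply: eq_bigr => l _.
  by rewrite natz gez0_abs.
have smono k l : (k <= l)%N -> (s k <= s l)%N.
  move=> kl; rewrite /s [X in (_ <= X)%N]big_mkcond [X in (X <= _)%N]big_mkcond.
  by apply: leq_sum => i _; case: ltnP => // ik; rewrite (leq_trans ik kl).
have sM k : (s k <= M)%N.
  rewrite -sn /s [X in (_ <= X)%N]big_mkcond [X in (X <= _)%N]big_mkcond.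
  by apply: leq_sum => i _; rewrite ltn_ord; case: ifP.
pose C := mkchain n 0 M (fun k _ => s k).
have lC k : (k <= n)%N -> level C k 0 = s k by move=> kn; rewrite level_mk.
have a0 (T : chain n 0 M) k : area T k = level T k 0 by rewrite /area big_ord1.
have hC : is_chain (fun=> 0%N) (part [:: M]) C.
  apply/chainP; split=> [[|//] _|[|//] _|k i kn].
  - by rewrite lC // /s big_pred0.
  - by rewrite lC // sn.
  - rewrite level_out //=; case: i => [|i]; last by rewrite level_out.
    by rewrite !lC ?smono // ltnW.
rewrite (bigD1 C) //= [X in (X + _)%N](_ : _ = 1%N); last first.
  suff -> : [forall k : 'I_n, (weight C k)%:Z == c k] by [].
  apply/forallP => k; rewrite /weight !a0 !lC ?(ltnW (ltn_ord k)) ?ltn_ord // sS addKn.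
  by rewrite gez0_abs.
rewrite big1 // => T /andP[hT]; apply: contraNeq; rewrite eqb0 negbK => /forallP wT.
apply/eqP/eq_chain => k [|//] kn _; rewrite lC //.
elim: k kn => [|k IH] kn.
  by case/chainP: hT => -> // _ _; rewrite /s big_pred0.
have := weightE hT kn; rewrite !a0 IH ?(ltnW kn) // => <-.
rewrite (sS (Ordinal kn)) /=; congr (_ + _)%N; apply/eqP; rewrite -eqz_nat.
by rewrite (eqP (wT (Ordinal kn))) gez0_abs.
Qed.

(** * Induction from the block subgroup *)

Section Induced.
Variables (k m : nat).
Implicit Types (f : 'S_k -> 'S_m -> nat) (w : 'S_(k + m)).
Local Open Scope nat_scope.

(** For [f] a class function of the block subgroup: k! m! times the induced character. *)
Definition induced f w : nat :=
  \sum_(g : 'S_(k + m)) \sum_(p : 'S_k * 'S_m) ((w ^ g)%g == block p.1 p.2) * f p.1 p.2.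

Lemma eq_induced f f' w : (forall u v, f u v = f' u v) -> induced f w = induced f' w.
Proof. by move=> e; apply: eq_bigr => g _; apply: eq_bigr => p _; rewrite e. Qed.

Lemma inducedD f f' w : induced (fun u v => f u v + f' u v) w = induced f w + induced f' w.
Proof.
rewrite /induced -big_split; apply: eq_bigr => g _; rewrite -big_split.
by apply: eq_bigr => p _; rewrite mulnDr.
Qed.

Lemma induced0 w : induced (fun _ _ => 0) w = 0.
Proof. by rewrite /induced big1 // => g _; rewrite big1 // => p _; rewrite muln0. Qed.

Lemma conj_sum_induced (F : 'S_(k + m) -> nat) f w :
  (forall w, ~~ stable w -> F w = 0) -> (forall u v, F (block u v) = f u v) ->
  conj_sum F w = induced f w.
Proof.
move=> F0 Ff; apply: eq_bigr => g _; set x := (w ^ g)%g.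
case: (boolP (stable x)) => [/stable_block[u [v xE]]|nx]; last first.
  rewrite F0 // big1 // => p _; case: eqP => // e; case/negP: nx; rewrite e.
  by apply/forallP => i; rewrite blockR leq_addr.
rewrite xE Ff (bigD1 (u, v)) //= eqxx mul1n big1 ?addn0 // => -[u' v'] /= ne.
by case: eqP => // /block_inj[eu ev]; rewrite eu ev eqxx in ne.
Qed.

Lemma induced_conj f w (s : 'S_k) (t : 'S_m) :
  induced (fun u v => f (u ^ s)%g (v ^ t)%g) w = induced f w.
Proof.
rewrite /induced [RHS](reindex_inj (mulIg (block s t))) /=; apply: eq_bigr => g _.
rewrite [RHS](reindex_inj (h := fun p : 'S_k * 'S_m => ((p.1 ^ s)%g, (p.2 ^ t)%g))) /=; last first.
  by move=> [u v] [u' v'] [/conjg_inj -> /conjg_inj ->].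
apply: eq_bigr => p _; rewrite conjgM -blockJ; congr (nat_of_bool _ * _).
by symmetry; apply: (inj_eq (@conjg_inj _ (block s t))).
Qed.

(** Conjugating inside the block subgroup does not change [induced]. Summing over all such
    conjugations produces the factor k! m! on one side and [conj_sum] on the other. *)
Lemma induced_conj_sum (f1 : 'S_k -> nat) (f2 : 'S_m -> nat) w :
  k`! * m`! * induced (fun u v => f1 u * f2 v) w =
  induced (fun u v => conj_sum f1 u * conj_sum f2 v) w.
Proof.
transitivity (\sum_(s : 'S_k) \sum_(t : 'S_m) induced (fun u v => f1 (u ^ s)%g * f2 (v ^ t)%g) w).
  rewrite (eq_bigr (fun=> m`! * induced (fun u v => f1 u * f2 v) w)) => [|s _].
    by rewrite sum_nat_const card_Sn mulnA.
  rewrite (eq_bigr (fun=> induced (fun u v => f1 u * f2 v) w)) => [|t _].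
    by rewrite sum_nat_const card_Sn.
  exact: (induced_conj (fun u v => f1 u * f2 v)).
have push (I : finType) (F : I -> 'S_k -> 'S_m -> nat) :
    \sum_i induced (F i) w = induced (fun u v => \sum_i F i u v) w.
  rewrite /induced exchange_big; apply: eq_bigr => g _; rewrite exchange_big.
  by apply: eq_bigr => p _; rewrite big_distrr.
under eq_bigr => s _ do rewrite push.
rewrite push; apply: eq_induced => u v.
by rewrite /conj_sum big_distrlr.
Qed.

End Induced.

(* Stanley-Stembridge characters come from nonempty shapes, but splitting can
   produce an empty block, for which only [pos = false] is available. *)
Inductive ss_sum (n : nat) (pos : bool) : ('S_n -> nat) -> Prop :=
| SsNil G : G =1 (fun=> 0%N) -> ss_sum pos G
| SsCons a b G G' : skew_rows a b n -> (pos -> (0 < row_sum a b n)%N) -> ss_sum pos G ->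
    (forall w, G' w = (conj_sum (nonneg_content a b (n := n)) w + G w)%N) -> ss_sum pos G'.

Lemma eq_ss_sum n pos (G G' : 'S_n -> nat) : G =1 G' -> ss_sum pos G -> ss_sum pos G'.
Proof.
move=> e h; case: h e => [{}G G0|a b G1 {}G hs hp h1 GE] e.
  by apply: SsNil => w; rewrite -e G0.
by apply: (SsCons hs hp h1) => w; rewrite -e GE.
Qed.

Lemma ss_sum0 n pos : ss_sum pos (fun _ : 'S_n => 0%N).
Proof. exact: SsNil. Qed.

Lemma ss_sumD n pos (G G' : 'S_n -> nat) :
  ss_sum pos G -> ss_sum pos G' -> ss_sum pos (fun w => (G w + G' w)%N).
Proof.
move=> h h'; elim: h => [{}G G0|a b G1 {}G hs hp _ IH GE].
  by apply: eq_ss_sum h' => w; rewrite G0.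
by apply: (SsCons hs hp IH) => w; rewrite GE addnA.
Qed.

Lemma ss_sum_big n pos (I : Type) (r : seq I) (P : pred I) (G : I -> 'S_n -> nat) :
  (forall i, P i -> ss_sum pos (G i)) -> ss_sum pos (fun w => (\sum_(i <- r | P i) G i w)%N).
Proof.
move=> h; elim: r => [|i r IH].
  by apply: SsNil => w; rewrite big_nil.
case: (boolP (P i)) => Pi.
  by apply: eq_ss_sum (ss_sumD (h i Pi) IH) => w; rewrite big_cons Pi.
by apply: eq_ss_sum IH => w; rewrite big_cons (negbTE Pi).
Qed.

Lemma eq_kostka th n (c d : 'I_n -> int) : (forall i, c i = d i) -> kostka th c = kostka th d.
Proof.
move=> e; apply: eq_card => T; rewrite !inE; congr (_ && _).
by apply: eq_forallb => i; rewrite e.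
Qed.

Section Blocks.
Variables (a b : nat -> nat) (k m : nat).
Let a' i := a (k + i)%N.
Let b' i := b (k + i)%N.

Lemma jt_entry_blockL (u : 'S_k) (v : 'S_m) i :
  jt_entry a b (block u v) (lshift m i) = jt_entry a b u i.
Proof.
rewrite /jt_entry blockV blockL /delta /=.
have := ltn_ord i; have := ltn_ord ((u^-1)%g i); lia.
Qed.

Lemma jt_entry_blockR (u : 'S_k) (v : 'S_m) i :
  jt_entry a b (block u v) (rshift k i) = jt_entry a' b' v i.
Proof.
rewrite /jt_entry blockV blockR /delta /a' /b' /=.
have := ltn_ord i; have := ltn_ord ((v^-1)%g i); lia.
Qed.

(** [jt_entry] at i is the index of the Jacobi-Trudi entry in row i and column w^-1 i; it is
    negative below the diagonal blocks. *)
Lemma unstable_negative (w : 'S_(k + m)) : splits a b k m -> ~~ stable w ->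
  exists i, jt_entry a b w i < 0.
Proof.
move=> hs nw; have : ~~ stable (w^-1)%g.
  apply: contra nw => /stable_block[u [v e]].
  rewrite -[w]invgK e blockV; apply/forallP => i; by rewrite blockR leq_addr.
rewrite negb_forall => /existsP[i]; rewrite -ltnNge => lt; exists (rshift k i).
have := hs (rshift k i) _ _ lt; rewrite /= leq_addr ltn_add2l ltn_ord => /(_ isT).
rewrite /jt_entry /delta /=; have := ltn_ord i; lia.
Qed.

Lemma row_sum_split : row_sum a b (k + m) = (row_sum a b k + row_sum a' b' m)%N.
Proof. by rewrite /row_sum big_split_ord. Qed.

Lemma nonneg_content_block (u : 'S_k) (v : 'S_m) :
  nonneg_content a b (block u v) = (nonneg_content a b u * nonneg_content a' b' v)%N.
Proof.
rewrite /nonneg_content mulnb; congr nat_of_bool.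
apply/forallP/andP => [h|[/forallP h1 /forallP h2] i].
  split; apply/forallP => i; first by rewrite -(jt_entry_blockL u v).
  by rewrite -(jt_entry_blockR u v).
case: (split_ordP i) => j ->; first by rewrite jt_entry_blockL.
by rewrite jt_entry_blockR.
Qed.

Lemma conj_sum_nonneg_block w : splits a b k m ->
  conj_sum (nonneg_content a b (n := k + m)) w =
  induced (fun (u : 'S_k) (v : 'S_m) => nonneg_content a b u * nonneg_content a' b' v)%N w.
Proof.
move=> hs; apply: conj_sum_induced; last exact: nonneg_content_block.
move=> {}w /(unstable_negative hs)[i neg]; rewrite /nonneg_content.
by apply/eqP; rewrite eqb0 negb_forall; apply/existsP; exists i; rewrite -(Order.TotalTheory.ltNge).
Qed.

End Blocks.

(** The first shape is moved right by the longest row of the second one, which forces a split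
    between them. *)
Definition glue (k : nat) (a2 c1 c2 : nat -> nat) (i : nat) : nat :=
  if (i < k)%N then (c1 i + a2 0)%N else c2 (i - k)%N.

Lemma eq_row_sum a b c d n : {in gtn n, a =1 c} -> {in gtn n, b =1 d} ->
  row_sum a b n = row_sum c d n.
Proof. by move=> e e'; apply: eq_bigr => i _; rewrite e ?e' // inE. Qed.

Lemma eq_nonneg_content a b c d n (w : 'S_n) : {in gtn n, a =1 c} -> {in gtn n, b =1 d} ->
  nonneg_content a b w = nonneg_content c d w.
Proof.
move=> e e'; congr nat_of_bool; apply: eq_forallb => i.
by rewrite /jt_entry e ?e' // inE.
Qed.

Section Glue.
Variables (a1 b1 a2 b2 : nat -> nat) (k m : nat).
Hypotheses (h1 : skew_rows a1 b1 k) (h2 : skew_rows a2 b2 m).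
Let a := glue k a2 a1 a2.
Let b := glue k a2 b1 b2.

Lemma glue_le0 i : (i < m)%N -> (a2 i <= a2 0)%N /\ (b2 i <= a2 0)%N.
Proof.
case: h2 => da _ ba im.
have le : (a2 i <= a2 0)%N.
  elim: i im => // i IH im; apply: leq_trans (IH (ltnW im)); exact: da.
by split=> //; apply: leq_trans le; apply: ba.
Qed.

Lemma glue_skew_rows : skew_rows a b (k + m).
Proof.
have dec c1 c2 : (forall i, (i.+1 < k)%N -> (c1 i.+1 <= c1 i)%N) ->
    (forall i, (i.+1 < m)%N -> (c2 i.+1 <= c2 i)%N) ->
    (forall i, (i < m)%N -> (c2 i <= a2 0)%N) ->
    forall i, (i.+1 < k + m)%N -> (glue k a2 c1 c2 i.+1 <= glue k a2 c1 c2 i)%N.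
  move=> d1 d2 d0 i im; rewrite /glue.
  case: (ltnP i.+1 k) => ik; first by rewrite (ltnW ik) leq_add2r d1.
  case: (ltnP i k) => ik'; last by rewrite subSn //; apply: d2; lia.
  by apply: leq_trans (leq_addl _ _); apply: d0; lia.
case: (h1) => da1 db1 ba1; case: (h2) => da2 db2 ba2; split.
- by apply: dec => // i /glue_le0[].
- by apply: dec => // i /glue_le0[].
move=> i im; rewrite /a /b /glue; case: ltnP => ik; first by rewrite leq_add2r ba1.
by apply: ba2; lia.
Qed.

Lemma glue_splits : splits a b k m.
Proof.
move=> i j /andP[ki im] jk; rewrite /a /b /glue jk ltnNge ki /=.
have [le _] : (a2 (i - k) <= a2 0)%N /\ (b2 (i - k) <= a2 0)%N by apply: glue_le0; lia.
exact: leq_trans le (leq_addl _ _).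
Qed.

Lemma glue_row_sum : row_sum a b (k + m) = (row_sum a1 b1 k + row_sum a2 b2 m)%N.
Proof.
rewrite row_sum_split; congr (_ + _)%N.
  by apply: eq_bigr => i _; rewrite /a /b /glue ltn_ord subnDr.
by apply: eq_row_sum => i _; rewrite /a /b /glue ltnNge leq_addr addKn.
Qed.

Lemma glue_conj_sum w : conj_sum (nonneg_content a b (n := k + m)) w =
  induced (fun (u : 'S_k) (v : 'S_m) => nonneg_content a1 b1 u * nonneg_content a2 b2 v)%N w.
Proof.
rewrite (conj_sum_nonneg_block _ glue_splits); apply: eq_induced => u v; congr (_ * _)%N.
  congr nat_of_bool; apply: eq_forallb => i; congr (0 <= _).
  rewrite /jt_entry /a /b /glue !ltn_ord; lia.
by apply: eq_nonneg_content => i _; rewrite /a /b /glue ltnNge leq_addr addKn.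
Qed.

End Glue.

(** By bilinearity it is enough to glue one shape to another. The factor k! m! accounts for
    [induced] being unnormalised. *)
Lemma ss_sum_product k m pos1 pos2 (G1 : 'S_k -> nat) (G2 : 'S_m -> nat) :
  ss_sum pos1 G1 -> ss_sum pos2 G2 ->
  exists2 G : 'S_(k + m) -> nat, ss_sum (pos1 || pos2) G &
    forall w, (k`! * m`! * G w = induced (fun u v => G1 u * G2 v) w)%N.
Proof.
move=> h1; elim: h1 G2 => {G1} [G1 G0|a1 b1 G1 G1' hs1 hp1 _ IH1 G1E] G2 h2.
  exists (fun=> 0%N); first exact: ss_sum0.
  by move=> w; rewrite muln0 -(@induced0 k m w); apply: eq_induced => u v; rewrite G0.
have [G hG GE] := IH1 G2 h2.
suff [K hK KE] : exists2 K : 'S_(k + m) -> nat, ss_sum (pos1 || pos2) K &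
    forall w, (k`! * m`! * K w =
      induced (fun u v => conj_sum (nonneg_content a1 b1 (n := k)) u * G2 v) w)%N.
  exists (fun w => K w + G w)%N; first exact: ss_sumD.
  move=> w; rewrite mulnDr KE GE -inducedD; apply: eq_induced => u v.
  by rewrite G1E mulnDl.
elim: h2 => {G2 IH1 G hG GE} [G2 G0|a2 b2 G2 G2' hs2 hp2 _ [K hK KE] G2E].
  exists (fun=> 0%N); first exact: ss_sum0.
  by move=> w; rewrite muln0 -(@induced0 k m w); apply: eq_induced => u v; rewrite G0 muln0.
pose a := glue k a2 a1 a2; pose b := glue k a2 b1 b2.
exists (fun w => conj_sum (nonneg_content a b (n := k + m)) w + K w)%N.
  apply: SsCons (glue_skew_rows hs1 hs2) _ hK _ => //.
  rewrite glue_row_sum // addn_gt0 => /orP[/hp1 ->//|/hp2 ->]; exact: orbT.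
move=> w; rewrite mulnDr KE glue_conj_sum // induced_conj_sum -inducedD; apply: eq_induced => u v.
by rewrite G2E mulnDr.
Qed.

(** (P2) for row-length functions. Empty shapes may occur in the sum only if there is no box at
    all. *)
Definition ss_decomposable (a b : nat -> nat) (n : nat) : Prop :=
  forall th, partition_of (row_sum a b n) th ->
    ss_sum (0 < row_sum a b n)%N (conj_sum (fun w : 'S_n => kostka th (jt_entry a b w))).

Lemma ss_decomposable_split a b k m : skew_rows a b (k + m) -> splits a b k m ->
  ss_decomposable a b k ->
  ss_decomposable (fun i => a (k + i)%N) (fun i => b (k + i)%N) m ->
  ss_decomposable a b (k + m).
Proof.
set a' := fun i => _; set b' := fun i => _.
move=> hr hs h1 h2 th /andP[hth /eqP sth].
have hr1 : skew_rows a b k.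
  by case: hr => da db ba; split=> i ik; [apply: da|apply: db|apply: ba]; lia.
have hr2 : skew_rows a' b' m.
  case: hr => da db ba; split=> i ik; rewrite /a' /b' ?addnS; [apply: da|apply: db|apply: ba]; lia.
have [L [/allP hL LE]] := kostka_split k m hth.
(* The hypotheses on the blocks cover only pairs of the right sizes. The other pairs have a zero
   Kostka number, the sum of the content of each block being fixed. *)
pose good2 (p : seq nat * seq nat) :=
  partition_of (row_sum a b k) p.1 && partition_of (row_sum a' b' m) p.2.
pose f1 (p : seq nat * seq nat) (u : 'S_k) := kostka p.1 (jt_entry a b u).
pose f2 (p : seq nat * seq nat) (v : 'S_m) := kostka p.2 (jt_entry a' b' v).
have e w : conj_sum (fun w : 'S_(k + m) => kostka th (jt_entry a b w)) w =
    (\sum_(p <- L | good2 p) induced (fun u v => f1 p u * f2 p v) w)%N.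
  rewrite (@conj_sum_induced _ _ _ (fun u v => \sum_(p <- L | good2 p) f1 p u * f2 p v)%N).
  - rewrite /induced [RHS]exchange_big /=; apply: eq_bigr => g _.
    rewrite [RHS]exchange_big /=; apply: eq_bigr => p _.
    by rewrite big_distrr.
  - move=> {}w /(unstable_negative hs)[i neg]; apply/eqP; rewrite cards_eq0; apply/eqP/setP => T.
    rewrite !inE; apply/negbTE; rewrite negb_and; apply/orP; right.
    by rewrite negb_forall; apply/existsP; exists i; apply: contraTneq neg => <-.
  - move=> u v; rewrite LE [RHS]big_mkcond; apply: eq_big_seq => p /hL/andP[p1 p2].
    rewrite /f1 /f2; under eq_kostka => i do rewrite jt_entry_blockL.
    under [X in (_ * X)%N]eq_kostka => i do rewrite jt_entry_blockR.
    rewrite /good2 /partition_of p1 p2 /=; case: eqP => [_|ne1] /=; last first.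
      rewrite (@kostka_eq0 p.1) // sum_jt_entry //.
      by apply/eqP => -[]; apply/nesym.
    case: eqP => [//|ne2]; rewrite (@kostka_eq0 p.2) ?muln0 // sum_jt_entry //.
    by apply/eqP => -[]; apply/nesym.
apply: (eq_ss_sum (fun w => esym (e w))).
apply: ss_sum_big => p /andP[/h1 s1 /h2 s2].
have [G hG GE] := ss_sum_product s1 s2.
apply: eq_ss_sum (_ : ss_sum _ G) => [w|].
  by apply/eqP; rewrite -(eqn_pmul2l (_ : 0 < k`! * m`!)%N) ?muln_gt0 ?fact_gt0 //
     GE induced_conj_sum.
by rewrite row_sum_split addn_gt0.
Qed.

(** * Reduction to connected shapes *)

Lemma eq_monomial_positive a b c d n : {in gtn n, a =1 c} -> {in gtn n, b =1 d} ->
  monomial_positive a b n -> monomial_positive c d n.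
Proof.
move=> e e' h B m nB; apply: eq_schur_positive (h B m nB) => N.
congr (immanant _ _); apply/matrixP => i j; rewrite !mxE.
by rewrite e ?e' // inE.
Qed.

Lemma eq_jt_entry a b c d n (w : 'S_n) i : {in gtn n, a =1 c} -> {in gtn n, b =1 d} ->
  jt_entry a b w i = jt_entry c d w i.
Proof. by move=> e e'; rewrite /jt_entry e ?e' // inE. Qed.

Lemma eq_conj_sum n (F F' : 'S_n -> nat) w : F =1 F' -> conj_sum F w = conj_sum F' w.
Proof. by move=> e; apply: eq_bigr => g _; rewrite e. Qed.

Lemma eq_ss_decomposable a b c d n : {in gtn n, a =1 c} -> {in gtn n, b =1 d} ->
  ss_decomposable a b n -> ss_decomposable c d n.
Proof.
move=> e e' h th; rewrite -(eq_row_sum e e') => /h; apply: eq_ss_sum => w.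
by apply: eq_conj_sum => {}w; apply: eq_kostka => i; apply: eq_jt_entry.
Qed.

Lemma skew_shape_rows mu nu n : skew_shape mu nu -> skew_rows (part mu) (part nu) n.
Proof. by case=> hmu hnu le _; split=> i _ //; apply: part_nonincr. Qed.

Lemma row_sum_skew_size mu nu n : (skew_length mu nu <= n)%N ->
  row_sum (part mu) (part nu) n = skew_size mu nu.
Proof.
move=> len; pose F i := (part mu i - part nu i)%N.
have Fs i : (size mu <= i)%N -> F i = 0%N by rewrite /F => /part_default ->.
have Fn i : (n <= i)%N -> F i = 0%N.
  move=> ni; case: (ltnP i (size mu)) => [imu|/Fs //].
  apply/eqP; rewrite subn_eq0 leqNgt; apply/negP => lt.
  have := @leq_bigmax_cond _ (fun i : 'I_(size mu) => (part nu i < part mu i)%N)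
    (fun i => i.+1) (Ordinal imu) lt.
  by rewrite -/(skew_length mu nu) => /leq_trans/(_ len); rewrite ltnNge ni.
rewrite /row_sum /skew_size -(sum_ord_trim (leq_addr (size mu) n) Fn).
by rewrite -(sum_ord_trim (leq_addl n (size mu)) Fs).
Qed.

Lemma immanant_char_row n al be w : skew_shape al be -> (skew_length al be <= n)%N ->
  immanant_char [:: skew_size al be] al be (n := n) w =
  (conj_sum (nonneg_content (part al) (part be) (n := n)) w)%:Z.
Proof.
move=> sh len; rewrite immanant_charE; congr _%:Z; apply: eq_conj_sum => {}w.
rewrite kostka_row //; first by case: sh.
by rewrite -(row_sum_skew_size len) -(sum_jt_entry w (skew_shape_rows n sh)).
Qed.

Lemma ss_sum_weaken n (p p' : bool) (G : 'S_n -> nat) : (p' -> p) -> ss_sum p G -> ss_sum p' G.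
Proof.
move=> pp; elim=> {G} [G G0|a b G G' hs hp _ IH GE]; first exact: SsNil.
by apply: (SsCons hs _ IH GE) => /pp.
Qed.

Lemma stanley_stembridge_sum n k (chi : 'I_k -> 'S_n -> int) :
  (forall a, stanley_stembridge (chi a)) ->
  exists2 G : 'S_n -> nat, ss_sum true G & forall w, \sum_(a < k) chi a w = (G w)%:Z.
Proof.
elim: k chi => [|k IH] chi h.
  by exists (fun=> 0%N) => [|w]; [exact: ss_sum0|rewrite big_ord0].
have [G hG GE] := IH (fun a => chi (lift ord0 a)) (fun a => h _).
have [al [be [sh len chiE]]] := h ord0.
exists (fun w => conj_sum (nonneg_content (part al) (part be) (n := n)) w + G w)%N.
  apply: (SsCons (skew_shape_rows n sh) _ hG) => // _.
  by rewrite (row_sum_skew_size len); case: sh.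
by move=> w; rewrite big_ord_recl chiE immanant_char_row // GE PoszD.
Qed.

Lemma to_partition_shape a b n : skew_rows a b n -> (0 < row_sum a b n)%N ->
  [/\ skew_shape (to_partition n a) (to_partition n b),
      (skew_length (to_partition n a) (to_partition n b) <= n)%N,
      {in gtn n, part (to_partition n a) =1 a} & {in gtn n, part (to_partition n b) =1 b}].
Proof.
case=> da db ba pos; set al := to_partition n a; set be := to_partition n b.
have ea : {in gtn n, part al =1 a} by move=> i; rewrite inE part_to_partition // => ->.
have eb : {in gtn n, part be =1 b} by move=> i; rewrite inE part_to_partition // => ->.
have len : (skew_length al be <= n)%N.
  apply/bigmax_leqP => i _; exact: leq_trans (ltn_ord i) (size_to_partition n a).
split=> //; split; [exact: to_partition_is_partition|exact: to_partition_is_partition| |].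
  by move=> i; rewrite !part_to_partition //; case: ifP => // /ba.
by rewrite -(row_sum_skew_size len) (eq_row_sum ea eb).
Qed.

Lemma ss_sum_stanley_stembridge n (G : 'S_n -> nat) : ss_sum true G ->
  exists (k : nat) (chi : 'I_k -> 'S_n -> int),
    (forall a, stanley_stembridge (chi a)) /\ forall w, (G w)%:Z = \sum_(a < k) chi a w.
Proof.
elim=> {G} [G G0|a b G G' hs /(_ isT) pos _ [k [chi [hchi chiE]]] GE].
  exists 0%N, (fun _ _ => 0); split=> [[]//|w].
  by rewrite big_ord0 G0.
have [sh len ea eb] := to_partition_shape hs pos.
set al := to_partition n a in sh len ea; set be := to_partition n b in sh len eb.
exists k.+1, (fun i => if unlift ord0 i is Some j then chi j
                       else immanant_char [:: skew_size al be] al be (n := n)).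
split=> [i|w].
  by case: unliftP => [j _|_]; [exact: hchi|exists al, be].
rewrite big_ord_recl unlift_none immanant_char_row // GE PoszD chiE; congr (_ + _).
  congr _%:Z; apply: eq_conj_sum => {}w; apply/esym; exact: eq_nonneg_content.
by apply: eq_bigr => i _; rewrite liftK.
Qed.

Lemma P2_ss_decomposable mu nu n : (skew_length mu nu <= n)%N -> P2 mu nu n ->
  ss_decomposable (part mu) (part nu) n.
Proof.
move=> len h th; rewrite (row_sum_skew_size len) => hth.
have [k [chi [hchi chiE]]] := h th hth.
have [G hG GE] := stanley_stembridge_sum hchi.
apply: (ss_sum_weaken _ (eq_ss_sum _ hG)) => // w.
by apply/eqP; rewrite -eqz_nat -GE -chiE immanant_charE.
Qed.

Lemma ss_decomposable_P2 mu nu n : (skew_length mu nu <= n)%N -> (0 < skew_size mu nu)%N ->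
  ss_decomposable (part mu) (part nu) n -> P2 mu nu n.
Proof.
move=> len pos h th hth; have := h th; rewrite (row_sum_skew_size len) pos => /(_ hth).
case/ss_sum_stanley_stembridge => k [chi [hchi chiE]].
by exists k, chi; split=> // w; rewrite immanant_charE chiE.
Qed.

(** * Connectedness of overlapping rows *)

Section Connected.
Variables (mu nu : seq nat) (n : nat).
Hypotheses (mu_out : forall i, (n <= i)%N -> part mu i = 0%N)
  (nu_nonincr : nonincr (part nu))
  (row : forall i, (i < n)%N -> (part nu i < part mu i)%N)
  (overlap : forall i, (i.+1 < n)%N -> (part nu i < part mu i.+1)%N).

Let joined (x y : nat * nat) : Prop :=
  exists2 p : seq (nat * nat), path adjacent x p && all (in_diagram mu nu) p & last x p = y.

Let joined_trans y x z : joined x y -> joined y z -> joined x z.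
Proof.
move=> [p /andP[p1 p2] <-] [q /andP[q1 q2] <-]; exists (p ++ q); last by rewrite last_cat.
by rewrite cat_path p1 q1 all_cat p2 q2.
Qed.

Let adjacent_sym x y : adjacent x y = adjacent y x.
Proof.
rewrite /adjacent (eq_sym x.1 y.1) (eq_sym x.2 y.2).
by congr (_ && _ || _ && _); apply: orbC.
Qed.

(** The list of a path omits its starting box, which the reversed path visits; hence the condition
    on x. *)
Let joined_sym x y : in_diagram mu nu x -> joined x y -> joined y x.
Proof.
move=> dx [p /andP[p1 p2] <-]; exists (rev (belast x p)).
  rewrite rev_path all_rev (eq_path (e' := adjacent)); last by move=> u v; apply: adjacent_sym.
  rewrite p1 /=; case: p p2 {p1} => //= y' p /andP[dy dp].
  rewrite dx /=; apply/allP => z zp; apply: (allP (_ : all (in_diagram mu nu) (y' :: p))).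
    by rewrite /= dy.
  exact: mem_belast zp.
by case: p {p1 p2} => //= y' p; rewrite rev_cons last_rcons.
Qed.

Let joined1 x y : in_diagram mu nu y -> adjacent x y -> joined x y.
Proof. by move=> dy xy; exists [:: y]; rewrite //= xy dy. Qed.

Let in_row i j : in_diagram mu nu (i, j) -> (i < n)%N.
Proof. by case/andP => /= _ lt; rewrite ltnNge; apply/negP => /mu_out e; rewrite e in lt. Qed.

Let joined_row i j : in_diagram mu nu (i, j) -> joined (i, j) (i, part nu i).
Proof.
elim: j => [|j IH] dij.
  have e : part nu i = 0%N by case/andP: dij => /=; case: part.
  by rewrite e; exists [::].
case: (eqVneq (part nu i) j.+1) => [->|ne]; first by exists [::].
have dj : in_diagram mu nu (i, j).
  by move: dij ne; rewrite /in_diagram /=; lia.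
apply: joined_trans (IH dj); apply: joined1 dj _.
by rewrite /adjacent /= !eqxx.
Qed.

(** Rows i and i+1 both have a box in column [part nu i], by the overlap; there one climbs to row
    i. *)
Let joined_origin i j : in_diagram mu nu (i, j) -> joined (i, j) (0%N, part nu 0).
Proof.
elim: i j => [|i IH] j dij; first exact: joined_row.
have iN := in_row dij.
have d1 : in_diagram mu nu (i.+1, part nu i).
  by rewrite /in_diagram /= nu_nonincr overlap.
have d0 : in_diagram mu nu (i, part nu i) by rewrite /in_diagram /= leqnn row // ltnW.
apply: joined_trans (joined_row dij) _.
apply: joined_trans (joined_sym d1 (joined_row d1)) _.
apply: joined_trans (IH _ d0); apply: joined1 d0 _.
by rewrite /adjacent /= !eqxx /= orbT.
Qed.

Lemma overlap_connected : (0 < n)%N -> skew_length mu nu = n /\ connected_skew mu nu.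
Proof.
move=> n0.
have len : skew_length mu nu = n.
  apply/eqP; rewrite eqn_leq; apply/andP; split.
    apply/bigmax_leqP => i lt; rewrite ltnNge; apply/negP => /mu_out e.
    by rewrite e in lt.
  case: n n0 row => // n' _ r.
  have lt := r n' (ltnSn n'); have ns : (n' < size mu)%N.
    by rewrite ltnNge; apply/negP => /part_default e; rewrite e in lt.
  exact: (@leq_bigmax_cond _ (fun i : 'I_(size mu) => (part nu i < part mu i)%N)
    (fun i => i.+1) (Ordinal ns) lt).
split=> //; split=> [[i j] [i' j'] d d'|i]; last by rewrite len; apply: row.
exact: joined_trans (joined_origin d) (joined_sym d' (joined_origin d')).
Qed.

End Connected.

Section Empty.
Variables a b : nat -> nat.
Hypothesis ab : a 0 = b 0.

Lemma perm1_eq (w : 'S_1) : w = 1%g.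
Proof. by apply/permP => i; rewrite !ord1. Qed.

(** The matrix has the single entry h_0 = 1, so the immanant is the value of the character at the
    identity. *)
Lemma monomial_positive_empty : monomial_positive a b 1.
Proof.
move=> B m nB; pose c := monomial_char m (1%g : 'S_1).
(* The Young sum for a single colour consists of this value alone. *)
have c0 : 0 <= c.
  have := @young_sum_monomial_char B 1 1 m [ffun i => i] nB.
  rewrite /young_sum (big_pred1 1%g) => [|w]; last first.
    rewrite (perm1_eq w) /= eqxx; apply/forallP => x; by rewrite perm1.
  by rewrite -/c => ->; rewrite mulr_ge0 // ler0n.
apply: eq_schur_positive (_ : schur_positive (fun N => c%:~R *: schur [::] N)); last first.
  by apply: schur_positive_scale; [rewrite ler0z|exact: schur_positive_schur].
move=> N; rewrite /immanant (big_pred1 1%g) => [|w]; last by rewrite (perm1_eq w) /= eqxx.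
rewrite big_ord1 mxE perm1 /= ab (_ : _ - _ = 0); last by lia.
rewrite schur_nil -mul_mpolyC mulr1.
rewrite (_ : hsym 0 N = 1) ?mulr1 ?rmorph_int //.
rewrite /hsym /= -[RHS](@mpolyX0 N rat).
have lt : (mdeg (0%MM : 'X_{1..N}) < 1)%N by rewrite mdeg0.
rewrite (big_pred1 (BMultinom lt)) // => x; rewrite mdeg_eq0.
by rewrite -(inj_eq val_inj).
Qed.

(** The Kostka number of the empty partition and zero content is 1, as is [nonneg_content] of an
    empty shape: one summand suffices. *)
Lemma ss_decomposable_empty : ss_decomposable a b 1.
Proof.
move=> th; rewrite /row_sum big_ord1 ab subnn => /andP[hth /eqP sth].
have -> : th = [::].
  by apply/nilP; rewrite /nilp -leqn0 -sth; apply: size_le_sumn.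
have hs : skew_rows a b 1 by split=> [[|i]|[|i]|[|i]] //; rewrite ab.
apply: (SsCons hs _ (@ss_sum0 1 _)) => // w; rewrite addn0; apply: eq_conj_sum => {}w.
have z i : jt_entry a b w i = 0.
  by rewrite (perm1_eq w) /jt_entry invg1 perm1 !ord1 /= ab subrr.
have nobox (x : box [::]) : false by case: x => -[].
rewrite /kostka /nonneg_content (_ : [set _ | _] = setT).
  rewrite cardsT card_ffun card_ord exp1n.
  by rewrite (_ : [forall i, _] = true) //; apply/forallP => i; rewrite z.
apply/setP => T; rewrite !inE; apply/andP; split.
  by apply/forallP => x; have := nobox x.
by apply/forallP => i; rewrite z; apply/eqP; congr _%:Z; apply: eq_card0 => x; have := nobox x.
Qed.

End Empty.

Theorem reduction_to_connected :
  (forall mu nu n, skew_shape mu nu -> connected_skew mu nu -> n = skew_length mu nu ->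
     P1 mu nu n /\ P2 mu nu n) ->
  forall n a b, (0 < n)%N -> skew_rows a b n ->
    monomial_positive a b n /\ ss_decomposable a b n.
Proof.
move=> conn n; have [N] := ubnP n; elim: N n => // N IH n; rewrite ltnS => nN a b n0 hr.
case: (hr) => da db ba.
case: (boolP [exists k : 'I_n, (0 < k)%N && (a k <= b k.-1)%N]) => [/existsP[k /andP[k0 le]]|].
  have kn := ltn_ord k; pose m := (n - k)%N.
  have nE : n = (k + m)%N by rewrite subnKC // ltnW.
  have hs : splits a b k m.
    move=> i j /andP[ki ikm] jk; rewrite -nE in ikm.
    have ale : (a i <= a k)%N.
      elim: i ki ikm => [|i IHi] ki ikm; first by move: ki; rewrite leqn0 => /eqP ->.
      move: ki; rewrite leq_eqVlt => /orP[/eqP <- //|ki].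
      by apply: leq_trans (IHi ki (ltnW ikm)); apply: da.
    apply: leq_trans ale (leq_trans le _).
    have : (j <= k.-1)%N by lia.
    have : (k.-1 < n)%N by lia.
    elim: (k.-1) => [|l IHl] ln; first by rewrite leqn0 => /eqP ->.
    rewrite leq_eqVlt => /orP[/eqP -> //|jl].
    by apply: leq_trans (db l ln) _; apply: IHl => //; apply: ltnW.
  have hr1 : skew_rows a b k.
    by split=> i ik; [apply: da|apply: db|apply: ba]; lia.
  have hr2 : skew_rows (fun i => a (k + i)%N) (fun i => b (k + i)%N) m.
    by split=> i ik; rewrite ?addnS; [apply: da|apply: db|apply: ba]; lia.
  have [||p1 d1] := IH k _ a b _ hr1; [lia|lia|].
  have [||p2 d2] := IH m _ _ _ _ hr2; [lia|lia|].
  rewrite nE; split; first exact: monomial_positive_split.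
  by apply: ss_decomposable_split => //; rewrite -nE.
rewrite negb_exists => /forallP nosplit.
have overlap i : (i.+1 < n)%N -> (b i < a i.+1)%N.
  move=> ik; have := nosplit (Ordinal ik); by rewrite /= -ltnNge.
case: (ltnP (b 0) (a 0)) => [ba0|ab0]; last first.
  have ab : a 0 = b 0 by apply/eqP; rewrite eqn_leq ab0 ba.
  (* A second row would give a 1 <= a 0 = b 0, against the overlap. *)
  have n1 : n = 1%N.
    case: (n) n0 da overlap => // -[//|n'] _ da' ov.
    by have := leq_trans (ov 0%N isT) (da' 0%N isT); rewrite ab ltnn.
  by rewrite n1; split; [exact: monomial_positive_empty|exact: ss_decomposable_empty].
have row i : (i < n)%N -> (b i < a i)%N.
  by case: i => // i ik; apply: leq_ltn_trans (db i ik) (overlap i ik).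
have pos : (0 < row_sum a b n)%N.
  by rewrite /row_sum (bigD1 (Ordinal n0)) //= addn_gt0 subn_gt0 ba0.
have [sh len ea eb] := to_partition_shape hr pos.
set al := to_partition n a in sh len ea; set be := to_partition n b in sh len eb.
have out i : (n <= i)%N -> part al i = 0%N.
  by move=> ni; rewrite part_to_partition // ltnNge ni.
have hbe : nonincr (part be) by case: sh => _ h _ _; apply: part_nonincr.
have [lenE hconn] : skew_length al be = n /\ connected_skew al be.
  apply: overlap_connected => // i ik; first by rewrite ea ?eb ?row // inE.
  by rewrite ea ?eb ?overlap // inE // ltnW.
have [h1 h2] := conn al be n sh hconn (esym lenE).
split; first exact: eq_monomial_positive ea eb (P1_monomial_positive h1).
exact: eq_ss_decomposable ea eb (P2_ss_decomposable len h2).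
Qed.

Theorem corollary3p6 :
  (forall (mu nu : seq nat) (n : nat),
      skew_shape mu nu -> connected_skew mu nu -> n = skew_length mu nu ->
      P1 mu nu n /\ P2 mu nu n) ->
  (forall (mu nu : seq nat) (n : nat),
      skew_shape mu nu -> (skew_length mu nu <= n)%N ->
      P1 mu nu n /\ P2 mu nu n).
Proof.
move=> conn mu nu n sh len.
have pos : (0 < skew_size mu nu)%N by case: sh.
have n0 : (0 < n)%N.
  by rewrite lt0n; apply: contraTneq pos => n0; rewrite -(row_sum_skew_size len) n0
     /row_sum big_ord0.
have [h1 h2] := reduction_to_connected conn n0 (skew_shape_rows n sh).
by split; [exact: monomial_positive_P1|exact: ss_decomposable_P2].
Qed.
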